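(* Let $\mu\in\mathrm{AC}^2([0,1];(\mathcal M(\Omega),\mathsf{HK}))$. Then there exists a Borel vector field $(\Xi,\xi):[0,1]\times\Omega\to\mathbb R^{d+1}$ such that the continuity equation $$\tfrac{\mathrm d}{\mathrm dt}\mu+\operatorname{div}(\Xi\mu)=4\xi\mu$$ is satisfied (in the distributional sense) and $$\int_\Omega\Big[|\Xi(t,x)|^2+4|\xi(t,x)|^2\Big]\,\mathrm d\mu(t)(x)\le|\dot\mu|_{\mathsf{HK}}(t)^2\quad\text{for a.e. }t\in[0,1].$$
   Context: $\Omega\subset\mathbb R^d$ is convex and compact; $\mathcal M(\Omega)$ is the set of finite nonnegative Borel measures on $\Omega$. The cone over $\Omega$ is $\mathfrak C_\Omega:=(\Omega\times[0,\infty[)/(\Omega\times\{0\})$, with points $[x,r]$, and metric $\mathsf d_{\mathfrak C}([x_0,r_0],[x_1,r_1])^2=r_0^2+r_1^2-2r_0r_1\cos_\pi(|x_0-x_1|)$, $\cos_\pi(L)=\cos(\min\{L,\pi\})$. $\mathcal M_2(\mathfrak C_\Omega)$ is the set of finite nonnegative Borel measures with $\int r^2\mathrm d\lambda<\infty$. $\mathsf W_{\mathfrak C}(\lambda_0,\lambda_1)^2=\inf\iint\mathsf d_{\mathfrak C}^2\,\mathrm d\gamma$ over nonnegative measures $\gamma$ on $\mathfrak C_\Omega\times\mathfrak C_\Omega$ with marginals $\lambda_0,\lambda_1$ ($=\infty$ if the masses differ). The projection $\mathfrak P:\mathcal M_2(\mathfrak C_\Omega)\to\mathcal M(\Omega)$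 is given by $\int_\Omega\phi\,\mathrm d\mathfrak P\lambda=\int r^2\phi(x)\,\mathrm d\lambda([x,r])$, $\phi\in\mathrm C^0(\Omega)$. The Hellinger–Kantorovich distance is $\mathsf{HK}(\mu_0,\mu_1)=\min\{\mathsf W_{\mathfrak C}(\lambda_0,\lambda_1)\mid\mathfrak P\lambda_j=\mu_j\}$. $\mathrm{AC}^2([0,1];(Y,\mathsf D))$ is the set of curves $u$ for which there is $m\in\mathrm L^2(0,1)$ with $\mathsf D(u(s),u(t))\le\int_s^tm(r)\,\mathrm dr$ for all $0\le s<t\le1$; $|\dot u|_{\mathsf D}(t)=\lim_{s\to t}\mathsf D(u(t),u(s))/|t-s|$ is the metric derivative (existing for a.e. $t$). The continuity equation in the distributional sense means: for all $\psi\in\mathrm C^1_c(]0,1[)$ and $\eta\in\mathrm C^1(\mathbb R^d)$, $\int_0^1\dot\psi\int_\Omega\eta\,\mathrm d\mu(t)\,\mathrm dt=-\int_0^1\psi\int_\Omega(\nabla\eta\cdot\Xi+4\eta\xi)\,\mathrm d\mu(t)\,\mathrm dt$. *)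

(* Defs.v *)
From HB Require Import structures.
From mathcomp Require Import all_boot all_order all_algebra generic_quotient.
From mathcomp Require Import all_classical all_reals all_analysis.
Set Implicit Arguments.
Unset Strict Implicit.
Unset Printing Implicit Defensive.
Import Order.TTheory GRing.Theory Num.Theory.
Import numFieldNormedType.Exports.
Local Open Scope classical_set_scope.
Local Open Scope quotient_scope.
Local Open Scope ring_scope.

(* The library norm on 'rV[R]_d is the sup norm, so the Euclidean structure is
   given separately; both norms induce the same topology. *)
Definition dot {R : realType} {d : nat} (u v : 'rV[R]_d) : R :=
  \sum_(i < d) u 0 i * v 0 i.

Definition enorm {R : realType} {d : nat} (u : 'rV[R]_d) : R :=
  Num.sqrt (dot u u).

Definition grad {R : realType} {d : nat} (eta : 'rV[R]_d -> R) (x : 'rV[R]_d)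
    : 'rV[R]_d :=
  \row_i 'D_(delta_mx 0 i) eta x.

(* 'rV[R]_d with its Borel sigma-algebra *)
Definition euclidean (R : realType) (d : nat) :=
  g_sigma_algebraType (@open 'rV[R]_d).

(* A finite Borel measure on a closed set Omega is represented by its extension
   by zero to R^d. *)
Record measure_on (R : realType) (d : nat) (Omega : set 'rV[R]_d) := MeasureOn {
  mu_of :> {finite_measure set (euclidean R d) -> \bar R} ;
  _ : mu_of (~` Omega) = 0%E }.

Section Cone.
Variables (R : realType) (d : nat).

Definition cone_rel (p q : 'rV[R]_d * {nonneg R}) : bool :=
  (p == q) || ((p.2%:num == 0) && (q.2%:num == 0)).

Lemma cone_rel_refl : reflexive cone_rel.
Proof. by move=> p; rewrite /cone_rel eqxx. Qed.

Lemma cone_rel_sym : symmetric cone_rel.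
Proof. by move=> p q; rewrite /cone_rel eq_sym andbC. Qed.

Lemma cone_rel_trans : transitive cone_rel.
Proof.
move=> q p s; rewrite /cone_rel.
case/orP => [/eqP -> //|/andP[p0 q0]].
by case/orP => [/eqP <-|/andP[_ ->]]; rewrite p0 ?q0 orbT.
Qed.

Canonical cone_equiv :=
  EquivRel cone_rel cone_rel_refl cone_rel_sym cone_rel_trans.

(* The cone over the whole of R^d; the cone over Omega is the subset
   [cone_over Omega] below. *)
Definition cone_quot := {eq_quot cone_equiv}.
HB.instance Definition _ := Choice.on cone_quot.
HB.instance Definition _ := EqQuotient.on cone_quot.

(* the point [x, r] of the cone *)
Definition cone_pt (x : 'rV[R]_d) (r : {nonneg R}) : cone_quot :=
  \pi_cone_quot (x, r).

(* cone_pos is an arbitrary point when z is the apex, where cone_rad z = 0. *)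
Definition cone_pos (z : cone_quot) : 'rV[R]_d := (repr z).1.
Definition cone_rad (z : cone_quot) : R := (repr z).2%:num.

Definition cospi (L : R) : R := cos (Num.min L pi).

Definition dcone (z0 z1 : cone_quot) : R :=
  Num.sqrt (cone_rad z0 ^+ 2 + cone_rad z1 ^+ 2
    - 2 * cone_rad z0 * cone_rad z1
      * cospi (enorm (cone_pos z0 - cone_pos z1))).

(* the open sets of the topology of dcone *)
Definition dcone_open (U : set cone_quot) : Prop :=
  forall z, U z -> exists2 e : R, 0 < e & forall z', dcone z z' < e -> U z'.

Lemma cone_radE x r : cone_rad (cone_pt x r) = r%:num.
Proof.
rewrite /cone_rad /cone_pt; case: piP => q.
by move=> /eqmodP /orP [/eqP <- //|/= /andP[/eqP -> /eqP ->]].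
Qed.

Lemma cone_posE x r : r%:num != 0 -> cone_pos (cone_pt x r) = x.
Proof.
rewrite /cone_pos /cone_pt => r0; case: piP => q.
by move=> /eqmodP /orP [/eqP <- //|/=]; rewrite (negbTE r0).
Qed.

(* dcone does not depend on the representatives *)
Lemma dconeE x0 r0 x1 r1 : dcone (cone_pt x0 r0) (cone_pt x1 r1) =
  Num.sqrt (r0%:num ^+ 2 + r1%:num ^+ 2
    - 2 * r0%:num * r1%:num * cospi (enorm (x0 - x1))).
Proof.
rewrite /dcone !cone_radE.
have [->|n0] := eqVneq r0%:num 0; first by rewrite !(mulr0, mul0r).
have [->|n1] := eqVneq r1%:num 0; first by rewrite !(mulr0, mul0r).
by rewrite !cone_posE.
Qed.

End Cone.

HB.instance Definition _ (R : realType) (d : nat) :=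
  isPointed.Build (cone_quot R d) (cone_pt 0 0%:nng).

(* the cone with the Borel sigma-algebra of the metric dcone *)
Definition cone (R : realType) (d : nat) := g_sigma_algebraType (@dcone_open R d).

Section HellingerKantorovich.
Variables (R : realType) (d : nat) (Omega : set 'rV[R]_d).

Definition cone_over : set (cone R d) :=
  [set cone_pt x r | x in Omega & r in [set: {nonneg R}]].

(* As for [measure_on], measures on the cone over Omega are extended by zero. *)
Record cone_measure2 := ConeMeasure2 {
  lambda_of :> {finite_measure set (cone R d) -> \bar R} ;
  _ : lambda_of (~` cone_over) = 0%E ;
  _ : (\int[lambda_of]_z (cone_rad z ^+ 2)%:E < +oo)%E }.

Definition is_plan (l0 l1 : cone_measure2)
    (gamma : {measure set (cone R d * cone R d)%type -> \bar R}) : Prop :=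
  forall A : set (cone R d), measurable A ->
    gamma (A `*` setT) = l0 A /\ gamma (setT `*` A) = l1 A.

(* +oo when the total masses differ, as there is then no plan *)
Definition Wcone (l0 l1 : cone_measure2) : \bar R :=
  sqrte (ereal_inf [set (\int[gamma]_p (dcone p.1 p.2 ^+ 2)%:E)%E
                   | gamma in is_plan l0 l1]).

(* [is_proj l m] says that the projection of l is m. *)
Definition is_proj (l : cone_measure2) (m : measure_on Omega) : Prop :=
  forall phi : 'rV[R]_d -> R, {within Omega, continuous phi} ->
    (\int[m]_(x in Omega) (phi x)%:E =
     \int[l]_(z in cone_over) (cone_rad z ^+ 2 * phi (cone_pos z))%:E)%E.

(* The infimum is in fact a minimum. *)
Definition HK (m0 m1 : measure_on Omega) : \bar R :=
  ereal_inf [set Wcone l0 l1 | l0 in [set l | is_proj l m0]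
                             & l1 in [set l | is_proj l m1]].

End HellingerKantorovich.

(* Curves on [0, 1] are functions on R of which only the values on [0, 1] are
   used; distances may take the value +oo. *)
Section Curves.
Variables (R : realType) (Y : Type) (D : Y -> Y -> \bar R).

Definition AC2 (u : R -> Y) : Prop :=
  exists m : R -> R,
    [/\ measurable_fun (`]0, 1[ : set R) m,
        (\int[lebesgue_measure]_(r in `]0%R, 1%R[) (`|m r| ^+ 2)%:E < +oo)%E
      & forall s t : R, 0 <= s -> s < t -> t <= 1 ->
          (D (u s) (u t) <= \int[lebesgue_measure]_(r in `]s, t[) (m r)%:E)%E].

(* The limit is taken over s in [0, 1], s != t. For curves in AC2 it exists for
   almost every t; elsewhere [lim] returns a default value. *)
Definition metric_derivative (u : R -> Y) (t : R) : \bar R :=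
  lim ((D (u t) (u s) * (`|t - s|^-1)%:E)%E @[s --> within `[0, 1] (t^')]).

End Curves.

Definition C1c01 (R : realType) (psi : R -> R) : Prop :=
  [/\ forall t, derivable psi t 1, continuous (derive1 psi),
      compact (closure [set t | psi t != 0])
    & closure [set t | psi t != 0] `<=` `]0, 1[].

Definition C1 (R : realType) (d : nat) (eta : 'rV[R]_d -> R) : Prop :=
  (forall x, differentiable eta x) /\ continuous (grad eta).

Definition continuity_equation (R : realType) (d : nat) (Omega : set 'rV[R]_d)
    (mu : R -> measure_on Omega)
    (Xi : R -> 'rV[R]_d -> 'rV[R]_d) (xi : R -> 'rV[R]_d -> R) : Prop :=
  forall (psi : R -> R) (eta : 'rV[R]_d -> R), C1c01 psi -> C1 eta ->
    (\int[lebesgue_measure]_(t in `]0%R, 1%R[)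
       ((derive1 psi t)%:E * \int[mu t]_(x in Omega) (eta x)%:E) =
     - \int[lebesgue_measure]_(t in `]0%R, 1%R[)
       ((psi t)%:E * \int[mu t]_(x in Omega)
          (dot (grad eta x) (Xi t x) + 4 * eta x * xi t x)%:E))%E.

(* Only the restrictions of Xi and xi to [0, 1] x Omega matter. *)
Definition borel_field (R : realType) (d : nat) (Omega : set 'rV[R]_d)
    (Xi : R -> 'rV[R]_d -> 'rV[R]_d) (xi : R -> 'rV[R]_d -> R) : Prop :=
  measurable_fun ([set` `[0, 1]] `*` Omega : set (R * euclidean R d)%type)
    (fun p => (Xi p.1 p.2 : euclidean R d, xi p.1 p.2)).

(* Main.v *)
(* For a plan between liftings of mu_0 and mu_1 to the cone, Cauchy-Schwarz bounds
   the increment of the integral of a C^1 function eta by the cost of the plan times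
   the mean over mu_0 and mu_1 of |grad eta|^2 + 4 eta^2, up to a small error.
   Along the curve, the integral of eta against mu(t) is thus absolutely continuous,
   with 2 d/dt int eta dmu(t) <= int (|grad eta|^2 + 4 eta^2) dmu(t) + |mu'|(t)^2
   for almost every t. Hence the time integral of psi d/dt int eta dmu(t) is a bounded
   linear functional of psi (grad eta, 2 eta) in L^2(dmu(t) dt), and (Xi, 2 xi) is its
   Riesz representative in the closure of these fields. The same inequality for
   fields restricted to a Borel set of times gives the bound for almost every t. *)
From HB Require Import structures.
Require Import Defs.
From mathcomp Require Import all_boot all_order all_algebra.
From mathcomp Require Import all_classical all_reals all_analysis.
From mathcomp Require Import measurable_realfun.
From mathcomp Require Import ring lra.
Import Order.TTheory GRing.Theory Num.Theory.
Import numFieldNormedType.Exports.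
Local Open Scope classical_set_scope.
Local Open Scope ring_scope.
Set Implicit Arguments.
Unset Strict Implicit.
Unset Printing Implicit Defensive.

(** The derivative estimate is kept in additive AM-GM form because a sum, unlike a product of square
    roots, integrates over any Borel set of times; the sharp constant comes back by rescaling the
    test field. To replace |mu'| by a measurable function v, the proof needs the triangle inequality
    for HK. The obstacle is that plans from mu_0 to mu_1 and from mu_1 to mu_2 may use different
    liftings of mu_1. Since only projections matter, a plan is described by its base marginals
    weighted by r^2. Each pair can then be dilated so that its middle point has radius 1, and two
    plans are joined over small cells of the middle measure. The error tends to 0 with the cell size
    and is absorbed by strict inequalities. In the same way every bound on HK becomes a bound on the
    cost of some plan, and minimizers are never invoked. The factor 4 has its origin in the polar
    form (r0 - r1)^2 + r0 r1 chord2 of the squared cone distance: the increment of r^2 eta has a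
    radial part, of slope 2 eta, and an angular part, of slope grad eta. The curve is extended to
    all real times by constants, so that densities and derivatives live on R and endpoints enter
    only at the close. *)

Local Notation cospi := Defs.cospi.

(** * Euclidean inner product and norm *)

Section Euclidean.
Variables (R : realType) (d : nat).
Implicit Types (u v w : 'rV[R]_d) (a : R).

Lemma dotC u v : dot u v = dot v u.
Proof. by apply: eq_bigr => i _; rewrite mulrC. Qed.

Lemma dotDl u v w : dot (u + v) w = dot u w + dot v w.
Proof. by rewrite -big_split; apply: eq_bigr => i _; rewrite mxE mulrDl. Qed.

Lemma dotDr u v w : dot w (u + v) = dot w u + dot w v.
Proof. by rewrite !(dotC w) dotDl. Qed.

Lemma dotZl a u v : dot (a *: u) v = a * dot u v.
Proof. by rewrite mulr_sumr; apply: eq_bigr => i _; rewrite mxE mulrA. Qed.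

Lemma dotZr a u v : dot u (a *: v) = a * dot u v.
Proof. by rewrite dotC dotZl dotC. Qed.

Lemma dotNl u v : dot (- u) v = - dot u v.
Proof. by rewrite -scaleN1r dotZl mulN1r. Qed.

Lemma dotNr u v : dot u (- v) = - dot u v.
Proof. by rewrite dotC dotNl dotC. Qed.

Lemma dot0l u : dot 0 u = 0.
Proof. by rewrite -(scale0r u) dotZl mul0r. Qed.

Lemma dot_ge0 u : 0 <= dot u u.
Proof. by apply: sumr_ge0 => i _; rewrite -expr2 sqr_ge0. Qed.

Lemma enorm_ge0 u : 0 <= enorm u.
Proof. exact: sqrtr_ge0. Qed.

Lemma enorm_sqr u : enorm u ^+ 2 = dot u u.
Proof. by rewrite sqr_sqrtr // dot_ge0. Qed.

Lemma enorm0 : enorm (0 : 'rV[R]_d) = 0.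
Proof. by rewrite /enorm dot0l sqrtr0. Qed.

Lemma enormN u : enorm (- u) = enorm u.
Proof. by rewrite /enorm dotNl dotNr opprK. Qed.

Lemma enormB u v : enorm (u - v) = enorm (v - u).
Proof. by rewrite -enormN opprB. Qed.

(** Expanding the squared norm of (v.v) u - (u.v) v gives (v.v) ((u.u) (v.v) - (u.v)^2) >= 0.
    Dividing needs v.v > 0; if v.v = 0 then v = 0. *)
Lemma dot_sqr_le u v : dot u v ^+ 2 <= dot u u * dot v v.
Proof.
have H : 0 <= dot (dot v v *: u - dot u v *: v) (dot v v *: u - dot u v *: v).
  exact: dot_ge0.
have [v0|vN0] := eqVneq (dot v v) 0.
  have {}v0 i : v 0 i = 0.
    move/eqP : v0; rewrite psumr_eq0; last by move=> j _; rewrite -expr2 sqr_ge0.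
    by move/allP => /(_ i); rewrite mem_index_enum -expr2 sqrf_eq0 => /(_ erefl) /eqP.
  rewrite {1}/dot big1 ?expr0n ?mulr_ge0 ?dot_ge0 // => i _.
  by rewrite v0 mulr0.
have vp : 0 < dot v v by rewrite lt_neqAle eq_sym vN0 dot_ge0.
rewrite dotDl !dotDr !dotNl !dotNr !dotZl !dotZr (dotC v u) in H.
rewrite -(ler_pM2l vp) -subr_ge0.
apply: le_trans H _; rewrite le_eqVlt; apply/orP; left; apply/eqP; ring.
Qed.

Lemma dot_le_enorm u v : dot u v <= enorm u * enorm v.
Proof.
apply: le_trans (ler_norm _) _; rewrite -sqrtrM ?dot_ge0 // -sqrtr_sqr.
by rewrite ler_sqrt ?mulr_ge0 ?dot_ge0 // dot_sqr_le.
Qed.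

Lemma enormD u v : enorm (u + v) <= enorm u + enorm v.
Proof.
rewrite -(@ler_pXn2r _ 2) ?nnegrE ?addr_ge0 ?enorm_ge0 //.
rewrite sqrrD !enorm_sqr dotDl !dotDr (dotC v u).
have := dot_le_enorm u v; lra.
Qed.

Lemma enorm_triangle u v w : enorm (u - w) <= enorm (u - v) + enorm (v - w).
Proof. by rewrite -[u - w](subrKA v) enormD. Qed.

Lemma coord_le_enorm u i : `|u 0 i| <= enorm u.
Proof.
rewrite -sqrtr_sqr ler_sqrt ?dot_ge0 // /dot (bigD1 i) //= expr2 lerDl.
by apply: sumr_ge0 => j _; rewrite -expr2 sqr_ge0.
Qed.

Lemma enorm_le_coord u a : 0 <= a -> (forall i, `|u 0 i| <= a) ->
  enorm u <= Num.sqrt d%:R * a.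
Proof.
move=> a0 ua; rewrite -[a](ger0_norm a0) -sqrtr_sqr -sqrtrM ?ler0n //.
rewrite ler_sqrt ?mulr_ge0 ?sqr_ge0 ?ler0n //.
have -> : d%:R * a ^+ 2 = \sum_(i < d) a ^+ 2.
  by rewrite sumr_const card_ord mulr_natl.
apply: ler_sum => i _; rewrite -expr2 -real_normK ?num_real //.
by rewrite ler_pXn2r ?nnegrE.
Qed.

End Euclidean.

(** * Squared cone distance in polar form and its triangle inequality *)

Section ConeDistance.
Variable R : realType.
Implicit Types (L a b r s t : R).

Lemma cospi_le1 L : cospi L <= 1.
Proof. exact: cos_le1. Qed.

Lemma cospi_geN1 L : -1 <= cospi L.
Proof. exact: cos_geN1. Qed.

Lemma cospi0 : cospi (0 : R) = 1.
Proof. by rewrite /cospi min_l ?cos0 // pi_ge0. Qed.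

Lemma cospi_small L : L <= pi -> cospi L = cos L.
Proof. by move=> h; rewrite /cospi min_l. Qed.

Lemma cospi_large L : pi <= L -> cospi L = -1.
Proof. by move=> h; rewrite /cospi min_r // trigo.cospi. Qed.

Lemma cospi_homo a b : 0 <= a -> a <= b -> cospi b <= cospi a.
Proof.
move=> a0 ab; have b0 := le_trans a0 ab.
have [bp|bp] := leP b pi.
  have ap := le_trans ab bp.
  rewrite !cospi_small //.
  by rewrite leNgt ltr_cos ?in_itv /= ?a0 ?b0 ?bp ?ap // -leNgt.
by rewrite (cospi_large (ltW bp)) cospi_geN1.
Qed.

(** A triangle inequality that is linear in the squares, so that it survives integration against a
    plan; t is optimized only after integrating, in [HK_triangle_lt]. *)
Lemma sqrD_le t a b : 0 < t ->
  (a + b) ^+ 2 <= (1 + t) * a ^+ 2 + (1 + t^-1) * b ^+ 2.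
Proof.
move=> t0; rewrite -subr_ge0.
have -> : (1 + t) * a ^+ 2 + (1 + t^-1) * b ^+ 2 - (a + b) ^+ 2 =
  t^-1 * (t * a - b) ^+ 2.
  by field; rewrite gt_eqF.
by rewrite mulr_ge0 ?sqr_ge0 // invr_ge0 ltW.
Qed.

Definition cdist2 r s L := r ^+ 2 + s ^+ 2 - 2 * r * s * cospi L.

Lemma cdist2_homo r s a b : 0 <= r -> 0 <= s -> 0 <= a -> a <= b ->
  cdist2 r s a <= cdist2 r s b.
Proof.
move=> r0 s0 a0 ab; rewrite lerD2l lerN2.
by rewrite ler_wpM2l ?cospi_homo // mulr_ge0 // mulr_ge0.
Qed.

(** By the law of cosines the three expressions are squared distances between the planar points of
    polar coordinates (r0, a), (r1, 0), (r2, -b); [sqrD_le] is applied to each Cartesian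
    coordinate. *)
Lemma cdist2_planar r0 r1 r2 a b t : 0 < t ->
  r0 ^+ 2 + r2 ^+ 2 - 2 * r0 * r2 * cos (a + b) <=
  (1 + t) * (r0 ^+ 2 + r1 ^+ 2 - 2 * r0 * r1 * cos a) +
  (1 + t^-1) * (r1 ^+ 2 + r2 ^+ 2 - 2 * r1 * r2 * cos b).
Proof.
move=> t0; rewrite cosD.
have ea := cos2Dsin2 a; have eb := cos2Dsin2 b.
have h1 := sqrD_le (r0 * cos a - r1) (r1 - r2 * cos b) t0.
have h2 := sqrD_le (r0 * sin a) (r2 * sin b) t0.
move: h1 h2 ea eb; move: (cos a) (sin a) (cos b) (sin b) => ca sa cb sb.
move=> h1 h2 ea eb.
have := lerD h1 h2.
have -> : (r0 * ca - r1 + (r1 - r2 * cb)) ^+ 2 + (r0 * sa + r2 * sb) ^+ 2 =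
  r0 ^+ 2 * (ca ^+ 2 + sa ^+ 2) + r2 ^+ 2 * (cb ^+ 2 + sb ^+ 2)
  - 2 * r0 * r2 * (ca * cb - sa * sb) by ring.
set X := (X in _ <= X -> _); set Y := (Y in _ -> _ <= Y).
have -> : X = (1 + t) * (r0 ^+ 2 * (ca ^+ 2 + sa ^+ 2) + r1 ^+ 2 - 2 * r0 * r1 * ca) +
  (1 + t^-1) * (r1 ^+ 2 + r2 ^+ 2 * (cb ^+ 2 + sb ^+ 2) - 2 * r1 * r2 * cb).
  by rewrite /X; ring.
by rewrite ea eb !mulr1.
Qed.

(** When a + b <= pi the three points unfold in the plane. Otherwise the path through the apex
    governs: the left-hand side is at most (r0 + r2)^2, and this is what each case compares with the
    right-hand side. *)
Lemma cdist2_triangle r0 r1 r2 a b c t : 0 < t ->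
  0 <= r0 -> 0 <= r1 -> 0 <= r2 -> 0 <= a -> 0 <= b -> 0 <= c -> c <= a + b ->
  cdist2 r0 r2 c <= (1 + t) * cdist2 r0 r1 a + (1 + t^-1) * cdist2 r1 r2 b.
Proof.
move=> t0 r00 r10 r20 a0 b0 c0 cab.
have u0 : 0 <= 1 + t by lra.
have v0 : 0 <= 1 + t^-1 by rewrite addr_ge0 // invr_ge0 ltW.
have big : cdist2 r0 r2 c <= (r0 + r2) ^+ 2.
  rewrite /cdist2; have : 0 <= r0 * r2 * (1 + cospi c).
    by rewrite mulr_ge0 ?mulr_ge0 // addrC -[1]opprK subr_ge0 cospi_geN1.
  by move=> h; nra.
have small r s L : 0 <= r -> 0 <= s -> (r - s) ^+ 2 <= cdist2 r s L.
  move=> rr ss; rewrite /cdist2.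
  have : 0 <= r * s * (1 - cospi L) by rewrite mulr_ge0 ?mulr_ge0 // subr_ge0 cospi_le1.
  by move=> h; nra.
have [api|api] := leP pi a.
  apply: le_trans big _.
  have -> : r0 + r2 = (r0 + r1) + (r2 - r1) by ring.
  apply: le_trans (sqrD_le _ _ t0) _; apply: lerD; rewrite ler_wpM2l //.
    by rewrite /cdist2 cospi_large //; lra.
  apply: le_trans (small _ _ _ r10 r20); lra.
have [bpi|bpi] := leP pi b.
  apply: le_trans big _.
  have -> : r0 + r2 = (r0 - r1) + (r2 + r1) by ring.
  apply: le_trans (sqrD_le _ _ t0) _; apply: lerD; rewrite ler_wpM2l //.
    exact: small.
  by rewrite /cdist2 cospi_large //; lra.
have [abpi|abpi] := leP (a + b) pi.
  apply: le_trans (cdist2_homo r00 r20 c0 cab) _.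
  rewrite /cdist2 !cospi_small //; try exact: ltW.
  exact: cdist2_planar.
(* Here a, b < pi < a + b. Shortening b to pi - a makes the total angle exactly pi, where the planar
   left-hand side is (r0 + r2)^2. *)
apply: le_trans big _.
have b'0 : 0 <= pi - a by rewrite subr_ge0 ltW.
have b'b : pi - a <= b by lra.
have -> : (r0 + r2) ^+ 2 = r0 ^+ 2 + r2 ^+ 2 - 2 * r0 * r2 * cos (a + (pi - a)).
  by rewrite subrKC trigo.cospi; ring.
apply: le_trans (cdist2_planar r0 r1 r2 a (pi - a) t0) _.
apply: lerD; first by rewrite /cdist2 cospi_small // ltW.
rewrite ler_wpM2l // -[cos (pi - a)]cospi_small; last lra.
exact: cdist2_homo.
Qed.

Lemma cdist2_ge r s L : 0 <= r -> 0 <= s -> (r - s) ^+ 2 <= cdist2 r s L.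
Proof.
move=> rr ss; rewrite /cdist2.
have : 0 <= r * s * (1 - cospi L).
  by rewrite mulr_ge0 ?mulr_ge0 // subr_ge0 cospi_le1.
by move=> h; nra.
Qed.

Lemma cdist2_ge0 r s L : 0 <= r -> 0 <= s -> 0 <= cdist2 r s L.
Proof. by move=> r0 s0; apply: le_trans (cdist2_ge _ r0 s0); exact: sqr_ge0. Qed.

End ConeDistance.

(** * Borel structures on the space and on the cone *)

Lemma measurable_fun_generated dT (T : measurableType dT) (S : pointedType)
    (G : set (set S)) (f : T -> g_sigma_algebraType G) :
  (forall U, G U -> measurable (f @^-1` U)) -> measurable_fun setT f.
Proof.
move=> fG; apply: (@measurability _ _ T (g_sigma_algebraType G) setT f G) => //.
by move=> _ [U GU <-]; rewrite setTI; exact: fG.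
Qed.

Section BorelMaps.
Variables (R : realType) (d : nat).

Lemma measurable_fun_open dT (T : measurableType dT) (f : T -> R) :
  (forall O : set R, open O -> measurable (f @^-1` O)) -> measurable_fun setT f.
Proof.
move=> fO; apply: (measurability _ (RGenOInfty.measurableE R)) => //.
move=> _ [_ [x ->] <-]; rewrite setTI; apply: fO; exact: interval_open.
Qed.

(** Inversion is continuous off 0 only; the point 0, sent to itself by [invr0], is split off.
    Dilations of radii require it. *)
Lemma measurable_inv : measurable_fun setT (@GRing.inv R).
Proof.
apply: measurable_fun_open => O oO.
have -> : @GRing.inv R @^-1` O = ([set x | x != 0] `&` @GRing.inv R @^-1` O)
    `|` ([set 0] `&` [set _ | O 0]).
  apply/seteqP; split => [x Ox|x [[]//|[-> O0]]]; last by rewrite /preimage /= invr0.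
  have [x0|x0] := eqVneq x 0; last by left.
  by right; split => //; move: Ox; rewrite /preimage /= x0 invr0.
apply: measurableU.
  apply: open_measurable; rewrite openE => x [/= x0 Ox].
  apply: filterI.
    apply/nbhs_ballP; exists `|x|; rewrite /= ?normr_gt0 // => y; rewrite /ball /=.
    by apply: contraTneq => ->; rewrite subr0 ltxx.
  by apply: (inv_continuous x0); exact: open_nbhs_nbhs.
apply: measurableI => //; have [h|h] := pselect (O 0).
  by rewrite (_ : [set _ | _] = setT) //; apply/seteqP; split.
by rewrite (_ : [set _ | _] = set0) //; apply/seteqP; split.
Qed.

Lemma continuous_measurable_euclidean (f : 'rV[R]_d -> R) :
  continuous f -> measurable_fun setT (f : euclidean R d -> R).
Proof.
move=> /continuousP cf; apply: measurable_fun_open => O /cf oO.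
exact: sub_sigma_algebra.
Qed.

Lemma measurable_coord i :
  measurable_fun setT (fun x : euclidean R d => (x : 'rV[R]_d) 0 i).
Proof. by apply: continuous_measurable_euclidean; exact: coord_continuous. Qed.

Lemma closed_measurable_euclidean (A : set 'rV[R]_d) :
  closed A -> measurable (A : set (euclidean R d)).
Proof.
move=> cA; rewrite -[A]setCK; apply: measurableC; apply: sub_sigma_algebra.
exact: closed_openC.
Qed.

(* Boxes with rational centres and radii form a countable base. *)
Lemma measurable_preimage_open dT (T : measurableType dT)
    (f : T -> 'rV[R]_d) (g : T -> R) (W : set ('rV[R]_d * R)) :
  (forall i, measurable_fun setT (fun t => f t 0 i)) ->
  measurable_fun setT g -> open W -> measurable [set t | W (f t, g t)].
Proof.
move=> mf mg oW.
pose q (k : 'rV[rat]_d * rat * nat) : 'rV[R]_d * R :=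
  (\row_i ratr (k.1.1 0 i), ratr k.1.2).
pose box (k : 'rV[rat]_d * rat * nat) : set T :=
  [set t | (forall i, ball ((q k).1 0 i) k.2.+1%:R^-1 (f t 0 i)) /\
           ball (q k).2 k.2.+1%:R^-1 (g t)].
pose K := [set k | box k `<=` [set t | W (f t, g t)]].
have -> : [set t | W (f t, g t)] = \bigcup_k (box k `&` [set _ | K k]).
  apply/seteqP; split => [t Wt|t [k _ [+ Kk]]]; last exact: Kk.
  move: oW; rewrite openE => /(_ _ Wt) /= /nbhs_ballP [e /= e0 eW].
  (* With a radius below e / 2, two points of one box are at distance less than e. *)
  have [n ne] : exists n, n.+1%:R^-1 < e / 2.
    have := @near_infty_natSinv_lt R (PosNum (divr_gt0 e0 (ltr0Sn R 1))).
    by case=> N _ /(_ N (leqnn _)) /=; exists N.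
  have app (x : R) : exists r : rat, ball (ratr r : R) n.+1%:R^-1 x.
    have /rat_in_itvoo[r] : x - n.+1%:R^-1 < x + n.+1%:R^-1.
      by rewrite ltrBlDr -addrA ltrDl addr_gt0.
    rewrite in_itv /= => /andP[h1 h2]; exists r.
    by rewrite /ball /= ltr_distlC ltrBlDr h2 -ltrBlDr h1.
  have [r gr] := app (g t).
  have [Q Qf] := choice (fun i => app (f t 0 i)).
  exists (\row_i Q i, r, n) => //; split.
    by split => //= i; rewrite !mxE.
  have tri (c x y : R) : ball c n.+1%:R^-1 x -> ball c n.+1%:R^-1 y -> ball x e y.
    rewrite /ball /= => h1 h2; rewrite -[x - y](subrKA c).
    apply: le_lt_trans (ler_normD _ _) _; rewrite distrC [e]splitr.
    by rewrite ltrD // (lt_trans _ ne).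
  move=> s [/= sf sg]; apply: eW; split => /=; last exact: tri gr sg.
  split => // i j; rewrite !ord1.
  have := sf j; rewrite !mxE => h; exact: tri (Qf j) h.
apply: countable_bigcupT_measurable => // k; have [Kk|Kk] := pselect (K k).
  rewrite (_ : [set _ | K k] = setT) ?setIT; last by apply/seteqP; split.
  have -> : box k = (\bigcap_i ((fun t => f t 0 i) @^-1`
      ball ((q k).1 0 i) k.2.+1%:R^-1)) `&` g @^-1` ball (q k).2 k.2.+1%:R^-1.
    by apply/seteqP; split => t /= [h1 h2]; split => // i; [move=> _|]; exact: h1.
  apply: measurableI; last first.
    by rewrite -[X in measurable X]setTI; apply: mg => //; exact: measurable_ball.
  apply: fin_bigcap_measurable => // i _.
  by rewrite -[X in measurable X]setTI; apply: mf => //; exact: measurable_ball.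
by rewrite (_ : [set _ | K k] = set0) ?setI0 //; apply/seteqP; split.
Qed.

Lemma measurable_fun_euclidean dT (T : measurableType dT) (f : T -> euclidean R d) :
  (forall i, measurable_fun setT (fun t => (f t : 'rV[R]_d) 0 i)) ->
  measurable_fun setT f.
Proof.
move=> mf; apply: measurable_fun_generated => U oU.
have := @measurable_preimage_open _ _ f (cst 0) (fst @^-1` U) mf.
apply=> //; apply: open_comp => // p _; exact: cvg_fst.
Qed.

Lemma measurable_dot dT (T : measurableType dT) (f g : T -> 'rV[R]_d) :
  (forall i, measurable_fun setT (fun t => f t 0 i)) ->
  (forall i, measurable_fun setT (fun t => g t 0 i)) ->
  measurable_fun setT (fun t => dot (f t) (g t)).
Proof.
move=> mf mg; rewrite /dot.
by apply: (@measurable_sum _ _ _ _ _ _ (fun i t => f t 0 i * g t 0 i)) => i; exact: measurable_funM.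
Qed.

Lemma measurable_enorm dT (T : measurableType dT) (f : T -> 'rV[R]_d) :
  (forall i, measurable_fun setT (fun t => f t 0 i)) ->
  measurable_fun setT (fun t => enorm (f t)).
Proof.
move=> mf; apply: (@measurableT_comp _ _ _ _ _ _ (@Num.sqrt R)).
  by apply: continuous_measurable_fun; exact: sqrt_continuous.
exact: measurable_dot.
Qed.

Lemma continuous_dot (S : topologicalType) (f g : S -> 'rV[R]_d) :
  continuous f -> continuous g -> continuous (fun x => dot (f x) (g x)).
Proof.
move=> cf cg x; rewrite /dot; apply: cvg_big => [|i _].
  by move=> [u v]; exact: add_continuous.
apply: cvgM; apply: (@continuous_comp _ _ _ _ (fun M : 'rV[R]_d => M 0 i));
  [exact: cf|exact: coord_continuous|exact: cg|exact: coord_continuous].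
Qed.

Lemma continuous_enorm : continuous (@enorm R d).
Proof.
move=> x; apply: (@continuous_comp _ _ _ (fun x : 'rV[R]_d => dot x x) Num.sqrt).
  by apply: continuous_dot => y; exact: cvg_id.
exact: sqrt_continuous.
Qed.

Lemma continuous_cospi : continuous (@cospi R).
Proof.
move=> x; apply: (@continuous_comp _ _ _ (fun L : R => Num.min L pi) (@cos R)).
  by apply: continuous_min; [exact: cvg_id|exact: cvg_cst].
exact: continuous_cos.
Qed.

End BorelMaps.

Section ConeBorel.
Variables (R : realType) (d : nat).
Implicit Types z : cone R d.

(** The absolute value admits every real radius, so that measurability can be tested on open subsets
    of R^d x R. *)
Definition cpt (x : 'rV[R]_d) (r : R) : cone R d := cone_pt x `|r|%:nng.

Lemma cone_rad_ge0 z : 0 <= cone_rad z.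
Proof. by rewrite /cone_rad. Qed.

Lemma cptK z : cpt (cone_pos z) (cone_rad z) = z.
Proof.
rewrite /cpt /cone_pos /cone_rad -[RHS]reprK /cone_pt.
case: (repr z) => x r /=; congr (\pi_(cone_quot R d)%qT (_, _)); apply/val_inj => /=.
by rewrite ger0_norm.
Qed.

Lemma cone_rad_cpt x r : 0 <= r -> cone_rad (cpt x r) = r.
Proof. by move=> r0; rewrite cone_radE /= ger0_norm. Qed.

Lemma cone_pos_cpt x r : 0 < r -> cone_pos (cpt x r) = x.
Proof. by move=> r0; rewrite cone_posE //= normr_eq0 gt_eqF. Qed.

Lemma cpt0 x y : cpt x 0 = cpt y 0.
Proof.
by apply/eqmodP => /=; apply/orP; right; apply/andP; split; apply/eqP; exact: normr0.
Qed.

Lemma cpt_apex x z : cone_rad z = 0 -> z = cpt x 0.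
Proof. by move=> r0; rewrite -[LHS]cptK r0; exact: cpt0. Qed.

Lemma dcone2E (z0 z1 : cone R d) : dcone z0 z1 ^+ 2 =
  cdist2 (cone_rad z0) (cone_rad z1) (enorm (cone_pos z0 - cone_pos z1)).
Proof. by rewrite sqr_sqrtr //; apply: cdist2_ge0; exact: cone_rad_ge0. Qed.

Lemma dconeC (z0 z1 : cone R d) : dcone z0 z1 = dcone z1 z0.
Proof. by rewrite /dcone enormB; congr Num.sqrt; ring. Qed.

Lemma dcone_rad (z0 z1 : cone R d) : `|cone_rad z0 - cone_rad z1| <= dcone z0 z1.
Proof.
rewrite -sqrtr_sqr ler_sqrt; last by apply: cdist2_ge0; exact: cone_rad_ge0.
by apply: cdist2_ge; exact: cone_rad_ge0.
Qed.

Lemma measurable_cone_rad : measurable_fun setT (@cone_rad R d : cone R d -> R).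
Proof.
apply: measurable_fun_open => O oO; apply: sub_sigma_algebra => z Oz.
move: oO; rewrite openE => /(_ _ Oz) /= /nbhs_ballP [e /= e0 eO].
exists e => // z' zz'; apply: eO; apply: le_lt_trans zz'; exact: dcone_rad.
Qed.

(** The first bound in t keeps the radius r' above r / 2. If the base points were at distance at
    least m, the squared cone distance would then be at least 2 r r' (1 - cos m) >= r^2 (1 - cos m),
    which the second bound excludes. Since 0 < m <= 1 <= pi, 1 - cos m is positive. *)
Lemma dcone_pos_lt (z : cone R d) (e : R) : 0 < cone_rad z -> 0 < e ->
  exists2 t : R, 0 < t & forall z', dcone z z' < t ->
    0 < cone_rad z' /\ enorm (cone_pos z - cone_pos z') < e.
Proof.
move=> r0 e0; set r := cone_rad z in r0 *.
pose m := Num.min e 1.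
have m0 : 0 < m by rewrite lt_min e0 ltr01.
have m1 : m <= 1 by rewrite ge_min lexx orbT.
have cm : 0 < 1 - cospi m.
  have pi1 : (1 : R) <= pi by apply: le_trans (pi_ge2 R); rewrite ler1n.
  rewrite subr_gt0 cospi_small; last exact: le_trans pi1.
  rewrite -(@cos0 R) ltr_cos // in_itv /= ?lexx ?pi_ge0 //.
  by rewrite ltW //= (le_trans m1).
pose t := Num.min (r / 2) (Num.sqrt (r ^+ 2 * (1 - cospi m))).
have t0 : 0 < t.
  by rewrite lt_min divr_gt0 // sqrtr_gt0 mulr_gt0 // exprn_gt0.
exists t => // z' zz'.
have r' : r / 2 < cone_rad z'.
  have := le_lt_trans (dcone_rad z z') zz'; rewrite -/r lt_min => /andP[+ _].
  by move=> /(le_lt_trans (ler_norm _)); lra.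
split; first by apply: lt_trans r'; rewrite divr_gt0.
rewrite ltNge; apply/negP => em.
have : dcone z z' ^+ 2 < t ^+ 2 by rewrite ltr_pXn2r ?nnegrE ?sqrtr_ge0 ?(ltW t0).
apply/negP; rewrite -leNgt.
apply: (@le_trans _ _ (r ^+ 2 * (1 - cospi m))).
  rewrite -[leRHS]sqr_sqrtr; last by rewrite mulr_ge0 ?sqr_ge0 ?(ltW cm).
  by rewrite ler_pXn2r ?nnegrE ?sqrtr_ge0 ?(ltW t0) // ge_min lexx orbT.
rewrite dcone2E -/r /cdist2.
have : cospi (enorm (cone_pos z - cone_pos z')) <= cospi m.
  by apply: cospi_homo; [exact: ltW|rewrite ge_min em].
have := cospi_le1 m.
move: r' cm; move: (cone_rad z') (cospi m) (cospi (enorm _)) => r' c c'.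
move=> hr c0 c1 cc; have r'0 : 0 <= r' by apply: ltW (lt_trans _ hr); rewrite divr_gt0.
have : 0 <= r * r' * (c - c') by rewrite !mulr_ge0 ?subr_ge0 ?(ltW r0).
have : 0 <= r * (r' - r / 2) * (1 - c) by rewrite !mulr_ge0 ?subr_ge0 ?(ltW r0) ?(ltW hr) ?(ltW c0).
have := sqr_ge0 (r - r').
nra.
Qed.

(** Off the apex the base point is continuous by [dcone_pos_lt]. At the apex, a measurable point, it
    is that of the chosen representative. *)
Lemma measurable_cone_pos :
  measurable_fun setT (@cone_pos R d : cone R d -> euclidean R d).
Proof.
apply: measurable_fun_generated => U oU.
have -> : @cone_pos R d @^-1` U = ([set z | 0 < cone_rad z] `&` @cone_pos R d @^-1` U)
    `|` ((@cone_rad R d @^-1` [set 0]) `&` [set _ | U (cone_pos (cpt 0 0))]).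
  apply/seteqP; split => [z /= Uz|z /= [[]//|[r0 +]]].
    have [r0|r0] := eqVneq (cone_rad z) 0; last first.
      by left; split => //; rewrite lt_neqAle eq_sym r0 cone_rad_ge0.
    by right; split => //; rewrite -(cpt_apex 0 r0).
  by rewrite -(cpt_apex 0 r0).
apply: measurableU.
  apply: sub_sigma_algebra => z [r0 Uz].
  move: oU; rewrite openE => /(_ _ Uz) /= /nbhs_ballP [e /= e0 eU].
  have [t t0 ht] := dcone_pos_lt r0 e0.
  exists t => // z' /ht [r'0 h]; split => //; apply: eU; split => // i j.
  rewrite !ord1; apply: le_lt_trans h.
  by have := coord_le_enorm (cone_pos z - cone_pos z') j; rewrite !mxE.
apply: measurableI.
  rewrite -[X in measurable X]setTI; exact: measurable_cone_rad.
have [h|h] := pselect (U (cone_pos (cpt 0 0))).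
  by rewrite (_ : [set _ | _] = setT) //; apply/seteqP; split.
by rewrite (_ : [set _ | _] = set0) //; apply/seteqP; split.
Qed.

Lemma measurable_cone_pos_coord i :
  measurable_fun setT (fun z : cone R d => cone_pos z 0 i).
Proof. exact: measurableT_comp (measurable_coord i) measurable_cone_pos. Qed.

(** The map (x, r) to [x, |r|] is continuous for [dcone], apex included: the explicit distance [h]
    to a fixed image point is continuous and vanishes at the base pair. *)
Lemma measurable_cpt dT (T : measurableType dT) (f : T -> 'rV[R]_d) (g : T -> R) :
  (forall i, measurable_fun setT (fun t => f t 0 i)) ->
  measurable_fun setT g -> measurable_fun setT (fun t => cpt (f t) (g t)).
Proof.
move=> mf mg; apply: measurable_fun_generated => U oU.
pose W : set ('rV[R]_d * R) := [set p | U (cpt p.1 p.2)].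
have := @measurable_preimage_open _ _ _ _ f g W mf mg; apply.
rewrite openE => -[x r] /= Uxr; rewrite /interior /=.
have [e e0 eU] := oU _ Uxr.
pose h (p : 'rV[R]_d * R) : R := Num.sqrt (`|r| ^+ 2 + `|p.2| ^+ 2
    - 2 * `|r| * `|p.2| * cospi (enorm (x - p.1))).
have h0 : h (x, r) = 0.
  rewrite /h /= subrr enorm0 cospi0; apply/eqP; rewrite sqrtr_eq0.
  by rewrite le_eqVlt; apply/orP; left; apply/eqP; ring.
have cn : {for (x, r), continuous (fun p : 'rV[R]_d * R => `|p.2|)}.
  by apply: cvg_norm; exact: cvg_snd.
have ch : {for (x, r), continuous h}.
  apply: (@continuous_comp _ _ _ _ (@Num.sqrt R)); last exact: sqrt_continuous.
  apply: cvgB.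
    by apply: cvgD; [exact: cvg_cst|rewrite expr2; under eq_fun do rewrite expr2; exact: cvgM].
  apply: cvgM; first by apply: cvgM; [exact: cvg_cst|exact: cn].
  apply: (@continuous_comp _ _ _ (fun p : 'rV[R]_d * R => enorm (x - p.1)));
    last exact: continuous_cospi.
  apply: (@continuous_comp _ _ _ (fun p : 'rV[R]_d * R => x - p.1));
    last exact: continuous_enorm.
  by apply: cvgB; [exact: cvg_cst|exact: cvg_fst].
have : \forall p \near (x, r), h p < e.
  by have := cvgr_lt _ ch; apply; rewrite h0.
apply: filterS => p hp; apply: eU; rewrite dconeE; exact: hp.
Qed.

Lemma measurable_dcone2 dT (T : measurableType dT) (f g : T -> cone R d) :
  measurable_fun setT f -> measurable_fun setT g ->
  measurable_fun setT (fun t => dcone (f t) (g t) ^+ 2).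
Proof.
move=> mf mg; under eq_fun do rewrite dcone2E; rewrite /cdist2.
have mrf := measurableT_comp measurable_cone_rad mf.
have mrg := measurableT_comp measurable_cone_rad mg.
have mpf i := measurableT_comp (measurable_cone_pos_coord i) mf.
have mpg i := measurableT_comp (measurable_cone_pos_coord i) mg.
apply: measurable_funB.
  by apply: measurable_funD; exact: measurable_funX.
apply: measurable_funM; first by do !apply: measurable_funM.
apply: (@measurableT_comp _ _ _ _ _ _ (@cospi R)).
  by apply: continuous_measurable_fun; exact: continuous_cospi.
apply: measurable_enorm => i; under eq_fun do rewrite mxE [X in _ + X]mxE.
by apply: measurable_funB; [exact: mpf|exact: mpg].
Qed.

End ConeBorel.

Import HBNNSimple.

(** * Measures with a density and images of measures *)

Section WeightedImage.
Context dT dS (T : measurableType dT) (S : measurableType dS) (R : realType).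
Local Open Scope ereal_scope.

(** The integral formula is checked on simple functions and passes to increasing limits. It is
    applied to measures on the cone and to Lebesgue measure. *)
Lemma density_measure (m : {measure set T -> \bar R}) (rho : T -> R) :
  measurable_fun setT rho -> (forall x, (0 <= rho x)%R) ->
  exists n : {measure set T -> \bar R},
    (forall A, n A = \int[m]_(x in A) (rho x)%:E) /\
    forall f : T -> \bar R, measurable_fun setT f -> (forall x, 0 <= f x) ->
      \int[n]_x f x = \int[m]_x ((rho x)%:E * f x).
Proof.
move=> mrho rho0.
pose n0 (A : set T) := \int[m]_(x in A) (rho x)%:E.
have n00 : n0 set0 = 0 by rewrite /n0 integral_set0.
have n0_ge0 A : 0 <= n0 A by apply: integral_ge0 => x _; rewrite lee_fin.
have n0_sigma : semi_sigma_additive n0.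
  move=> F mF tF mUF; rewrite /n0 ge0_integral_bigcup //; last 2 first.
- by apply: measurable_funTS; exact/measurable_EFinP.
- by move=> x _; rewrite lee_fin.
  by apply: is_cvg_ereal_nneg_natsum_cond => k _ _; exact: n0_ge0.
pose H := isMeasure.Build _ _ R n0 n00 n0_ge0 n0_sigma.
pose n : {measure set T -> \bar R} := HB.pack n0 H.
have nE A : n A = \int[m]_(x in A) (rho x)%:E by [].
exists n; split => // f mf f0.
have emrho : measurable_fun setT (EFin \o rho) by exact/measurable_EFinP.
have nns (h : {nnsfun T >-> R}) : \int[n]_x (h x)%:E = \int[m]_x ((rho x)%:E * (h x)%:E).
  rewrite integralT_nnsfun sintegralE.
  transitivity (\int[m]_x \sum_(r \in range h) (r%:E * ((rho x)%:E * (\1_(h @^-1` [set r]) x)%:E))).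
    rewrite ge0_integral_fsum //; last 2 first.
    - move=> r; apply: measurable_funeM; apply: emeasurable_funM => //.
      exact/measurable_EFinP/measurable_indic.
    - move=> r x _.
      have [->|h0] := eqVneq (\1_(h @^-1` [set r]) x : R)%R 0%R.
        by rewrite !mule0.
      have : (0 <= r)%R.
        move: h0; rewrite indicE; case: (boolP (_ \in _)) => [|_ /eqP//].
        by rewrite inE /= => <- _.
      by move=> r0; rewrite -!EFinM lee_fin !mulr_ge0 // indicE ler0n.
    apply: eq_fsbigr => r /[!inE] -[x _ <-].
    rewrite ge0_integralZl ?lee_fin //; last 2 first.
    - apply: emeasurable_funM => //; exact/measurable_EFinP/measurable_indic.
    - by move=> y _; rewrite -EFinM lee_fin mulr_ge0 // indicE ler0n.
    congr (_ * _); rewrite nE integral_mkcond; apply: eq_integral => y _.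
    by rewrite patchE indicE; case: ifPn => _; rewrite ?mule1 ?mule0.
  apply: eq_integral => x _.
  under eq_fsbigr do rewrite muleCA.
  rewrite -ge0_mule_fsumr; last first.
    move=> r; have [r0|r0] := leP 0%R r.
      by rewrite -EFinM lee_fin mulr_ge0 // indicE ler0n.
    by rewrite preimage_nnfun0 // indic0 mule0.
  congr (_ * _).
  by rewrite fimfunE -fsumEFin.
pose f_ := nnsfun_approx measurableT mf.
have cvgf x : (f_ n x)%:E @[n --> \oo] --> f x.
  by apply: cvg_nnsfun_approx.
have ndf x : {homo (fun n => (f_ n x)%:E) : i j / (i <= j)%N >-> i <= j}.
  by move=> i j ij; rewrite lee_fin; exact/lefP/nd_nnsfun_approx.
transitivity (limn (fun k => \int[n]_x (f_ k x)%:E)).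
  rewrite -monotone_convergence //; last 2 first.
  - by move=> k; exact/measurable_EFinP.
  - by move=> k x _; rewrite lee_fin.
  by apply: eq_integral => x _; apply/esym/cvg_lim.
under eq_fun do rewrite nns.
rewrite -monotone_convergence //; last 3 first.
- by move=> k; apply: emeasurable_funM => //; exact/measurable_EFinP.
- by move=> k x _; rewrite -EFinM lee_fin mulr_ge0.
- by move=> x _ i j ij; rewrite lee_wpmul2l ?lee_fin //; exact: ndf.
apply: eq_integral => x _; apply/cvg_lim => //.
by apply: cvgeZl.
Qed.

(** Serves for the projection of a cone measure, with density r^2 and map [cone_pos], and for the
    three pieces of a glued plan. *)
Lemma weighted_image (m : {measure set T -> \bar R}) (rho : T -> R) (F : T -> S) :
  measurable_fun setT rho -> (forall x, (0 <= rho x)%R) -> measurable_fun setT F ->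
  exists n : {measure set S -> \bar R},
    forall f : S -> \bar R, measurable_fun setT f -> (forall x, 0 <= f x) ->
      \int[n]_y f y = \int[m]_x ((rho x)%:E * f (F x)).
Proof.
move=> mrho rho0 mF; have [n [_ nf]] := density_measure m mrho rho0.
exists (pushforward n F) => f mf f0.
rewrite (ge0_integral_pushforward mF) // preimage_setT.
by apply: nf => [|x]; [exact: (measurableT_comp mf mF)|exact: f0].
Unshelve. exact: mF.
Qed.

End WeightedImage.

Lemma finite_measure_pack dT (T : measurableType dT) (R : realType)
    (m : {measure set T -> \bar R}) : (m setT < +oo)%E ->
  exists n : {finite_measure set T -> \bar R}, forall A, n A = m A.
Proof.
move=> mT.
have mfin : fin_num_fun m.
  move=> A mA; rewrite ge0_fin_numE //; apply: le_lt_trans mT.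
  by apply: le_measure => //; rewrite inE.
have msig : sigma_finite setT m.
  by apply: fin_num_fun_sigma_finite => //; rewrite measure0.
pose H1 := isFinite.Build _ _ _ _ mfin.
pose H2 := isSFinite.Build _ _ _ _ (sfinite_measure_sigma_finite msig).
pose H3 := isSigmaFinite.Build _ _ _ _ msig.
pose n : {finite_measure set T -> \bar R} := HB.pack (Measure.sort m) H1 H2 H3.
by exists n.
Qed.

Lemma image_measure d1 d2 (T : measurableType d1) (S : measurableType d2)
    (R : realType) (m : {measure set T -> \bar R}) (F : T -> S) :
  measurable_fun setT F ->
  exists n : {measure set S -> \bar R}, (forall A, n A = m (F @^-1` A)) /\
    forall f : S -> \bar R, measurable_fun setT f -> (forall x, 0 <= f x)%E ->
      (\int[n]_y f y = \int[m]_x f (F x))%E.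
Proof.
move=> mF; exists (pushforward m F); split; first by [].
by move=> f mf f0; rewrite (ge0_integral_pushforward mF) ?preimage_setT.
Unshelve. exact: mF.
Qed.

(** * Continuous functions and Borel measures *)

Section MeasuresOnEuclidean.
Variables (R : realType) (d : nat).

Lemma near_enorm (x : 'rV[R]_d) (e : R) : 0 < e ->
  \forall y \near x, enorm (x - y) < e.
Proof.
move=> e0; have s0 : 0 < Num.sqrt d%:R + 1 :> R by rewrite ltr_wpDl ?sqrtr_ge0.
apply/nbhs_ballP; exists (e / (Num.sqrt d%:R + 1)); first exact: divr_gt0.
move=> y [_ xy]; apply: (@le_lt_trans _ _ (Num.sqrt d%:R * (e / (Num.sqrt d%:R + 1)))).
  apply: enorm_le_coord => [|i]; first by rewrite ltW // divr_gt0.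
  by have := ltW (xy 0 i); rewrite !mxE.
by rewrite mulrCA gtr_pMr // ltr_pdivrMr // mul1r ltrDl.
Qed.

Definition setdist (A : set 'rV[R]_d) (x : 'rV[R]_d) : R :=
  inf [set enorm (x - y) | y in A].

Lemma setdist_ge0 A x : A !=set0 -> 0 <= setdist A x.
Proof.
move=> [a Aa]; apply: lb_le_inf; first by exists (enorm (x - a)), a.
by move=> _ [y _ <-]; exact: enorm_ge0.
Qed.

Lemma setdist_le A x y : A y -> setdist A x <= enorm (x - y).
Proof.
move=> Ay; apply: ge_inf; last by exists y.
by exists 0 => _ [z _ <-]; exact: enorm_ge0.
Qed.

Lemma setdist0 A x : A x -> setdist A x = 0.
Proof.
move=> Ax; apply/eqP; rewrite eq_le setdist_ge0 ?andbT; last by exists x.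
by have := setdist_le x Ax; rewrite subrr enorm0.
Qed.

Lemma setdist_gt0 A x : A !=set0 -> closed A -> ~ A x -> 0 < setdist A x.
Proof.
move=> A0 cA nAx.
have : nbhs x (~` A) by apply: open_nbhs_nbhs; split => //; exact: closed_openC.
move=> /nbhs_ballP [e /= e0 eA]; apply: (lt_le_trans e0).
apply: lb_le_inf; first by case: A0 => a Aa; exists (enorm (x - a)), a.
move=> _ [y Ay <-]; rewrite leNgt; apply/negP => ye.
apply: (eA y) => //; split => [|i j]; first exact: e0.
rewrite !ord1; apply: le_lt_trans ye.
by have := coord_le_enorm (x - y) j; rewrite !mxE.
Qed.

Lemma setdist_lipschitz A x y : A !=set0 -> setdist A x - setdist A y <= enorm (x - y).
Proof.
move=> A0; rewrite lerBlDr addrC -lerBlDr; apply: lb_le_inf.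
  by case: A0 => a Aa; exists (enorm (y - a)), a.
move=> _ [z Az <-]; rewrite lerBlDr addrC.
exact: le_trans (setdist_le _ Az) (enorm_triangle _ _ _).
Qed.

Lemma continuous_setdist A : A !=set0 -> continuous (setdist A).
Proof.
move=> A0 x; apply/(@cvgrPdist_lt _ _ _ (nbhs x) (nbhs_filter (x : 'rV[R]_d))) => e e0.
have : \forall y \near (x : 'rV[R]_d), enorm (x - y) < e.
  exact: near_enorm.
apply: filterS => y xy; apply: le_lt_trans xy.
by rewrite ler_norml {1}enormB lerNl opprB !setdist_lipschitz.
Qed.

(** The functions are min(1, k dist(x, complement of U)). An infimum over an empty complement would
    be a default value, hence the separate case. *)
Lemma open_indic_approx (U : set 'rV[R]_d) : open U ->
  exists f : nat -> 'rV[R]_d -> R,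
    [/\ forall k, continuous (f k), forall k x, 0 <= f k x <= 1,
        forall x, {homo f^~ x : i j / (i <= j)%N >-> i <= j}
      & forall x, f k x @[k --> \oo] --> (\1_U x : R)].
Proof.
move=> oU; have [U0|U0] := pselect (~` U !=set0); last first.
  have UT x : U x by apply: contrapT => nUx; apply: U0; exists x.
  exists (fun _ _ => 1); split => [k|k x|x i j _|x].
  - exact: cst_continuous.
  - by rewrite ler01 lexx.
  - by [].
  - by rewrite indicE mem_set //; exact: cvg_cst.
exists (fun k x => Num.min 1 (k%:R * setdist (~` U) x)); split.
- move=> k x; apply: (@continuous_min _ _ (cst 1) (fun x => k%:R * setdist (~` U) x));
    first exact: (@cst_continuous _ _ (1 : R^o) x).
  apply: (@continuous_comp _ _ _ (setdist (~` U)) (fun r : R => k%:R * r)).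
    exact: continuous_setdist.
  exact: mulrl_continuous.
- move=> k x; rewrite ge_min lexx /= le_min ler01 /=.
  by rewrite mulr_ge0 ?setdist_ge0.
- move=> x i j ij; rewrite le_min ge_min lexx /= ge_min; apply/orP; right.
  by rewrite ler_wpM2r ?setdist_ge0 // ler_nat.
- move=> x; rewrite indicE; have [Ux|nUx] := pselect (U x); last first.
    rewrite memNset //; apply: cvg_near_cst; apply: nearW => k.
    by rewrite setdist0 // mulr0 min_r.
  have d0 : 0 < setdist (~` U) x.
    by apply: setdist_gt0 => //; exact: open_closedC.
  rewrite mem_set //; apply: cvg_near_cst.
  near=> k; rewrite min_l // -ler_pdivrMr // mul1r.
  by near: k; exact: nbhs_infty_ger.
Unshelve. all: by end_near. Qed.

Lemma measure_open_cvg (m : {finite_measure set (euclidean R d) -> \bar R})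
    (U : set 'rV[R]_d) (f : nat -> 'rV[R]_d -> R) :
  open U -> (forall k, continuous (f k)) -> (forall k x, 0 <= f k x <= 1) ->
  (forall x, {homo f^~ x : i j / (i <= j)%N >-> i <= j}) ->
  (forall x, f k x @[k --> \oo] --> (\1_U x : R)) ->
  (\int[m]_x (f k x)%:E @[k --> \oo] --> m U)%E.
Proof.
move=> oU fc f01 fnd fU.
have mU : measurable (U : set (euclidean R d)) by exact: sub_sigma_algebra.
have -> : m U = (\int[m]_x limn (fun k => (f k x)%:E))%E.
  rewrite -[in LHS](setIT U) -integral_indic //; apply: eq_integral => x _.
  by apply/esym/cvg_lim => //; apply/cvg_EFin; [exact: nearW|exact: fU].
apply: cvg_monotone_convergence => //.
- by move=> k; apply/measurable_EFinP; exact: continuous_measurable_euclidean.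
- by move=> k x _; rewrite lee_fin; have /andP[] := f01 k x.
- by move=> x _ i j ij; rewrite lee_fin; exact: fnd.
Qed.

Lemma eq_measure_euclidean (m n : {finite_measure set (euclidean R d) -> \bar R}) :
  (forall f : 'rV[R]_d -> R, continuous f -> (forall x, 0 <= f x <= 1)%R ->
    \int[m]_x (f x)%:E = \int[n]_x (f x)%:E)%E ->
  forall A, measurable A -> m A = n A.
Proof.
move=> mn; apply: (@measure_unique _ _ (euclidean R d) (@open 'rV[R]_d)
  (fun _ => setT)) => //.
- by move=> A B; exact: openI.
- by move=> _; exact: openT.
- by apply/seteqP; split => // x _; exists 0%N.
- move=> U oU; have [f [fc f01 fnd fU]] := open_indic_approx oU.
  have h1 := measure_open_cvg (m := m) oU fc f01 fnd fU.
  have h2 := measure_open_cvg (m := n) oU fc f01 fnd fU.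
  have E : (fun k => \int[m]_x (f k x)%:E)%E = (fun k => \int[n]_x (f k x)%:E)%E.
    by apply/funext => k; exact: mn.
  rewrite E in h1; exact: (cvg_unique (@ereal_hausdorff R) h1 h2).
- by move=> _; rewrite ltey_eq fin_num_measure.
Qed.

Lemma within_continuous_measurable (Omega : set 'rV[R]_d) (f : 'rV[R]_d -> R) :
  closed Omega -> {within Omega, continuous f} ->
  measurable_fun (Omega : set (euclidean R d)) f.
Proof.
move=> cO /continuousP cf.
have mO := closed_measurable_euclidean cO.
apply/(measurable_restrictT _ mO); apply: measurable_fun_open => O oO.
have -> : (f \_ Omega) @^-1` O = (f @^-1` O `&` Omega) `|`
    ((cst point : _ -> R) @^-1` O `&` ~` Omega).
  apply/seteqP; split => [x|x [[Ox Omx]|[Ox nOm]]]; rewrite /preimage /= patchE.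
  - case: ifPn => [/set_mem h|/negP h] Ox; [left|right]; split => //.
    by move=> /mem_set.
  - by rewrite mem_set.
  - by rewrite memNset.
apply: measurableU.
  have /open_subspaceP[V oV <-] := cf _ oO.
  by apply: measurableI => //; exact: sub_sigma_algebra.
apply: measurableI; last exact: measurableC.
have [h|h] := pselect (O point).
  by rewrite (_ : _ @^-1` _ = setT) //; apply/seteqP; split.
by rewrite (_ : _ @^-1` _ = set0) //; apply/seteqP; split.
Qed.

End MeasuresOnEuclidean.

Lemma integral_concentrated dT (T : measurableType dT) (R : realType)
    (m : {measure set T -> \bar R}) (D : set T) (f : T -> \bar R) :
  measurable D -> m (~` D) = 0%E -> measurable_fun setT f ->
  (forall x, 0 <= f x)%E -> (\int[m]_(x in D) f x = \int[m]_x f x)%E.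
Proof.
move=> mD mDC mf f0.
have -> : D = setT `\` ~` D by rewrite setDE setCK setTI.
rewrite -ge0_negligible_integral //; first exact: measurableC.
Qed.

(** * Plans between projections *)

Section Plans.
Variables (R : realType) (d : nat) (Omega : set 'rV[R]_d).
Hypothesis cOmega : closed Omega.
Hypothesis Omega0 : Omega !=set0.
Implicit Types m : measure_on Omega.
Local Notation C := (cone R d).
Local Notation E := (euclidean R d).

Let mOmega : measurable (Omega : set E).
Proof. exact: closed_measurable_euclidean. Qed.

Lemma measure_on_setC m : m (~` (Omega : set E)) = 0%E.
Proof. by case: m. Qed.

Lemma integral_measure_on m (f : E -> \bar R) : measurable_fun setT f ->
  (forall x, 0 <= f x)%E -> (\int[m]_(x in Omega) f x = \int[m]_x f x)%E.
Proof.
by move=> mf f0; apply: integral_concentrated => //; exact: measure_on_setC.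
Qed.

Lemma cone_overE : cone_over Omega =
  (@cone_rad R d @^-1` [set 0] `|` (@cone_pos R d @^-1` Omega) : set C).
Proof.
have [x0 Ox0] := Omega0.
apply/seteqP; split => [_ [x Ox [r _ <-]]|z /= [r0|Oz]].
- have [r0|r0] := eqVneq r%:num 0; first by left; rewrite /= cone_radE.
  by right; rewrite /preimage /= cone_posE.
- by exists x0 => //; exists `|0 : R|%:nng => //; rewrite (cpt_apex x0 r0).
- by exists (cone_pos z) => //; exists `|cone_rad z|%:nng => //; rewrite -[RHS]cptK.
Qed.

Lemma measurable_cone_over : measurable (cone_over Omega : set C).
Proof.
rewrite cone_overE; apply: measurableU; rewrite -[X in measurable X]setTI.
  exact: measurable_cone_rad.
exact: measurable_cone_pos.
Qed.

Lemma measurable_rad2 : measurable_fun setT (fun z : C => cone_rad z ^+ 2).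
Proof. by apply: measurable_funX; exact: measurable_cone_rad. Qed.

Lemma measurable_rad2_pos (phi : E -> \bar R) : measurable_fun setT phi ->
  measurable_fun setT (fun z : C => ((cone_rad z ^+ 2)%:E * phi (cone_pos z))%E).
Proof.
move=> mphi; apply: emeasurable_funM; first by apply/measurable_EFinP; exact: measurable_rad2.
exact: (measurableT_comp mphi (@measurable_cone_pos R d)).
Qed.

(* Stated without the marginals, which are the measures on the cone in the
   definition of HK. *)
Definition hkplan (gamma : {measure set (C * C)%type -> \bar R}) m0 m1 :=
  [/\ (gamma setT < +oo)%E,
      forall phi : E -> \bar R, measurable_fun setT phi -> (forall x, 0 <= phi x)%E ->
        (\int[gamma]_p ((cone_rad p.1 ^+ 2)%:E * phi (cone_pos p.1)) =
         \int[m0]_x phi x)%E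
    & forall phi : E -> \bar R, measurable_fun setT phi -> (forall x, 0 <= phi x)%E ->
        (\int[gamma]_p ((cone_rad p.2 ^+ 2)%:E * phi (cone_pos p.2)) =
         \int[m1]_x phi x)%E].

Definition plan_cost (gamma : {measure set (C * C)%type -> \bar R}) : \bar R :=
  (\int[gamma]_p (dcone p.1 p.2 ^+ 2)%:E)%E.

Lemma plan_cost_ge0 gamma : (0 <= plan_cost gamma)%E.
Proof. by apply: integral_ge0 => p _; rewrite lee_fin sqr_ge0. Qed.

(** [is_proj] tests continuous functions only. The image of r^2 l under [cone_pos] is a finite Borel
    measure that agrees with m on them, hence equals m. *)
Lemma is_proj_integral (l : cone_measure2 Omega) m : is_proj l m ->
  forall phi : E -> \bar R, measurable_fun setT phi -> (forall x, 0 <= phi x)%E ->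
  (\int[l]_z ((cone_rad z ^+ 2)%:E * phi (cone_pos z)) = \int[m]_x phi x)%E.
Proof.
move=> lm phi mphi phi0.
have [n nE] := weighted_image l (@measurable_rad2)
  (fun z => sqr_ge0 (cone_rad z)) (@measurable_cone_pos R d).
have l0 : l (~` cone_over Omega) = 0%E by case: (l).
have lfin : (\int[l]_z (cone_rad z ^+ 2)%:E < +oo)%E by case: (l).
have n1 : (n setT < +oo)%E.
  rewrite -(setIT setT) -integral_indic // nE //; last first.
    by apply/measurable_EFinP; exact: measurable_indic.
  by under eq_integral do rewrite indicT mule1.
have [n' n'E] := finite_measure_pack n1.
have mn : forall A, measurable A -> n' A = m A.
  apply: eq_measure_euclidean => f cf f01.
  have mf : measurable_fun setT (EFin \o f : E -> \bar R).
    by apply/measurable_EFinP; exact: continuous_measurable_euclidean.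
  have f0 x : (0 <= (f x)%:E)%E by rewrite lee_fin; case/andP: (f01 x).
  rewrite (eq_measure_integral n) => [|A _ _]; last exact: n'E.
  rewrite (nE _ mf) //.
  have := lm f (continuous_subspaceT cf).
  rewrite integral_measure_on //.
  move=> ->; apply/esym; apply: (@integral_concentrated _ _ _ l (cone_over Omega)
    (fun z : C => ((cone_rad z ^+ 2)%:E * (f (cone_pos z))%:E)%E)) => //.
  - exact: measurable_cone_over.
  - exact: (measurable_rad2_pos mf).
  - by move=> z; rewrite mule_ge0 // lee_fin sqr_ge0.
rewrite -nE //; apply: eq_measure_integral => A mA _; rewrite -n'E; exact: mn.
Qed.

(** The strict inequality provides liftings and a plan that nearly realize both infima. *)
Lemma HK_lt_plan m0 m1 (x : R) : (HK m0 m1 < x%:E)%E ->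
  exists gamma, hkplan gamma m0 m1 /\ (plan_cost gamma < (x ^+ 2)%:E)%E.
Proof.
move=> /ereal_inf_lt[_ [l0 p0 [l1 p1 <-]]] Wx.
have x0 : 0 < x by rewrite -lte_fin; apply: le_lt_trans Wx; exact: sqrte_ge0.
have : (ereal_inf [set (\int[gamma]_p (dcone p.1 p.2 ^+ 2)%:E)%E
    | gamma in is_plan l0 l1] < (x ^+ 2)%:E)%E.
  rewrite ltNge; apply/negP => h.
  move: Wx; rewrite ltNge => /negP; apply.
  have -> : x%:E = sqrte (x ^+ 2)%:E by rewrite /= sqrtr_sqr gtr0_norm.
  by rewrite lee_sqrt //; apply: le_trans h; rewrite lee_fin sqr_ge0.
move=> /ereal_inf_lt[_ [gamma gp <-]] cx; exists gamma; split => //.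
have push (pr : C * C -> C) (l : cone_measure2 Omega) (m : measure_on Omega) :
    measurable_fun setT pr -> (forall A, measurable A -> gamma (pr @^-1` A) = l A) ->
    is_proj l m ->
    forall phi : E -> \bar R, measurable_fun setT phi -> (forall x, 0 <= phi x)%E ->
        (\int[gamma]_p ((cone_rad (pr p) ^+ 2)%:E * phi (cone_pos (pr p))) =
         \int[m]_x phi x)%E.
  move=> mpr prl lm phi mphi phi0; rewrite -(is_proj_integral lm) //.
  have [n [nA nE]] := image_measure gamma mpr.
  rewrite -(nE (fun z => ((cone_rad z ^+ 2)%:E * phi (cone_pos z))%E)).
  - by apply: eq_measure_integral => A mA _; rewrite nA; exact: prl.
  - exact: measurable_rad2_pos.
  - by move=> z; rewrite mule_ge0 // lee_fin sqr_ge0.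
split.
- have [h _] := gp setT measurableT.
  by rewrite setXTT in h; rewrite h ltey_eq fin_num_measure.
- apply: (push fst l0 m0 measurable_fst _ p0) => A mA.
  have [<- _] := gp A mA; congr (gamma _).
  by apply/seteqP; split => // -[a b] /= [].
- apply: (push snd l1 m1 measurable_snd _ p1) => A mA.
  have [_ <-] := gp A mA; congr (gamma _).
  by apply/seteqP; split => // -[a b] /= [].
Qed.

(** Turns the weighted condition back into a lifting: the ordinary marginal of gamma is the
    candidate, and the condition expresses that its projection is m. *)
Lemma plan_marginal (gamma : {measure set (C * C)%type -> \bar R}) m (pr : C * C -> C) :
  measurable_fun setT pr -> (gamma setT < +oo)%E ->
  (forall phi : E -> \bar R, measurable_fun setT phi -> (forall x, 0 <= phi x)%E ->
        (\int[gamma]_p ((cone_rad (pr p) ^+ 2)%:E * phi (cone_pos (pr p))) =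
         \int[m]_x phi x)%E) ->
  exists l : cone_measure2 Omega, is_proj l m /\
    forall A, measurable A -> l A = gamma (pr @^-1` A).
Proof.
move=> mpr gfin gm.
have [n [nA nE0]] := image_measure gamma mpr.
have nT : (n setT < +oo)%E by rewrite nA preimage_setT.
have [n' n'A] := finite_measure_pack nT.
have nE (f : C -> \bar R) : measurable_fun setT f -> (forall z, 0 <= f z)%E ->
    (\int[n']_z f z = \int[gamma]_p f (pr p))%E.
  move=> mf f0; rewrite -nE0 //; apply: eq_measure_integral => A _ _; exact: n'A.
(* Outside the cone over Omega the radius is nonzero and the base point is outside Omega, where r^2
   n' has no mass because m has none. *)
have n'C : n' (~` cone_over Omega) = 0%E.
  have mN : measurable (~` (Omega : set E)) by exact: measurableC.
  have : (\int[n']_z `|(cone_rad z ^+ 2)%:E * (\1_(~` Omega) (cone_pos z))%:E| = 0)%E.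
    under eq_integral do rewrite gee0_abs ?mule_ge0 ?lee_fin ?sqr_ge0 //.
    rewrite nE; last 2 first.
    - apply: (@measurable_rad2_pos (EFin \o \1_(~` Omega))).
      exact/measurable_EFinP/measurable_indic.
    - by move=> z; rewrite mule_ge0 ?lee_fin ?sqr_ge0.
    rewrite (gm (EFin \o \1_(~` Omega))); last 2 first.
    - exact/measurable_EFinP/measurable_indic.
    - by move=> z; rewrite lee_fin.
    transitivity (m (~` (Omega : set E))); last exact: measure_on_setC.
    by rewrite integral_indic // setIT.
  move=> /ae_eq_integral_abs []; first exact: measurableT.
    apply: (@measurable_rad2_pos (EFin \o \1_(~` Omega))).
    exact/measurable_EFinP/measurable_indic.
  move=> N [mN' N0 sN]; apply/eqP; rewrite -measure_le0 -N0 le_measure ?inE //.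
    by apply: measurableC; exact: measurable_cone_over.
  move=> z; rewrite cone_overE => zO; apply: sN => /= /(_ Logic.I) [].
  have [r0 Oz] : cone_rad z <> 0 /\ ~ Omega (cone_pos z).
    by split => h; apply: zO; [left|right].
  move/eqP; rewrite indicE mem_set // mulr1 sqrf_eq0 => /eqP; exact: r0.
have n2 : (\int[n']_z (cone_rad z ^+ 2)%:E < +oo)%E.
  rewrite nE; last 2 first.
  - by apply/measurable_EFinP; exact: measurable_rad2.
  - by move=> z; rewrite lee_fin sqr_ge0.
  have := gm (cst 1%E) (measurable_cst _) (fun _ => lee01).
  under eq_integral do rewrite mule1.
  by move=> ->; rewrite integral_cst // mul1e ltey_eq fin_num_measure.
exists (ConeMeasure2 n'C n2); split => [phi cphi /=|A _]; last by rewrite /= n'A nA.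
rewrite integral_mkcond [RHS]integral_mkcond.
(* phi is continuous within Omega only. It is extended by zero, then split into positive and
   negative parts, as the hypothesis concerns nonnegative functions. *)
pose psi := phi \_ Omega.
have mpsi : measurable_fun setT (psi : E -> R).
  apply/(measurable_restrictT _ mOmega).
  exact: within_continuous_measurable.
transitivity (\int[m]_x (psi x)%:E)%E; first by rewrite restrict_EFin.
transitivity (\int[n']_z ((cone_rad z ^+ 2)%:E * (psi (cone_pos z))%:E))%E; last first.
  apply: eq_integral => z _; rewrite -EFinM /psi !patchE cone_overE.
  case: ifPn => [/set_mem Oz|nO].
    by case: ifPn => // /negP[]; apply/mem_set; right.
  case: ifPn => [/set_mem [/= ->|Oz]|_].
  - by rewrite expr0n /= !mul0r.
  - by case/negP: nO; apply/mem_set.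
  - by rewrite mulr0.
rewrite integralE [RHS]integralE.
have mp : measurable_fun setT ((EFin \o psi)^\+ : E -> \bar R)%E.
  exact/measurable_funepos/measurable_EFinP.
have mm : measurable_fun setT ((EFin \o psi)^\- : E -> \bar R)%E.
  exact/measurable_funeneg/measurable_EFinP.
rewrite -(gm _ mp) // -(gm _ mm) //.
congr (_ - _)%E.
- rewrite -(nE (fun z => ((cone_rad z ^+ 2)%:E * (EFin \o psi)^\+ (cone_pos z)))%E).
  + apply: eq_integral => z _; rewrite !funeposE /= -!EFin_max -!EFinM.
    by rewrite maxr_pMr ?sqr_ge0 // mulr0.
  + exact: measurable_rad2_pos.
  + by move=> z; rewrite mule_ge0 // lee_fin sqr_ge0.
- rewrite -(nE (fun z => ((cone_rad z ^+ 2)%:E * (EFin \o psi)^\- (cone_pos z)))%E).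
  + apply: eq_integral => z _; rewrite !funenegE /= -!EFin_max -!EFinM.
    by rewrite maxr_pMr ?sqr_ge0 // mulr0 mulrN.
  + exact: measurable_rad2_pos.
  + by move=> z; rewrite mule_ge0 // lee_fin sqr_ge0.
Qed.

(** Together with [HK_lt_plan], this makes HK the infimum of the root of [plan_cost] over all
    [hkplan]s. Any operation that preserves the weighted projections, such as a dilation, may thus
    be applied to plans. *)
Lemma HK_le_plan gamma m0 m1 : hkplan gamma m0 m1 ->
  (HK m0 m1 <= sqrte (plan_cost gamma))%E.
Proof.
move=> [gfin g0 g1].
have [l0 [p0 l0E]] := plan_marginal measurable_fst gfin g0.
have [l1 [p1 l1E]] := plan_marginal measurable_snd gfin g1.
have : (HK m0 m1 <= Wcone l0 l1)%E.
  by apply: ereal_inf_lbound; exists l0 => //; exists l1.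
move=> /le_trans; apply; rewrite lee_sqrt ?plan_cost_ge0 //.
apply: ereal_inf_lbound; exists gamma => // A mA; rewrite l0E // l1E //; split;
  by congr (gamma _); apply/seteqP; split => // -[a b] /= [].
Qed.

End Plans.

(** * Cells and the triangle inequality *)

Section Cells.
Variables (R : realType) (d : nat).
Local Notation E := (euclidean R d).

(** Cells are cubes of side 1 / N, numbered by [pickle]. Their diameter is at most sqrt d / N <= e;
    the 1 added to sqrt d keeps N positive when d = 0. *)
Lemma small_cells (e : R) : 0 < e -> exists kappa : E -> nat,
  measurable_fun setT kappa /\
  forall x y : 'rV[R]_d, kappa x = kappa y -> enorm (x - y) <= e.
Proof.
move=> e0; have s0 : 0 < Num.sqrt d%:R + 1 :> R by rewrite ltr_wpDl ?sqrtr_ge0.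
pose N : R := (Num.sqrt d%:R + 1) / e.
have N0 : 0 < N by rewrite divr_gt0.
pose fl (x : 'rV[R]_d) : 'rV[int]_d := \row_i Num.floor (N * x 0 i).
exists (fun x => pickle (fl x)); split.
  move=> _ A _; rewrite setTI.
  have -> : (fun x : E => pickle (fl x)) @^-1` A =
      \bigcup_(k in A) [set x : E | pickle (fl x) = k].
    apply/seteqP; split => [x Ax|x [k Ak /= xk]]; first by exists (pickle (fl x)).
    by rewrite /preimage /= xk.
  apply: bigcup_measurable => k _.
  have [[x0 x0k]|nk] := pselect (exists x0, pickle (fl x0) = k); last first.
    rewrite (_ : [set _ | _] = set0) //; apply/seteqP; split => // x xk.
    by apply: nk; exists x.
  have -> : [set x : E | pickle (fl x) = k] =
      \bigcap_i ((fun x : E => (x : 'rV[R]_d) 0 i) @^-1`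
        `[(Num.floor (N * x0 0 i))%:~R / N, (Num.floor (N * x0 0 i) + 1)%:~R / N[).
    have flE (x : E) i : (`[(Num.floor (N * x0 0 i))%:~R / N,
        (Num.floor (N * x0 0 i) + 1)%:~R / N[%classic ((x : 'rV[R]_d) 0 i)) <->
        Num.floor (N * (x : 'rV[R]_d) 0 i) = Num.floor (N * x0 0 i).
      rewrite /= in_itv /= ler_pdivrMr // ltr_pdivlMr // ![_ * N]mulrC.
      split => [h|<-]; first by apply: floor_def.
      by rewrite ge_floor floorD1_gt.
    apply/seteqP; split => [x /= xk i _|x /= xk].
      apply/flE; move: xk; rewrite -x0k => /(pcan_inj pickleK) /rowP /(_ i).
      by rewrite !mxE.
    rewrite -x0k; congr pickle; apply/rowP => i; rewrite !mxE.
    by apply/flE; exact: xk.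
  apply: fin_bigcap_measurable => // i _.
  by rewrite -[X in measurable X]setTI; apply: measurable_coord.
move=> x y /(pcan_inj pickleK) /rowP xy.
apply: (@le_trans _ _ (Num.sqrt d%:R * N^-1)).
  apply: enorm_le_coord => [|i]; first by rewrite invr_ge0 ltW.
  have := xy i; rewrite !mxE => fxy.
  rewrite -(ler_pM2l N0) divff ?gt_eqF // -[X in X * _](gtr0_norm N0) -normrM mulrBr.
  have h1 := ge_floor (N * x 0 i); have h2 := floorD1_gt (N * x 0 i).
  have h3 := ge_floor (N * y 0 i); have h4 := floorD1_gt (N * y 0 i).
  rewrite fxy in h1 h2; rewrite intrD in h2 h4.
  move: h1 h2 h3 h4; move: (N * x 0 i) (N * y 0 i) ((Num.floor (N * y 0 i))%:~R) => a b c.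
  by rewrite ler_norml => *; apply/andP; split; lra.
rewrite /N invf_div mulrCA ger_pMr // ler_pdivrMr // mul1r lerDl ler01 //.
Qed.

Variables (m : {finite_measure set E -> \bar R}) (kappa : E -> nat).
Hypothesis mkappa : measurable_fun setT kappa.

Let cell (k : nat) := kappa @^-1` [set k].

Let mcell k : measurable (cell k).
Proof. by rewrite /cell -[X in measurable X]setTI; exact: mkappa. Qed.

(* The density, with respect to [m * m], of the measure that conditions both
   coordinates to lie in the same cell. *)
Definition cell_weight (x y : E) : R :=
  if kappa x == kappa y then (fine (m (cell (kappa x))))^-1 else 0.

Lemma cell_weight_ge0 x y : 0 <= cell_weight x y.
Proof. by rewrite /cell_weight; case: ifP => // _; rewrite invr_ge0 fine_ge0. Qed.

Lemma cell_weightC x y : cell_weight x y = cell_weight y x.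
Proof. by rewrite /cell_weight eq_sym; case: eqVneq => // ->. Qed.

Lemma measurable_cell_weight :
  measurable_fun setT (fun p : E * E => cell_weight p.1 p.2).
Proof.
apply: measurable_fun_ifT => //.
  apply: (measurable_fun_bool true); rewrite setTI.
  have -> : (fun p : E * E => kappa p.1 == kappa p.2) @^-1` [set true] =
      \bigcup_k (fst @^-1` cell k `&` snd @^-1` cell k).
    apply/seteqP; split => [p /= /eqP pk|p [k _ [/= h1 h2]]].
      by exists (kappa p.1) => //; split => //=; rewrite /cell /= pk.
    by apply/eqP; rewrite h1 h2.
  apply: bigcup_measurable => k _; apply: measurableI; rewrite -[X in measurable X]setTI.
    exact: measurable_fst.
  exact: measurable_snd.
have mh : measurable_fun setT (fun k : nat => (fine (m (cell k)))^-1 : R) by [].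
exact: (measurableT_comp mh (measurableT_comp mkappa measurable_fst)).
Qed.

Lemma measurable_cell_weight1 x : measurable_fun setT (cell_weight x).
Proof.
have h := @pair1_measurable _ _ E E x.
exact: (measurableT_comp measurable_cell_weight h).
Qed.

Lemma integral_cell_weight x : (\int[m]_y (cell_weight x y)%:E =
  ((fine (m (cell (kappa x))))^-1)%:E * m (cell (kappa x)))%E.
Proof.
rewrite -[X in (_ * m X)%E]setIT -integral_indic // -ge0_integralZl_EFin //.
- apply: eq_integral => y _; rewrite /cell_weight indicE -EFinM.
  case: eqVneq => xy; first by rewrite mem_set ?mulr1.
  by rewrite memNset ?mulr0 // => yx; move/eqP: xy; apply; rewrite -yx.
- exact/measurable_EFinP/measurable_indic.
- by rewrite invr_ge0 fine_ge0.
Qed.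

Lemma integral_cell_weight_le1 x : (\int[m]_y (cell_weight x y)%:E <= 1)%E.
Proof.
rewrite integral_cell_weight -[X in (_ * X)%E]fineK ?fin_num_measure // -EFinM lee_fin.
have [->|h] := eqVneq (fine (m (cell (kappa x)))) 0; first by rewrite mulr0.
by rewrite mulVf.
Qed.

Lemma integral_cell_weight_eq1 x : m (cell (kappa x)) != 0%E ->
  (\int[m]_y (cell_weight x y)%:E = 1)%E.
Proof.
move=> h; rewrite integral_cell_weight -[X in (_ * X)%E]fineK ?fin_num_measure //.
by rewrite -EFinM mulVf // fine_eq0 // fin_num_measure.
Qed.

(** Here the inverse in [cell_weight] is the default 0^-1 = 0, so the total weight is 0 instead of
    1. There are countably many cells, so the exceptional set is m-null. *)
Definition null_cells := [set x | m (cell (kappa x)) = 0%E].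

Lemma null_cellsE : null_cells = \bigcup_(k in [set k | m (cell k) = 0%E]) cell k.
Proof.
apply/seteqP; split => [x xk|x [k mk xk]]; first by exists (kappa x).
by rewrite /null_cells /= xk.
Qed.

Lemma measurable_null_cells : measurable null_cells.
Proof. by rewrite null_cellsE; exact: bigcup_measurable. Qed.

Lemma measure_null_cells : m null_cells = 0%E.
Proof.
suff [A [mA A0 sA]] : m.-negligible null_cells.
  apply/eqP; rewrite -measure_le0 -A0 le_measure ?inE //.
  exact: measurable_null_cells.
have -> : null_cells = \bigcup_k (cell k `&` [set _ | m (cell k) = 0%E]).
  rewrite null_cellsE; apply/seteqP; split => [x [k h xk]|x [k _ [xk h]]];
    by exists k.
apply: negligible_bigcup => k; have [h|h] := pselect (m (cell k) = 0%E).
  by exists (cell k); split => // x [].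
exists set0; split => // x [_ //].
Qed.

End Cells.

Lemma lee_of_lt_EFin (R : realType) (a b : \bar R) : (0 <= b)%E ->
  (forall x : R, b < x%:E -> a <= x%:E)%E -> (a <= b)%E.
Proof.
case: b => [b b0 h|_ _|//]; last by rewrite leey.
apply/lee_addgt0Pr => e e0; apply: h.
by rewrite lte_fin ltrDl.
Qed.

Section HKSymmetric.
Variables (R : realType) (d : nat) (Omega : set 'rV[R]_d).
Hypothesis cOmega : closed Omega.
Hypothesis Omega0 : Omega !=set0.
Implicit Types m : measure_on Omega.
Local Notation C := (cone R d).
Local Notation E := (euclidean R d).

Lemma HK_ge0 m0 m1 : (0 <= HK m0 m1)%E.
Proof. by apply: le_ereal_inf_tmp => _ [l0 _ [l1 _ <-]]; exact: sqrte_ge0. Qed.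

Lemma HK_sym_le m0 m1 : (HK m0 m1 <= HK m1 m0)%E.
Proof.
apply: lee_of_lt_EFin; first exact: HK_ge0.
move=> x hx; have x0 : 0 <= x.
  by rewrite -lee_fin; apply: le_trans (ltW hx); exact: HK_ge0.
have [g [[gT g0 g1] gc]] := HK_lt_plan cOmega Omega0 hx.
have msw : measurable_fun setT (fun p : C * C => (p.2, p.1)).
  by apply/measurable_fun_pairP; split; [exact: measurable_snd|exact: measurable_fst].
have [n [nA nE]] := image_measure g msw.
have cn : plan_cost n = plan_cost g.
  rewrite /plan_cost nE => [|//|p]; last by rewrite lee_fin sqr_ge0.
    by apply: eq_integral => p _; rewrite /= dconeC.
  by apply/measurable_EFinP; apply: measurable_dcone2; [exact: measurable_fst|exact: measurable_snd].
have : hkplan n m0 m1.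
  split; first by rewrite nA preimage_setT.
  - move=> phi mphi phi0; rewrite -g1 // nE //.
    + exact: (measurableT_comp (measurable_rad2_pos mphi) measurable_fst).
    + by move=> p; rewrite mule_ge0 // lee_fin sqr_ge0.
  - move=> phi mphi phi0; rewrite -g0 // nE //.
    + exact: (measurableT_comp (measurable_rad2_pos mphi) measurable_snd).
    + by move=> p; rewrite mule_ge0 // lee_fin sqr_ge0.
move=> /(HK_le_plan cOmega Omega0) /le_trans; apply; rewrite cn.
rewrite (_ : x%:E = sqrte (x ^+ 2)%:E); last by rewrite /= sqrtr_sqr ger0_norm.
by rewrite lee_sqrt ?lee_fin ?sqr_ge0 // ltW.
Qed.

Lemma HKC m0 m1 : HK m0 m1 = HK m1 m0.
Proof. by apply/eqP; rewrite eq_le !HK_sym_le. Qed.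

End HKSymmetric.

Section CellAverage.
Context dT (T : measurableType dT) (R : realType) (d : nat).
Local Notation E := (euclidean R d).
Variables (m : {finite_measure set E -> \bar R}) (kappa : E -> nat).
Hypothesis mkappa : measurable_fun setT kappa.
Variables (g : {finite_measure set T -> \bar R}) (a : T -> R) (x : T -> E).
Hypothesis ma : measurable_fun setT a.
Hypothesis mx : measurable_fun setT x.
Hypothesis gm : forall phi : E -> \bar R, measurable_fun setT phi ->
  (forall z, 0 <= phi z)%E ->
  (\int[g]_p ((a p ^+ 2)%:E * phi (x p)) = \int[m]_z phi z)%E.
Local Notation wt := (cell_weight m kappa).

Lemma weighted_cell_weight y :
  (\int[g]_p ((a p ^+ 2)%:E * (wt y (x p))%:E) = \int[m]_z (wt y z)%:E)%E.
Proof.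
apply: (gm (phi := fun z => (wt y z)%:E)).
  by apply/measurable_EFinP; exact: measurable_cell_weight1.
by move=> z; rewrite lee_fin cell_weight_ge0.
Qed.

(** [a] and [x] stand for the radius and the base point of one coordinate of a plan. The image of
    a^2 g under x is m, which does not charge null cells. *)
Lemma null_cells_negligible :
  {ae g, forall p, a p != 0 -> ~ null_cells m kappa (x p)}.
Proof.
have mN := measurable_null_cells m mkappa.
have m1N : measurable_fun setT (EFin \o \1_(null_cells m kappa) : E -> \bar R).
  exact/measurable_EFinP/measurable_indic.
have mf : measurable_fun setT
    (fun p => (a p ^+ 2)%:E * (\1_(null_cells m kappa) (x p))%:E)%E.
  apply: emeasurable_funM; first by apply/measurable_EFinP; exact: measurable_funX.
  exact: (measurableT_comp m1N mx).
have : (\int[g]_p `|(a p ^+ 2)%:E * (\1_(null_cells m kappa) (x p))%:E| = 0)%E.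
  under eq_integral do rewrite gee0_abs ?mule_ge0 ?lee_fin ?sqr_ge0 //.
  rewrite (gm m1N) => [|z]; last by rewrite lee_fin.
  rewrite integral_indic // setIT; exact: measure_null_cells.
move=> /(ae_eq_integral_abs g measurableT mf); apply: filterS => p /(_ Logic.I) h a0 Np.
move: h => /eqP; rewrite indicE mem_set // mule1 eqe sqrf_eq0; exact/negP.
Qed.

Lemma measurable_cell_average :
  measurable_fun setT (fun y => \int[m]_z (wt y z)%:E)%E.
Proof.
apply: (@measurable_fun_fubini_tonelli_F _ _ E E R m (fun p => (wt p.1 p.2)%:E)).
  by apply/measurable_EFinP; exact: measurable_cell_weight.
by move=> p; rewrite lee_fin cell_weight_ge0.
Qed.

(** Where a is nonzero the total weight is 1 almost everywhere, by [null_cells_negligible]; where a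
    = 0 both integrands vanish with u. *)
Lemma cell_average (u : T -> \bar R) : measurable_fun setT u ->
  (forall p, 0 <= u p)%E -> (forall p, a p = 0%R -> u p = 0)%E ->
  (\int[g]_p (u p * \int[m]_z (wt (x p) z)%:E) = \int[g]_p u p)%E.
Proof.
move=> mu u0 au.
have mW : measurable_fun setT (fun p => \int[m]_z (wt (x p) z)%:E)%E.
  exact: (measurableT_comp measurable_cell_average mx).
apply: ge0_ae_eq_integral => //.
- exact: emeasurable_funM.
- move=> p _; rewrite mule_ge0 //; apply: integral_ge0 => z _.
  by rewrite lee_fin cell_weight_ge0.
- move: null_cells_negligible; apply: filterS => p h _.
  have [a0|a0] := eqVneq (a p) 0; first by rewrite (au p a0) mul0e.
  rewrite integral_cell_weight_eq1 ?mule1 //.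
  by apply/eqP; exact: h.
Qed.

Lemma cell_average_le (u : T -> R) : measurable_fun setT u -> (forall p, 0 <= u p) ->
  (\int[g]_p ((u p)%:E * \int[m]_z (wt (x p) z)%:E) <= \int[g]_p (u p)%:E)%E.
Proof.
move=> mu u0.
have mW : measurable_fun setT (fun p => \int[m]_z (wt (x p) z)%:E)%E.
  exact: (measurableT_comp measurable_cell_average mx).
have mEu : measurable_fun setT (EFin \o u) by exact/measurable_EFinP.
apply: ge0_le_integral => //.
- move=> p _; rewrite mule_ge0 ?lee_fin //; apply: integral_ge0 => z _.
  by rewrite lee_fin cell_weight_ge0.
- exact: emeasurable_funM.
- by move=> p _; rewrite -[leRHS]mule1 lee_wpmul2l ?lee_fin // integral_cell_weight_le1.
Qed.

End CellAverage.

Section CellCoupling.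
Context d1 d2 (T1 : measurableType d1) (T2 : measurableType d2) (R : realType) (d : nat).
Local Notation E := (euclidean R d).
Variables (m : {finite_measure set E -> \bar R}) (kappa : E -> nat).
Hypothesis mkappa : measurable_fun setT kappa.
Variables (g : {finite_measure set T1 -> \bar R}) (a : T1 -> R) (x : T1 -> E).
Variables (g' : {finite_measure set T2 -> \bar R}) (b : T2 -> R) (y : T2 -> E).
Hypothesis ma : measurable_fun setT a.
Hypothesis mx : measurable_fun setT x.
Hypothesis gm : forall phi : E -> \bar R, measurable_fun setT phi ->
  (forall z, 0 <= phi z)%E ->
  (\int[g]_p ((a p ^+ 2)%:E * phi (x p)) = \int[m]_z phi z)%E.
Hypothesis mb : measurable_fun setT b.
Hypothesis my : measurable_fun setT y.
Hypothesis gm' : forall phi : E -> \bar R, measurable_fun setT phi ->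
  (forall z, 0 <= phi z)%E ->
  (\int[g']_p ((b p ^+ 2)%:E * phi (y p)) = \int[m]_z phi z)%E.
Local Notation wt := (cell_weight m kappa).

Let mwt : measurable_fun setT (fun pq : T1 * T2 => wt (x pq.1) (y pq.2)).
Proof.
have h : measurable_fun setT (fun pq : T1 * T2 => (x pq.1, y pq.2)).
  apply/measurable_fun_pairP; split.
    exact: (measurableT_comp mx measurable_fst).
  exact: (measurableT_comp my measurable_snd).
exact: (measurableT_comp (measurable_cell_weight m mkappa) h).
Qed.

Let mb2 : measurable_fun setT (fun pq : T1 * T2 => b pq.2 ^+ 2).
Proof. exact: measurable_funX (measurableT_comp mb measurable_snd). Qed.

Let ma2 : measurable_fun setT (fun pq : T1 * T2 => a pq.1 ^+ 2).
Proof. exact: measurable_funX (measurableT_comp ma measurable_fst). Qed.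

(** By Tonelli, integrating out the second plan turns b^2 g' into m and leaves the total cell weight
    seen from the first plan. *)
Lemma coupling_left (u : T1 -> \bar R) : measurable_fun setT u ->
  (forall p, 0 <= u p)%E ->
  (\int[g \x g']_pq (u pq.1 * (b pq.2 ^+ 2 * wt (x pq.1) (y pq.2))%:E) =
   \int[g]_p (u p * \int[m]_z (wt (x p) z)%:E))%E.
Proof.
move=> mu u0; rewrite fubini_tonelli1; last 2 first.
- apply: emeasurable_funM; first exact: (measurableT_comp mu measurable_fst).
  by apply/measurable_EFinP; exact: measurable_funM.
- by move=> pq; rewrite mule_ge0 // lee_fin mulr_ge0 ?sqr_ge0 ?cell_weight_ge0.
apply: eq_integral => p _; rewrite /fubini_F /=.
have mw : measurable_fun setT (fun q => (b q ^+ 2 * wt (x p) (y q))%:E).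
  apply/measurable_EFinP; apply: measurable_funM; first exact: measurable_funX.
  exact: (measurableT_comp (measurable_cell_weight1 m mkappa (x p)) my).
rewrite ge0_integralZl //; last first.
  by move=> q _; rewrite lee_fin mulr_ge0 ?sqr_ge0 ?cell_weight_ge0.
congr (_ * _)%E; rewrite -(weighted_cell_weight mkappa gm').
by apply: eq_integral => q _; rewrite EFinM.
Qed.

Lemma coupling_right (v : T2 -> \bar R) : measurable_fun setT v ->
  (forall q, 0 <= v q)%E ->
  (\int[g \x g']_pq (v pq.2 * (a pq.1 ^+ 2 * wt (x pq.1) (y pq.2))%:E) =
   \int[g']_q (v q * \int[m]_z (wt (y q) z)%:E))%E.
Proof.
move=> mv v0; rewrite fubini_tonelli2; last 2 first.
- apply: emeasurable_funM; first exact: (measurableT_comp mv measurable_snd).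
  by apply/measurable_EFinP; exact: measurable_funM.
- by move=> pq; rewrite mule_ge0 // lee_fin mulr_ge0 ?sqr_ge0 ?cell_weight_ge0.
apply: eq_integral => q _; rewrite /fubini_G /=.
under eq_integral do rewrite cell_weightC.
have mw : measurable_fun setT (fun p => (a p ^+ 2 * wt (y q) (x p))%:E).
  apply/measurable_EFinP; apply: measurable_funM; first exact: measurable_funX.
  exact: (measurableT_comp (measurable_cell_weight1 m mkappa (y q)) mx).
rewrite ge0_integralZl //; last first.
  by move=> p _; rewrite lee_fin mulr_ge0 ?sqr_ge0 ?cell_weight_ge0.
congr (_ * _)%E; rewrite -(weighted_cell_weight mkappa gm).
by apply: eq_integral => p _; rewrite EFinM.
Qed.

End CellCoupling.

(** * Dilations and gluing of two plans *)

Section Gluing.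
Variables (R : realType) (d : nat) (Omega : set 'rV[R]_d).
Hypothesis cOmega : closed Omega.
Hypothesis Omega0 : Omega !=set0.
Implicit Types m : measure_on Omega.
Local Notation C := (cone R d).
Local Notation E := (euclidean R d).

Definition apex : C := cpt 0 0.

Lemma dcone2_apex (z : C) : dcone z apex ^+ 2 = cone_rad z ^+ 2.
Proof. by rewrite dcone2E /cdist2 cone_rad_cpt //; ring. Qed.

Lemma dcone2_rad0 (z w : C) : cone_rad w = 0 -> dcone z w ^+ 2 = cone_rad z ^+ 2.
Proof. by move=> w0; rewrite dcone2E /cdist2 w0; ring. Qed.

(** Weighted by r^2, division of the radius by r preserves the projection ([dilate_proj]). With r
    the radius of the middle point, that point is brought to radius 1. For r = 0 the quotient is 0,
    and such points will get weight 0. *)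
Definition dilate (z : C) (r : R) : C := cpt (cone_pos z) (cone_rad z / r).

Lemma measurable_dilate dT (T : measurableType dT) (f : T -> C) (r : T -> R) :
  measurable_fun setT f -> measurable_fun setT r ->
  measurable_fun setT (fun t => dilate (f t) (r t)).
Proof.
move=> mf mr; apply: measurable_cpt => [i|].
  exact: (measurableT_comp (measurable_cone_pos_coord i) mf).
apply: measurable_funM; first exact: (measurableT_comp (@measurable_cone_rad R d) mf).
exact: (measurableT_comp (@measurable_inv R) mr).
Qed.

Lemma cospi_lipschitz (a b : R) : `|cospi a - cospi b| <= `|a - b|.
Proof.
have cl (s t : R) : s <= t -> `|cos t - cos s| <= t - s.
  move=> st.
  have cw : {within `[s, t], continuous (@cos R)}.
    by apply: continuous_subspaceT; exact: continuous_cos.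
  have [c _ ->] := MVT_segment st (fun x _ => is_derive_cos x) cw.
  rewrite normrM normrN (ger0_norm (x := t - s)) ?subr_ge0 //.
  by rewrite ler_piMl ?subr_ge0 // sin_max.
have mn (s t : R) : s <= t -> `|Num.min t pi - Num.min s pi| <= t - s.
  move=> st; rewrite ler_norml; have [tp|tp] := leP t pi; have [sp|sp] := leP s pi;
  by apply/andP; split; lra.
have mo (s t : R) : s <= t -> Num.min s pi <= Num.min t pi.
  by move=> st; rewrite le_min ge_min st ge_min lexx orbT.
rewrite /cospi; wlog ba : a b / b <= a.
  move=> h; have [/h//|/ltW/h] := leP b a.
  by rewrite distrC (distrC b).
apply: le_trans (cl _ _ (mo _ _ ba)) _.
by apply: le_trans (ler_norm _) _; rewrite (ger0_norm (x := a - b)) ?subr_ge0 ?mn.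
Qed.

(* The middle point [z1 / r] (resp. [w1 / s]) lies at radius 1; moving its base
   point by at most [e] perturbs the squared distance by at most [e (1 + rad^2)]. *)
Lemma dilate_dist (z0 z1 w1 w2 : C) (t e : R) : 0 < t ->
  cone_rad z1 != 0 -> cone_rad w1 != 0 ->
  enorm (cone_pos z1 - cone_pos w1) <= e ->
  cone_rad z1 ^+ 2 * cone_rad w1 ^+ 2 *
    dcone (dilate z0 (cone_rad z1)) (dilate w2 (cone_rad w1)) ^+ 2 <=
  (1 + t) * (cone_rad w1 ^+ 2 * dcone z0 z1 ^+ 2) +
  (1 + t^-1) * (cone_rad z1 ^+ 2 *
     (dcone w1 w2 ^+ 2 + e * (cone_rad w1 ^+ 2 + cone_rad w2 ^+ 2))).
Proof.
move=> t0 r0 s0 xy.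
have v0 : 0 <= 1 + t^-1 by rewrite addr_ge0 // invr_ge0 ltW.
rewrite !dcone2E.
have radE (z : C) (r : R) : 0 <= r -> cone_rad (dilate z r) = cone_rad z / r.
  by move=> h; rewrite cone_rad_cpt // divr_ge0 // cone_rad_ge0.
rewrite !radE ?cone_rad_ge0 //.
have [r0' r1' s1' s2'] : [/\ 0 <= cone_rad z0, 0 <= cone_rad z1, 0 <= cone_rad w1
  & 0 <= cone_rad w2] by split; exact: cone_rad_ge0.
(* The base point of a dilated point of radius 0 is arbitrary, but the coefficient of the cosine is
   then 0. *)
have -> (L := enorm (cone_pos (dilate z0 (cone_rad z1)) - cone_pos (dilate w2 (cone_rad w1)))) :
    cdist2 (cone_rad z0 / cone_rad z1) (cone_rad w2 / cone_rad w1) L =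
    cdist2 (cone_rad z0 / cone_rad z1) (cone_rad w2 / cone_rad w1)
      (enorm (cone_pos z0 - cone_pos w2)).
  have [z00|z00] := eqVneq (cone_rad z0) 0; first by rewrite /cdist2 z00; ring.
  have [w20|w20] := eqVneq (cone_rad w2) 0; first by rewrite /cdist2 w20; ring.
  have pos (p q : R) : 0 <= p -> p != 0 -> 0 <= q -> q != 0 -> 0 < p / q.
    by move=> *; rewrite divr_gt0 // lt_neqAle eq_sym; apply/andP.
  by rewrite /L !cone_pos_cpt // pos.
have scl (p q r L : R) : r != 0 -> r ^+ 2 * cdist2 (p / r) (q / r) L = cdist2 p q L.
  by move=> h; rewrite /cdist2; field.
have tri := @cdist2_triangle R (cone_rad z0 / cone_rad z1) 1 (cone_rad w2 / cone_rad w1)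
  (enorm (cone_pos z0 - cone_pos z1)) (enorm (cone_pos z1 - cone_pos w2))
  (enorm (cone_pos z0 - cone_pos w2)) t t0.
have {}tri := tri (divr_ge0 r0' r1') ler01 (divr_ge0 s2' s1') (enorm_ge0 _)
  (enorm_ge0 _) (enorm_ge0 _) (enorm_triangle _ _ _).
(* [cospi] is 1-Lipschitz, so moving the base point costs at most 2 b e <= e (1 + b^2), where b is
   the dilated radius of [w2]. *)
have pert : cdist2 1 (cone_rad w2 / cone_rad w1) (enorm (cone_pos z1 - cone_pos w2)) <=
    cdist2 1 (cone_rad w2 / cone_rad w1) (enorm (cone_pos w1 - cone_pos w2)) +
    e * (1 + (cone_rad w2 / cone_rad w1) ^+ 2).
  have := cospi_lipschitz (enorm (cone_pos w1 - cone_pos w2)) (enorm (cone_pos z1 - cone_pos w2)).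
  have : `|enorm (cone_pos w1 - cone_pos w2) - enorm (cone_pos z1 - cone_pos w2)| <= e.
    apply: le_trans xy; rewrite ler_norml.
    have := enorm_triangle (cone_pos w1) (cone_pos z1) (cone_pos w2).
    have := enorm_triangle (cone_pos z1) (cone_pos w1) (cone_pos w2).
    rewrite (enormB (cone_pos w1) (cone_pos z1)) => *.
    by apply/andP; split; lra.
  move=> /[swap] /le_trans /[apply] /(le_trans (ler_norm _)).
  have : 0 <= cone_rad w2 / cone_rad w1 by exact: divr_ge0.
  rewrite /cdist2; move: (cone_rad w2 / cone_rad w1) (cospi _) (cospi _) => b c c' b0 cc'.
  have e0 : 0 <= e by apply: le_trans xy; exact: enorm_ge0.
  have h1 : 0 <= b * (e - (c' - c)) by rewrite mulr_ge0 ?subr_ge0.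
  have h2 : 0 <= e * (1 - b) ^+ 2 by rewrite mulr_ge0 ?sqr_ge0.
  by nra.
have rs0 : 0 <= cone_rad z1 ^+ 2 * cone_rad w1 ^+ 2 by rewrite mulr_ge0 ?sqr_ge0.
apply: (le_trans (ler_wpM2l rs0 tri)).
rewrite mulrDr; apply: lerD.
  rewrite -(scl (cone_rad z0) (cone_rad z1) (cone_rad z1)) // divff //.
  by rewrite le_eqVlt; apply/orP; left; apply/eqP; ring.
have := ler_wpM2l rs0 (ler_wpM2l v0 pert); move/le_trans; apply.
rewrite -(scl (cone_rad w1) (cone_rad w2) (cone_rad w1)) // divff //.
rewrite le_eqVlt; apply/orP; left; apply/eqP.
by move: (cdist2 1 _ _) (t^-1) => D ti; field.
Qed.

End Gluing.

Lemma measurable_eq0 dT (T : measurableType dT) (R : realType) (r : T -> R) :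
  measurable_fun setT r -> measurable_fun setT (fun t => (r t == 0)%:R : R).
Proof.
move=> mr; have -> : (fun t => (r t == 0)%:R : R) = \1_(r @^-1` [set 0]).
  apply/funext => t; rewrite indicE; have [h|h] := eqVneq (r t) 0.
    by rewrite mem_set.
  by rewrite memNset // => /= h'; rewrite h' eqxx in h.
by apply: measurable_indic; rewrite -[X in measurable X]setTI; exact: mr.
Qed.

Lemma measurable_neq0 dT (T : measurableType dT) (R : realType) (r : T -> R) :
  measurable_fun setT r -> measurable_fun setT (fun t => (r t != 0)%:R : R).
Proof.
move=> mr; have -> : (fun t => (r t != 0)%:R : R) = (fun t => 1 - (r t == 0)%:R).
  by apply/funext => t; case: eqVneq => _; rewrite /= ?subrr ?subr0.
by apply: measurable_funB => //; exact: measurable_eq0.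
Qed.

Section HKTriangle.
Variables (R : realType) (d : nat) (Omega : set 'rV[R]_d).
Implicit Types m : measure_on Omega.
Local Notation C := (cone R d).
Local Notation E := (euclidean R d).

Lemma hkplan_pack (gamma : {measure set (C * C)%type -> \bar R}) m0 m1 :
  hkplan gamma m0 m1 ->
  exists g : {finite_measure set (C * C)%type -> \bar R},
    hkplan g m0 m1 /\ plan_cost g = plan_cost gamma.
Proof.
move=> [gT g0 g1]; have [g gE] := finite_measure_pack gT.
have ie (f : C * C -> \bar R) : (\int[g]_p f p = \int[gamma]_p f p)%E.
  by apply: eq_measure_integral => A _ _; exact: gE.
exists g; split; last exact: ie.
split; [|by move=> *; rewrite ie g0|by move=> *; rewrite ie g1].
by apply: le_lt_trans gT; rewrite le_eqVlt; apply/orP; left; apply/eqP; exact: gE.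
Qed.

Let mrad1 : measurable_fun setT (fun p : C * C => cone_rad p.1).
Proof. exact: (measurableT_comp (@measurable_cone_rad R d) measurable_fst). Qed.

Let mrad2 : measurable_fun setT (fun p : C * C => cone_rad p.2).
Proof. exact: (measurableT_comp (@measurable_cone_rad R d) measurable_snd). Qed.

Let mpos1 : measurable_fun setT (fun p : C * C => cone_pos p.1 : E).
Proof. exact: (measurableT_comp (@measurable_cone_pos R d) measurable_fst). Qed.

Let mpos2 : measurable_fun setT (fun p : C * C => cone_pos p.2 : E).
Proof. exact: (measurableT_comp (@measurable_cone_pos R d) measurable_snd). Qed.

Let mdist : measurable_fun setT (fun p : C * C => dcone p.1 p.2 ^+ 2).
Proof. by apply: measurable_dcone2; [exact: measurable_fst|exact: measurable_snd]. Qed.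

Variables (m0 m1 m2 : measure_on Omega).
Variables (g g' : {finite_measure set (C * C)%type -> \bar R}).
Hypothesis hg : hkplan g m0 m1.
Hypothesis hg' : hkplan g' m1 m2.
Variables (kappa : E -> nat) (e : R).
Hypothesis mkappa : measurable_fun setT kappa.
Hypothesis small : forall x y : 'rV[R]_d, kappa x = kappa y -> enorm (x - y) <= e.
Hypothesis e0 : 0 <= e.

Local Notation wt := (cell_weight m1 kappa).
(** For each marginal, one squared radius undoes the dilation in [F], while the other and the cell
    weight integrate to 1 over the opposite plan, up to null cells. *)
Let rho (pq : (C * C) * (C * C)) : R :=
  cone_rad pq.1.2 ^+ 2 * cone_rad pq.2.1 ^+ 2 * wt (cone_pos pq.1.2) (cone_pos pq.2.1).
Let F (pq : (C * C) * (C * C)) : C * C :=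
  (dilate pq.1.1 (cone_rad pq.1.2), dilate pq.2.2 (cone_rad pq.2.1)).

Let gm1 : forall phi : E -> \bar R, measurable_fun setT phi ->
  (forall z, 0 <= phi z)%E ->
  (\int[g]_p ((cone_rad p.2 ^+ 2)%:E * phi (cone_pos p.2)) = \int[m1]_z phi z)%E.
Proof. by case: hg. Qed.

Let gm1' : forall phi : E -> \bar R, measurable_fun setT phi ->
  (forall z, 0 <= phi z)%E ->
  (\int[g']_p ((cone_rad p.1 ^+ 2)%:E * phi (cone_pos p.1)) = \int[m1]_z phi z)%E.
Proof. by case: hg'. Qed.

Let left_int (u : C * C -> \bar R) : measurable_fun setT u ->
  (forall p, 0 <= u p)%E ->
  (\int[g \x g']_pq (u pq.1 *
     (cone_rad pq.2.1 ^+ 2 * wt (cone_pos pq.1.2) (cone_pos pq.2.1))%:E) =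
   \int[g]_p (u p * \int[m1]_z (wt (cone_pos p.2) z)%:E))%E.
Proof. exact: (coupling_left mkappa _ mpos2 mrad1 mpos1 gm1'). Qed.

Let right_int (v : C * C -> \bar R) : measurable_fun setT v ->
  (forall q, 0 <= v q)%E ->
  (\int[g \x g']_pq (v pq.2 *
     (cone_rad pq.1.2 ^+ 2 * wt (cone_pos pq.1.2) (cone_pos pq.2.1))%:E) =
   \int[g']_q (v q * \int[m1]_z (wt (cone_pos q.1) z)%:E))%E.
Proof. exact: (coupling_right mkappa _ mrad2 mpos2 gm1 mpos1). Qed.

Let rho_ge0 pq : 0 <= rho pq.
Proof.
by apply: mulr_ge0; [apply: mulr_ge0; exact: sqr_ge0|exact: cell_weight_ge0].
Qed.

Let mwt : measurable_fun setT
  (fun pq : (C * C) * (C * C) => wt (cone_pos pq.1.2) (cone_pos pq.2.1)).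
Proof.
have h : measurable_fun setT
    (fun pq : (C * C) * (C * C) => (cone_pos pq.1.2 : E, cone_pos pq.2.1 : E)).
  apply/measurable_fun_pairP; split.
    exact: (measurableT_comp mpos2 measurable_fst).
  exact: (measurableT_comp mpos1 measurable_snd).
exact: (measurableT_comp (measurable_cell_weight m1 mkappa) h).
Qed.

Let mrho : measurable_fun setT rho.
Proof.
apply: measurable_funM; last exact: mwt.
apply: measurable_funM.
  exact: measurable_funX (measurableT_comp mrad2 measurable_fst).
exact: measurable_funX (measurableT_comp mrad1 measurable_snd).
Qed.

Let mF : measurable_fun setT F.
Proof.
apply/measurable_fun_pairP; split; apply: measurable_dilate.
- exact: (measurableT_comp measurable_fst measurable_fst).
- exact: (measurableT_comp mrad2 measurable_fst).
- exact: (measurableT_comp measurable_snd measurable_snd).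
- exact: (measurableT_comp mrad1 measurable_snd).
Qed.

Let dilate_proj (z : C) (r : R) (phi : E -> \bar R) : 0 <= r -> r != 0 ->
  ((r ^+ 2)%:E * ((cone_rad (dilate z r) ^+ 2)%:E * phi (cone_pos (dilate z r))) =
   (cone_rad z ^+ 2)%:E * phi (cone_pos z))%E.
Proof.
move=> r0 rn0.
rewrite cone_rad_cpt ?divr_ge0 ?cone_rad_ge0 // muleA -EFinM.
have -> : r ^+ 2 * (cone_rad z / r) ^+ 2 = cone_rad z ^+ 2 by field.
have [z0|z0] := eqVneq (cone_rad z) 0; first by rewrite z0 expr0n /= !mul0e.
rewrite cone_pos_cpt // divr_gt0 // lt_neqAle eq_sym ?rn0 ?z0 // ?r0 //.
exact: cone_rad_ge0.
Qed.

Let indicD (z : C) (X : \bar R) : (0 <= X)%E ->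
  ((cone_rad z != 0)%:R%:E * X + (cone_rad z == 0)%:R%:E * X = X)%E.
Proof. by move=> X0; case: eqVneq => _; rewrite /= !(mul0e, mul1e, adde0, add0e). Qed.

(** The factor on the right appears because pairs whose middle radius is 0 have weight [rho] = 0;
    [glue_plans] adds them back. *)
Let first_marginal (phi : E -> \bar R) : measurable_fun setT phi ->
  (forall z, 0 <= phi z)%E ->
  (\int[g \x g']_pq ((rho pq)%:E *
     ((cone_rad (F pq).1 ^+ 2)%:E * phi (cone_pos (F pq).1))) =
   \int[g]_p ((cone_rad p.2 != 0)%:R%:E *
      ((cone_rad p.1 ^+ 2)%:E * phi (cone_pos p.1))))%E.
Proof.
move=> mphi phi0.
pose u (p : C * C) := ((cone_rad p.2 != 0)%:R%:E *
  ((cone_rad p.1 ^+ 2)%:E * phi (cone_pos p.1)))%E.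
have mu : measurable_fun setT u.
  apply: emeasurable_funM; first exact/measurable_EFinP/measurable_neq0.
  exact: (measurableT_comp (measurable_rad2_pos mphi) measurable_fst).
have u0 p : (0 <= u p)%E by rewrite !mule_ge0 ?lee_fin ?sqr_ge0.
transitivity (\int[g \x g']_pq (u pq.1 *
    (cone_rad pq.2.1 ^+ 2 * wt (cone_pos pq.1.2) (cone_pos pq.2.1))%:E))%E.
  apply: eq_integral => -[p q] _; rewrite /u /rho /F /=.
  have [p0|p0] := eqVneq (cone_rad p.2) 0.
    by rewrite p0 expr0n /= !mul0r !mul0e.
  rewrite /= mul1e -(dilate_proj p.1 phi (cone_rad_ge0 _) p0) -mulrA EFinM.
  by rewrite muleAC.
rewrite left_int // (cell_average mkappa mrad2 mpos2 gm1) // => p p0.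
by rewrite /u p0 eqxx mul0e.
Qed.

Let second_marginal (phi : E -> \bar R) : measurable_fun setT phi ->
  (forall z, 0 <= phi z)%E ->
  (\int[g \x g']_pq ((rho pq)%:E *
     ((cone_rad (F pq).2 ^+ 2)%:E * phi (cone_pos (F pq).2))) =
   \int[g']_q ((cone_rad q.1 != 0)%:R%:E *
      ((cone_rad q.2 ^+ 2)%:E * phi (cone_pos q.2))))%E.
Proof.
move=> mphi phi0.
pose u (p : C * C) := ((cone_rad p.1 != 0)%:R%:E *
  ((cone_rad p.2 ^+ 2)%:E * phi (cone_pos p.2)))%E.
have mu : measurable_fun setT u.
  apply: emeasurable_funM; first exact/measurable_EFinP/measurable_neq0.
  exact: (measurableT_comp (measurable_rad2_pos mphi) measurable_snd).
have u0 p : (0 <= u p)%E by rewrite !mule_ge0 ?lee_fin ?sqr_ge0.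
transitivity (\int[g \x g']_pq (u pq.2 *
    (cone_rad pq.1.2 ^+ 2 * wt (cone_pos pq.1.2) (cone_pos pq.2.1))%:E))%E.
  apply: eq_integral => -[p q] _; rewrite /u /rho /F /=.
  have [q0|q0] := eqVneq (cone_rad q.1) 0.
    by rewrite q0 expr0n /= mulr0 !mul0r !mul0e.
  rewrite /= mul1e -(dilate_proj q.2 phi (cone_rad_ge0 _) q0).
  rewrite (mulrC (cone_rad p.2 ^+ 2)) -mulrA EFinM.
  by rewrite muleAC.
rewrite right_int // (cell_average mkappa mrad1 mpos1 gm1') // => q q0.
by rewrite /u q0 eqxx mul0e.
Qed.

Let mcross : measurable_fun setT (fun q : C * C => cone_rad q.1 ^+ 2 + cone_rad q.2 ^+ 2).
Proof. by apply: measurable_funD; exact: measurable_funX. Qed.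

(** The cell weight vanishes unless the middle base points share a cell, hence are within e, so
    [dilate_dist] applies pointwise. Each resulting term is a function of one plan times a weight
    whose total is at most 1. *)
Let coupled_cost (t : R) : 0 < t ->
  (\int[g \x g']_pq ((rho pq)%:E * (dcone (F pq).1 (F pq).2 ^+ 2)%:E) <=
   (1 + t)%:E * \int[g]_p ((cone_rad p.2 != 0)%:R * dcone p.1 p.2 ^+ 2)%:E +
   (1 + t^-1)%:E * \int[g']_q ((cone_rad q.1 != 0)%:R *
     (dcone q.1 q.2 ^+ 2 + e * (cone_rad q.1 ^+ 2 + cone_rad q.2 ^+ 2)))%:E)%E.
Proof.
move=> t0.
have v0 : 0 <= 1 + t^-1 by rewrite addr_ge0 // invr_ge0 ltW.
have w0 : 0 <= 1 + t by rewrite addr_ge0 // ltW.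
pose U (p : C * C) := (cone_rad p.2 != 0)%:R * dcone p.1 p.2 ^+ 2.
pose V (q : C * C) := (cone_rad q.1 != 0)%:R *
     (dcone q.1 q.2 ^+ 2 + e * (cone_rad q.1 ^+ 2 + cone_rad q.2 ^+ 2)).
have mU : measurable_fun setT U.
  by apply: measurable_funM => //; exact: measurable_neq0.
have mV : measurable_fun setT V.
  apply: measurable_funM; first exact: measurable_neq0.
  by apply: measurable_funD => //; apply: measurable_funM.
have U0 p : 0 <= U p by rewrite mulr_ge0 ?sqr_ge0.
have V0 p : 0 <= V p by rewrite mulr_ge0 // addr_ge0 ?sqr_ge0 // mulr_ge0 // addr_ge0 ?sqr_ge0.
have mdF : measurable_fun setT (fun pq => dcone (F pq).1 (F pq).2 ^+ 2).
  exact: (measurableT_comp mdist mF).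
pose k1 (pq : (C * C) * (C * C)) := cone_rad pq.2.1 ^+ 2 * wt (cone_pos pq.1.2) (cone_pos pq.2.1).
pose k2 (pq : (C * C) * (C * C)) := cone_rad pq.1.2 ^+ 2 * wt (cone_pos pq.1.2) (cone_pos pq.2.1).
have mk1 : measurable_fun setT k1.
  apply: measurable_funM; last exact: mwt.
  exact: measurable_funX (measurableT_comp mrad1 measurable_snd).
have mk2 : measurable_fun setT k2.
  apply: measurable_funM; last exact: mwt.
  exact: measurable_funX (measurableT_comp mrad2 measurable_fst).
have k10 pq : 0 <= k1 pq by rewrite mulr_ge0 ?sqr_ge0 ?cell_weight_ge0.
have k20 pq : 0 <= k2 pq by rewrite mulr_ge0 ?sqr_ge0 ?cell_weight_ge0.
have mUk : measurable_fun setT (fun pq : (C * C) * (C * C) => U pq.1 * k1 pq).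
  apply: measurable_funM => //; exact: (measurableT_comp mU measurable_fst).
have mVk : measurable_fun setT (fun pq : (C * C) * (C * C) => V pq.2 * k2 pq).
  apply: measurable_funM => //; exact: (measurableT_comp mV measurable_snd).
apply: (@le_trans _ _ (\int[g \x g']_pq ((1 + t)%:E * (U pq.1 * k1 pq)%:E +
    (1 + t^-1)%:E * (V pq.2 * k2 pq)%:E)))%E.
  apply: ge0_le_integral => //.
  - by move=> pq _; rewrite -EFinM lee_fin mulr_ge0 ?rho_ge0 ?sqr_ge0.
  - by apply/measurable_EFinP; exact: measurable_funM.
  - by apply/measurable_EFinP; apply: measurable_funD; exact: measurable_funM.
  move=> [p q] _; rewrite -!EFinM -EFinD lee_fin /rho /U /V /k1 /k2 /F /=.
  have [p0|p0] := eqVneq (cone_rad p.2) 0.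
    by rewrite p0 expr0n /= !(mul0r, mulr0, addr0).
  have [q0|q0] := eqVneq (cone_rad q.1) 0.
    by rewrite q0 expr0n /= !(mul0r, mulr0, addr0).
  rewrite !mul1r /cell_weight; case: eqVneq => [pq|_]; last by rewrite !(mul0r, mulr0, addr0).
  set h := (fine _)^-1.
  have h0 : 0 <= h by rewrite invr_ge0 fine_ge0.
  have := ler_wpM2r h0 (dilate_dist p.1 q.2 t0 p0 q0 (small pq)).
  by congr (_ <= _); ring.
rewrite ge0_integralD //; last 4 first.
- by move=> pq _; apply: mule_ge0; rewrite lee_fin // mulr_ge0.
- by apply/measurable_EFinP; exact: measurable_funM.
- by move=> pq _; apply: mule_ge0; rewrite lee_fin // mulr_ge0.
- by apply/measurable_EFinP; exact: measurable_funM.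
rewrite !ge0_integralZl_EFin //; last 4 first.
- by move=> pq _; rewrite lee_fin mulr_ge0.
- exact/measurable_EFinP.
- by move=> pq _; rewrite lee_fin mulr_ge0.
- exact/measurable_EFinP.
apply: leeD; rewrite lee_wpmul2l ?lee_fin //.
  under eq_integral do rewrite EFinM.
  rewrite (left_int (u := EFin \o U)) //; last exact/measurable_EFinP.
  exact: (cell_average_le m1 mkappa g mpos2 mU U0).
under eq_integral do rewrite EFinM.
rewrite (right_int (v := EFin \o V)) //; last exact/measurable_EFinP.
exact: (cell_average_le m1 mkappa g' mpos1 mV V0).
Qed.

Let rho_mass : (\int[g \x g']_pq (rho pq)%:E <= m1 setT)%E.
Proof.
pose u (p : C * C) := cone_rad p.2 ^+ 2.
have mu : measurable_fun setT u by exact: measurable_funX.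
have u0 p : 0 <= u p by exact: sqr_ge0.
under eq_integral do rewrite /rho -mulrA EFinM.
rewrite (left_int (u := EFin \o u)) //; last exact/measurable_EFinP.
apply: (@le_trans _ _ (\int[g]_p (u p)%:E)%E); first exact: cell_average_le.
have := gm1 (measurable_cst 1%E) (fun _ => lee01).
under eq_integral do rewrite mule1.
by move=> ->; rewrite integral_cst // mul1e.
Qed.

(* Without disintegration: on the middle cone, points of radius 0 are replaced by
   the apex, and the others are matched when their base points lie in the same
   cell of diameter at most [e], independently within the cell. *)
Lemma glue_plans (t : R) : 0 < t ->
  exists n : {measure set (C * C)%type -> \bar R}, hkplan n m0 m2 /\
    (plan_cost n <= (1 + t)%:E * plan_cost g +
      (1 + t^-1)%:E * (plan_cost g' + e%:E * (m1 setT + m2 setT)))%E.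
Proof.
move=> t0.
have v0 : 0 <= 1 + t^-1 by rewrite addr_ge0 // invr_ge0 ltW.
have w0 : 0 <= 1 + t by rewrite addr_ge0 // ltW.
have [n1 n1E] := weighted_image (g \x g')%E mrho rho_ge0 mF.
have mF2 : measurable_fun setT (fun p : C * C => (p.1, apex R d) : C * C).
  by apply/measurable_fun_pairP; split; [exact: measurable_fst|exact: measurable_cst].
have mF3 : measurable_fun setT (fun p : C * C => (apex R d, p.2) : C * C).
  by apply/measurable_fun_pairP; split; [exact: measurable_cst|exact: measurable_snd].
(* Pairs with middle radius 0 keep their outer point and get the apex on the other side, which adds
   nothing to the other projection. *)
have [n2 n2E] := weighted_image g (measurable_eq0 mrad2) (fun p => ler0n _ _) mF2.
have [n3 n3E] := weighted_image g' (measurable_eq0 mrad1) (fun p => ler0n _ _) mF3.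
pose n : {measure set (C * C)%type -> \bar R} := measure_add (measure_add n1 n2) n3.
have nE (f : C * C -> \bar R) : measurable_fun setT f -> (forall p, 0 <= f p)%E ->
    (\int[n]_p f p = \int[g \x g']_pq ((rho pq)%:E * f (F pq)) +
      \int[g]_p ((cone_rad p.2 == 0)%:R%:E * f (p.1, apex R d)) +
      \int[g']_q ((cone_rad q.1 == 0)%:R%:E * f (apex R d, q.2)))%E.
  move=> mf f0; rewrite ge0_integral_measure_add // ge0_integral_measure_add //.
  by rewrite n1E // n2E // n3E.
have rapex : cone_rad (apex R d) = 0 by rewrite cone_rad_cpt.
have mphi1 (phi : E -> \bar R) : measurable_fun setT phi ->
    measurable_fun setT (fun p : C * C => ((cone_rad p.1 ^+ 2)%:E * phi (cone_pos p.1))%E).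
  by move=> h; exact: (measurableT_comp (measurable_rad2_pos h) measurable_fst).
have mphi2 (phi : E -> \bar R) : measurable_fun setT phi ->
    measurable_fun setT (fun p : C * C => ((cone_rad p.2 ^+ 2)%:E * phi (cone_pos p.2))%E).
  by move=> h; exact: (measurableT_comp (measurable_rad2_pos h) measurable_snd).
exists n; split; first split.
- rewrite -(mul1e (n setT)) -integral_cst // nE //.
  apply: lte_add_pinfty; first apply: lte_add_pinfty.
  + under eq_integral do rewrite mule1.
    by apply: le_lt_trans rho_mass _; rewrite ltey_eq fin_num_measure.
  + apply: (@le_lt_trans _ _ (g setT)); last by rewrite ltey_eq fin_num_measure.
    rewrite -[leRHS]mul1e -integral_cst //; apply: ge0_le_integral => //.
    * by move=> p _; rewrite mule1 lee_fin.
    * by under eq_fun do rewrite mule1; exact/measurable_EFinP/measurable_eq0.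
    * by move=> p _; rewrite mule1 lee_fin lern1 leq_b1.
  + apply: (@le_lt_trans _ _ (g' setT)); last by rewrite ltey_eq fin_num_measure.
    rewrite -[leRHS]mul1e -integral_cst //; apply: ge0_le_integral => //.
    * by move=> p _; rewrite mule1 lee_fin.
    * by under eq_fun do rewrite mule1; exact/measurable_EFinP/measurable_eq0.
    * by move=> p _; rewrite mule1 lee_fin lern1 leq_b1.
- move=> phi mphi phi0; rewrite nE; [|exact: mphi1|by move=> p; rewrite mule_ge0 ?lee_fin ?sqr_ge0].
  rewrite first_marginal //= [X in (_ + X)%E]integral0_eq ?adde0; last first.
    by move=> q _; rewrite rapex expr0n /= mul0e mule0.
  case: hg => _ <- // _; rewrite -ge0_integralD //.
  + by apply: eq_integral => p _; apply: indicD; rewrite mule_ge0 ?lee_fin ?sqr_ge0.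
  + by move=> p _; rewrite !mule_ge0 ?lee_fin ?sqr_ge0.
  + by apply: emeasurable_funM; [exact/measurable_EFinP/measurable_neq0|exact: mphi1].
  + by move=> p _; rewrite !mule_ge0 ?lee_fin ?sqr_ge0.
  + by apply: emeasurable_funM; [exact/measurable_EFinP/measurable_eq0|exact: mphi1].
- move=> phi mphi phi0; rewrite nE; [|exact: mphi2|by move=> p; rewrite mule_ge0 ?lee_fin ?sqr_ge0].
  rewrite second_marginal //= [X in (_ + X + _)%E]integral0_eq ?adde0; last first.
    by move=> q _; rewrite rapex expr0n /= mul0e mule0.
  case: hg' => _ _ <- //; rewrite -ge0_integralD //.
  + by apply: eq_integral => p _; apply: indicD; rewrite mule_ge0 ?lee_fin ?sqr_ge0.
  + by move=> p _; rewrite !mule_ge0 ?lee_fin ?sqr_ge0.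
  + by apply: emeasurable_funM; [exact/measurable_EFinP/measurable_neq0|exact: mphi2].
  + by move=> p _; rewrite !mule_ge0 ?lee_fin ?sqr_ge0.
  + by apply: emeasurable_funM; [exact/measurable_EFinP/measurable_eq0|exact: mphi2].
rewrite /plan_cost nE; last 2 first.
- exact/measurable_EFinP.
- by move=> p; rewrite lee_fin sqr_ge0.
rewrite /=; under [X in (_ + X + _ <= _)%E]eq_integral do rewrite dcone2_apex.
under [X in (_ + X <= _)%E]eq_integral do rewrite dconeC dcone2_apex.
(* All points of radius 0 are at the same distance from a given point, so these pairs cost what they
   did in [g]. *)
have cost1 : (\int[g]_p ((cone_rad p.2 == 0)%:R%:E * (cone_rad p.1 ^+ 2)%:E) =
    \int[g]_p ((cone_rad p.2 == 0)%:R * dcone p.1 p.2 ^+ 2)%:E)%E.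
  apply: eq_integral => p _; rewrite -EFinM; case: eqVneq => [h|_]; last by rewrite !mul0r.
  by rewrite dcone2_rad0.
have cost2 : (\int[g']_q ((cone_rad q.1 == 0)%:R%:E * (cone_rad q.2 ^+ 2)%:E) =
    \int[g']_q ((cone_rad q.1 == 0)%:R * dcone q.1 q.2 ^+ 2)%:E)%E.
  apply: eq_integral => p _; rewrite -EFinM; case: eqVneq => [h|_]; last by rewrite !mul0r.
  by rewrite dconeC dcone2_rad0.
rewrite cost1 cost2.
pose a1 := (\int[g]_p ((cone_rad p.2 != 0)%:R * dcone p.1 p.2 ^+ 2)%:E)%E.
pose a0 := (\int[g]_p ((cone_rad p.2 == 0)%:R * dcone p.1 p.2 ^+ 2)%:E)%E.
pose b1 := (\int[g']_q ((cone_rad q.1 != 0)%:R *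
     (dcone q.1 q.2 ^+ 2 + e * (cone_rad q.1 ^+ 2 + cone_rad q.2 ^+ 2)))%:E)%E.
pose b0 := (\int[g']_q ((cone_rad q.1 == 0)%:R * dcone q.1 q.2 ^+ 2)%:E)%E.
have mz1 := measurable_neq0 mrad1. have mz2 := measurable_neq0 mrad2.
have me1 := measurable_eq0 mrad1. have me2 := measurable_eq0 mrad2.
have aE : (a1 + a0 = \int[g]_p (dcone p.1 p.2 ^+ 2)%:E)%E.
  rewrite -ge0_integralD //.
  - apply: eq_integral => p _; rewrite -EFinD -mulrDl; congr (_%:E).
    by case: eqVneq => _; rewrite /= ?add0r ?addr0 mul1r.
  - by move=> p _; rewrite lee_fin mulr_ge0 ?sqr_ge0.
  - by apply/measurable_EFinP; exact: measurable_funM.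
  - by move=> p _; rewrite lee_fin mulr_ge0 ?sqr_ge0.
  - by apply/measurable_EFinP; exact: measurable_funM.
have bE : (b1 + b0 <= \int[g']_q (dcone q.1 q.2 ^+ 2)%:E + e%:E * (m1 setT + m2 setT))%E.
  have one1 := gm1' (measurable_cst 1%E) (fun _ => lee01).
  have one2 : (\int[g']_q ((cone_rad q.2 ^+ 2)%:E * cst 1%E (cone_pos q.2)) =
      \int[m2]_x cst 1%E x)%E by case: hg' => _ _; apply.
  rewrite !integral_cst // !mul1e in one1 one2.
  have -> : (m1 setT + m2 setT =
      \int[g']_q (cone_rad q.1 ^+ 2 + cone_rad q.2 ^+ 2)%:E)%E.
    under eq_integral do rewrite EFinD.
    rewrite ge0_integralD //.
    - by rewrite -one1 -one2; congr (_ + _)%E; apply: eq_integral => q _ /=; rewrite mule1.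
    - by move=> q _; rewrite lee_fin sqr_ge0.
    - by apply/measurable_EFinP; exact: measurable_funX.
    - by move=> q _; rewrite lee_fin sqr_ge0.
    - by apply/measurable_EFinP; exact: measurable_funX.
  rewrite -ge0_integralZl_EFin //; last 2 first.
  - by move=> q _; rewrite lee_fin addr_ge0 ?sqr_ge0.
  - exact/measurable_EFinP.
  rewrite -!ge0_integralD //; last 8 first.
  - by move=> q _; rewrite lee_fin sqr_ge0.
  - exact/measurable_EFinP.
  - by move=> q _; rewrite -EFinM lee_fin mulr_ge0 ?addr_ge0 ?sqr_ge0.
  - by apply/measurable_EFinP; exact: measurable_funM.
  - by move=> q _; rewrite lee_fin mulr_ge0 // addr_ge0 ?sqr_ge0 // mulr_ge0 // addr_ge0 ?sqr_ge0.
  - apply/measurable_EFinP; apply: measurable_funM => //.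
    by apply: measurable_funD => //; exact: measurable_funM.
  - by move=> q _; rewrite lee_fin mulr_ge0 ?sqr_ge0.
  - by apply/measurable_EFinP; exact: measurable_funM.
  apply: ge0_le_integral => //.
  - move=> q _; rewrite -EFinD lee_fin; apply: addr_ge0; last by rewrite mulr_ge0 ?sqr_ge0.
    by rewrite mulr_ge0 // addr_ge0 ?sqr_ge0 // mulr_ge0 // addr_ge0 ?sqr_ge0.
  - apply: emeasurable_funD; apply/measurable_EFinP; last exact: measurable_funM.
    apply: measurable_funM => //.
    by apply: measurable_funD => //; exact: measurable_funM.
  - by apply: emeasurable_funD; apply/measurable_EFinP => //; exact: measurable_funM.
  - move=> q _; rewrite -EFinM -!EFinD lee_fin.
    have h : 0 <= e * (cone_rad q.1 ^+ 2 + cone_rad q.2 ^+ 2).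
      by rewrite mulr_ge0 // addr_ge0 ?sqr_ge0.
    by case: eqVneq => _; rewrite /= !(mul0r, mul1r, add0r, addr0) ?lerDl.
have a0_ge0 : (0 <= a0)%E by apply: integral_ge0 => p _; rewrite lee_fin mulr_ge0 ?sqr_ge0.
have a1_ge0 : (0 <= a1)%E by apply: integral_ge0 => p _; rewrite lee_fin mulr_ge0 ?sqr_ge0.
have b0_ge0 : (0 <= b0)%E by apply: integral_ge0 => p _; rewrite lee_fin mulr_ge0 ?sqr_ge0.
have b1_ge0 : (0 <= b1)%E.
  apply: integral_ge0 => p _; rewrite lee_fin mulr_ge0 // addr_ge0 ?sqr_ge0 //.
  by rewrite mulr_ge0 // addr_ge0 ?sqr_ge0.
apply: (@le_trans _ _ ((1 + t)%:E * a1 + (1 + t^-1)%:E * b1 + a0 + b0)%E).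
  by apply: leeD; [apply: leeD; [exact: coupled_cost|exact: lexx]|exact: lexx].
apply: (@le_trans _ _ ((1 + t)%:E * (a1 + a0) + (1 + t^-1)%:E * (b1 + b0))%E).
  rewrite (ge0_muleDr _ a1_ge0 a0_ge0) (ge0_muleDr _ b1_ge0 b0_ge0) -addeA [leRHS]addeACA.
  apply: leeD; first exact: lexx.
  apply: leeD.
    by rewrite -[leLHS]mul1e lee_wpmul2r // lee_fin lerDl ltW.
  by rewrite -[leLHS]mul1e lee_wpmul2r // lee_fin lerDl invr_ge0 ltW.
rewrite aE; apply: leeD; first exact: lexx.
by apply: lee_wpmul2l; rewrite ?lee_fin.
Qed.

End HKTriangle.

Section HKTriangleInequality.
Variables (R : realType) (d : nat) (Omega : set 'rV[R]_d).
Hypothesis cOmega : closed Omega.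
Hypothesis Omega0 : Omega !=set0.

Lemma HK_triangle_lt (m0 m1 m2 : measure_on Omega) (x y : R) :
  (HK m0 m1 < x%:E -> HK m1 m2 < y%:E -> HK m0 m2 <= (x + y)%:E)%E.
Proof.
move=> h01 h12.
have x0 : 0 < x by rewrite -lte_fin; apply: le_lt_trans h01; exact: HK_ge0.
have y0 : 0 < y by rewrite -lte_fin; apply: le_lt_trans h12; exact: HK_ge0.
have [g_ [/hkplan_pack[g [hg <-]] cg]] := HK_lt_plan cOmega Omega0 h01.
have [g'_ [/hkplan_pack[g' [hg' <-]] cg']] := HK_lt_plan cOmega Omega0 h12.
(* t = y / x is optimal: (1 + y/x) x^2 + (1 + x/y) y^2 = (x + y)^2. *)
have t0 : 0 < y / x by rewrite divr_gt0.
have cfin : plan_cost g' \is a fin_num.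
  by rewrite ge0_fin_numE ?plan_cost_ge0 // (lt_trans cg') // ltry.
pose c' := fine (plan_cost g').
have c'E : plan_cost g' = c'%:E by rewrite fineK.
pose M := fine (m1 setT + m2 setT)%E.
have ME : (m1 setT + m2 setT)%E = M%:E by rewrite fineK // fin_numD !fin_num_measure.
have M0 : 0 <= M by rewrite -lee_fin -ME adde_ge0.
have c'y : c' < y ^+ 2 by rewrite -lte_fin -c'E.
(* The slack between the cost c' and y^2 pays for the cell error e M; M + 1 is positive even when M
   = 0. *)
pose e := (y ^+ 2 - c') / (M + 1).
have e0 : 0 < e by rewrite divr_gt0 ?subr_gt0 // ltr_wpDl.
have eM : c' + e * M <= y ^+ 2.
  rewrite -lerBrDl /e mulrAC ler_pdivrMr ?ltr_wpDl //.
  by rewrite ler_wpM2l ?subr_ge0 ?(ltW c'y) // lerDl.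
have [kappa [mk small]] := small_cells d e0.
have [n [hn cn]] := glue_plans hg hg' mk small (ltW e0) t0.
apply: le_trans (HK_le_plan cOmega Omega0 hn) _.
rewrite (_ : (x + y)%:E = sqrte ((x + y) ^+ 2)%:E); last first.
  by rewrite /= sqrtr_sqr gtr0_norm // addr_gt0.
rewrite lee_sqrt ?lee_fin ?sqr_ge0 //; apply: le_trans cn _.
apply: (@le_trans _ _ ((1 + y / x)%:E * (x ^+ 2)%:E + (1 + (y / x)^-1)%:E * (y ^+ 2)%:E)%E).
  apply: leeD; rewrite lee_wpmul2l ?lee_fin ?addr_ge0 ?invr_ge0 ?(ltW t0) //.
    exact: ltW.
  by rewrite c'E ME -EFinM -EFinD lee_fin.
rewrite -!EFinM -EFinD lee_fin le_eqVlt; apply/orP; left; apply/eqP.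
by field; rewrite !gt_eqF.
Qed.

Lemma HK_triangle (m0 m1 m2 : measure_on Omega) :
  (HK m0 m2 <= HK m0 m1 + HK m1 m2)%E.
Proof.
have [->|f01] := eqVneq (HK m0 m1) +oo%E; first by rewrite addye ?leey // -ltNye (lt_le_trans _ (HK_ge0 _ _)).
have [->|f12] := eqVneq (HK m1 m2) +oo%E; first by rewrite addey ?leey // -ltNye (lt_le_trans _ (HK_ge0 _ _)).
have {}f01 : HK m0 m1 \is a fin_num by rewrite ge0_fin_numE ?HK_ge0 // ltey.
have {}f12 : HK m1 m2 \is a fin_num by rewrite ge0_fin_numE ?HK_ge0 // ltey.
apply/lee_addgt0Pr => e e0.
rewrite -(fineK f01) -(fineK f12) -!EFinD.
have e2 : 0 < e / 2 by rewrite divr_gt0.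
have := @HK_triangle_lt m0 m1 m2 (fine (HK m0 m1) + e / 2) (fine (HK m1 m2) + e / 2).
rewrite -{1}(fineK f01) -{1}(fineK f12) !lte_fin !ltrDl e2 => /(_ erefl erefl).
move/le_trans; apply; rewrite lee_fin [in leRHS](splitr e).
by rewrite le_eqVlt; apply/orP; left; apply/eqP; ring.
Qed.

End HKTriangleInequality.

(** * Variation of integrals of test functions *)

Section Chord.
Variable R : realType.
Implicit Types (L r s e : R).

(* The squared distance of two points of the cone at radius 1. *)
Definition chord2 L : R := 2 - 2 * cospi L.

Lemma cdist2_chord2 r s L : cdist2 r s L = (r - s) ^+ 2 + r * s * chord2 L.
Proof. by rewrite /cdist2 /chord2; ring. Qed.

Lemma chord2_ge0 L : 0 <= chord2 L.
Proof. by rewrite /chord2; have := cospi_le1 L; lra. Qed.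

Lemma chord2_homo r s : 0 <= r -> r <= s -> chord2 r <= chord2 s.
Proof. by move=> r0 rs; rewrite /chord2; have := cospi_homo r0 rs; lra. Qed.

(** chord2 L = 4 sin^2 (L/2), and sin (L/2) = (L/2) cos c by the mean value theorem, with cos^2 c >
    1 / (1 + e) for small L. The limiting ratio 1 gives the gradient term its exact coefficient. *)
Lemma chord2_small e : 0 < e ->
  exists2 a : R, 0 < a & forall L, 0 <= L -> L < a -> L ^+ 2 <= (1 + e) * chord2 L.
Proof.
move=> e0.
have e1 : 0 < 1 + e by rewrite addr_gt0.
have e1lt : (1 + e)^-1 < 1 by rewrite invf_lt1 // ltrDl.
have : \forall x \near (0 : R), (1 + e)^-1 < cos x * cos x.
  have cc : {for (0 : R), continuous (fun x : R => cos x * cos x)}.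
    by apply: continuousM; exact: continuous_cos.
  have c1 : (1 + e)^-1 < cos 0 * cos (0 : R) by rewrite cos0 mulr1.
  exact: (cvgr_gt _ cc _ c1).
move=> /nbhs_ballP[a /= a0 ha].
have pi0 := @pi_gt0 R.
exists (Num.min a (pi / 2)); first by rewrite lt_min a0 divr_gt0.
move=> L L0; rewrite lt_min => /andP[La Lpi].
have Lp : L <= pi by apply: ltW; apply: lt_le_trans Lpi _; rewrite ler_pdivrMr // ler_peMr // ?(ltW pi0) //; lra.
rewrite /chord2 cospi_small //.
have -> : 2 - 2 * cos L = 4 * sin (L / 2) ^+ 2.
  have : cos L = cos (L / 2) ^+ 2 - sin (L / 2) ^+ 2.
    by rewrite {1}(splitr L) cosD -!expr2.
  by have := cos2Dsin2 (L / 2); lra.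
have [->|Ln0] := eqVneq L 0; first by rewrite expr0n /= mul0r sin0 expr0n /= !mulr0.
have {L0 Ln0}L0 : 0 < L by rewrite lt_neqAle eq_sym Ln0.
have L2 : 0 < L / 2 by rewrite divr_gt0.
have [c] := @MVT _ sin cos 0 (L / 2) L2 (fun x _ => is_derive_sin x)
  (continuous_subspaceT (@continuous_sin R)).
rewrite in_itv /= sin0 !subr0 => /andP[c0 cL] ->.
have cc : (1 + e)^-1 < cos c * cos c.
  by apply: ha; rewrite /ball /= sub0r normrN gtr0_norm //; lra.
have -> : (1 + e) * (4 * (cos c * (L / 2)) ^+ 2) = ((1 + e) * (cos c * cos c)) * L ^+ 2 by field.
by rewrite ler_peMl ?sqr_ge0 // -ler_pdivrMl // mulr1 ltW.
Qed.

End Chord.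

Section C1Functions.
Variables (R : realType) (d : nat).
Implicit Types (x y v : 'rV[R]_d).

Lemma nbhs_enorm (A : set 'rV[R]_d) x : nbhs x A ->
  exists2 e : R, 0 < e & forall y, enorm (x - y) < e -> A y.
Proof.
move=> /nbhs_ballP [e /= e0 eA]; exists e => // y ye.
apply: eA; split => [|i j]; first exact: e0.
rewrite !ord1; apply: le_lt_trans ye.
by have := coord_le_enorm (x - y) j; rewrite !mxE.
Qed.

(** Only x is confined to K: y may leave it, as may the mean value point in [C1_increment]. *)
Lemma compact_uniform (K : set 'rV[R]_d) (f : 'rV[R]_d -> R) (e : R) :
  compact K -> continuous f -> 0 < e ->
  exists2 a : R, 0 < a & forall x y, K x -> enorm (x - y) < a -> `|f x - f y| < e.
Proof.
move=> /compact_near_coveringP cK cf e0.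
have := cK R (0^'+) (fun a x => forall y, enorm (x - y) < a -> `|f x - f y| < e) _ _.
have e2 : 0 < e / 2 by rewrite divr_gt0.
case.
  move=> x Kx.
  have := cf x; move/(@cvgrPdist_lt _ _ _ (nbhs x) (nbhs_filter x)) => /(_ _ e2).
  move=> /nbhs_enorm[r r0 hr].
  have r2 : 0 < r / 2 by rewrite divr_gt0.
  exists ([set y | enorm (x - y) < r / 2], [set a | a < r / 2]) => /=.
    by split; [exact: near_enorm|exact: nbhs_right_lt].
  move=> [y a] /= [xy ar] z yz.
  have h1 : `|f x - f y| < e / 2 by apply: hr; lra.
  have h2 : `|f x - f z| < e / 2.
    by apply: hr; have := enorm_triangle x y z; lra.
  have -> : f y - f z = (f x - f z) - (f x - f y) by ring.
  by apply: le_lt_trans (ler_normB _ _) _; lra.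
move=> a /= a0 ha; exists (a / 2); first by rewrite divr_gt0.
move=> x y Kx; apply: ha => //; last by rewrite divr_gt0.
by rewrite /ball_ /= sub0r normrN gtr0_norm ?divr_gt0 //; lra.
Qed.

Lemma diff_grad (eta : 'rV[R]_d -> R) x v : differentiable eta x ->
  'D_v eta x = dot (grad eta x) v.
Proof.
move=> de; rewrite deriveE // {1}(row_sum_delta v) linear_sum /=.
by apply: eq_bigr => i _; rewrite linearZ /= /grad mxE deriveE // mulrC.
Qed.

Lemma C1_mean_value (eta : 'rV[R]_d -> R) x y : (forall z, differentiable eta z) ->
  exists u : R, [/\ 0 <= u, u <= 1 &
    eta y - eta x = dot (grad eta (x + u *: (y - x))) (y - x)].
Proof.
move=> de; pose f (u : R) := eta (x + u *: (y - x)).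
have df (u : R) : is_derive u 1 f (dot (grad eta (x + u *: (y - x))) (y - x)).
  have E : (fun h : R => h^-1 *: (f (h *: 1 + u) - f u)) =
      (fun h => h^-1 *: (eta (h *: (y - x) + (x + u *: (y - x))) - eta (x + u *: (y - x)))).
    apply/funext => h; rewrite /f; congr (_ *: (eta _ - _)).
    by rewrite [h%:A]mulr1 scalerDl addrCA addrA addrC addrA.
  split; rewrite ?/derivable ?/derive /= E; last by rewrite -diff_grad.
  exact: diff_derivable.
have cf : {within `[0, 1], continuous f}.
  by apply: derivable_within_continuous => u _; case: (df u).
have [u] := MVT_segment (@ler01 R) (fun u _ => df u) cf.
rewrite in_itv /= => /andP[u0 u1]; rewrite subr0 mulr1 /f scale1r scale0r addr0 subrKC => h.
by exists u.
Qed.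

Lemma C1_continuous (eta : 'rV[R]_d -> R) : C1 eta -> continuous eta.
Proof. by move=> [de _] x; exact: differentiable_continuous. Qed.

Lemma continuous_grad2 (eta : 'rV[R]_d -> R) : C1 eta ->
  continuous (fun x => dot (grad eta x) (grad eta x)).
Proof. by move=> [_ cg]; exact: continuous_dot. Qed.

Lemma compact_bound (K : set 'rV[R]_d) (f : 'rV[R]_d -> R) :
  compact K -> continuous f -> exists2 M : R, 0 < M & forall x, K x -> `|f x| <= M.
Proof.
move=> cK cf.
have /compact_bounded [M [_ hM]] := continuous_compact (continuous_subspaceT cf) cK.
exists (Num.max M 0 + 1); first by rewrite ltr_wpDl // le_max lexx orbT.
move=> x Kx; apply: (hM (Num.max M 0 + 1)); last by exists x.
by rewrite ltr_pwDr // le_max lexx.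
Qed.

(** For close points the mean value theorem and uniform continuity give the gradient at x up to e,
    and [chord2_small] replaces the Euclidean distance. At distance at least s, chord2 >= chord2 s,
    and the crude bound 4 M^2 is absorbed by the quadratic term, whence C. *)
Lemma C1_increment (K : set 'rV[R]_d) (eta : 'rV[R]_d -> R) (e : R) :
  compact K -> C1 eta -> 0 < e ->
  exists2 C : R, 0 < C & forall x y, K x -> K y ->
    (eta x - eta y) ^+ 2 <= chord2 (enorm (x - y)) *
      ((1 + e) * (dot (grad eta x) (grad eta x) + e) + C * chord2 (enorm (x - y))).
Proof.
move=> cK ce e0.
have [M M0 hM] := compact_bound cK (C1_continuous ce).
have [a a0 ha] := compact_uniform cK (continuous_grad2 ce) e0.
have [b b0 hb] := chord2_small e0.
pose s := Num.min a b / 2.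
have ab0 : 0 < Num.min a b by rewrite lt_min a0 b0.
have s0 : 0 < s by rewrite divr_gt0.
have [sa sb] : s < a /\ s < b.
  have : s < Num.min a b by rewrite /s; lra.
  by rewrite lt_min => /andP.
have cs : 0 < chord2 s.
  have := hb s (ltW s0) sb; have : 0 < s ^+ 2 by rewrite exprn_gt0.
  by move=> h1 /(lt_le_trans h1); rewrite pmulr_rgt0 // addr_gt0.
exists (4 * M ^+ 2 / chord2 s ^+ 2); first by rewrite divr_gt0 ?mulr_gt0 ?exprn_gt0.
move=> x y Kx Ky; have S0 := chord2_ge0 (enorm (x - y)).
have [xs|sx] := ltP (enorm (x - y)) s.
  have [u [u0 u1 E]] := C1_mean_value y x ce.1.
  set z := y + u *: (x - y) in E.
  have xz : enorm (x - z) < a.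
    have -> : x - z = (1 - u) *: (x - y) by rewrite /z scalerBl scale1r opprD addrA.
    have : enorm ((1 - u) *: (x - y)) <= enorm (x - y).
      rewrite -ler_sqr ?nnegrE ?enorm_ge0 // !enorm_sqr dotZl dotZr mulrA -expr2.
      by rewrite ler_piMl ?dot_ge0 // expr_le1 // ?subr_ge0 // gerBl.
    by move/le_lt_trans; apply; lra.
  have := ha x z Kx xz; rewrite ltr_norml => /andP[g1 _].
  have h1 : (eta x - eta y) ^+ 2 <= dot (grad eta z) (grad eta z) * enorm (x - y) ^+ 2.
    by rewrite E enorm_sqr; exact: dot_sqr_le.
  have h2 := hb _ (enorm_ge0 (x - y)) (lt_trans xs sb).
  have h3 : 0 <= dot (grad eta z) (grad eta z) by exact: dot_ge0.
  apply: le_trans h1 _.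
  apply: le_trans (ler_wpM2l h3 h2) _.
  rewrite [leRHS]mulrDr -[leLHS]addr0; apply: lerD; last first.
    apply: mulr_ge0 => //; apply: mulr_ge0 => //; apply: divr_ge0; last exact: sqr_ge0.
    by rewrite mulr_ge0 ?sqr_ge0.
  have -> : dot (grad eta z) (grad eta z) * ((1 + e) * chord2 (enorm (x - y))) =
    chord2 (enorm (x - y)) * ((1 + e) * dot (grad eta z) (grad eta z)) by ring.
  by rewrite ler_wpM2l // ler_wpM2l; lra.
have c1 := chord2_homo (ltW s0) sx.
have h1 : (eta x - eta y) ^+ 2 <= 4 * M ^+ 2.
  have -> : 4 * M ^+ 2 = (2 * M) ^+ 2 by ring.
  rewrite -real_normK ?num_real // ler_sqr ?nnegrE ?mulr_ge0 ?(ltW M0) //.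
  by apply: le_trans (ler_normB _ _) _; have := hM x Kx; have := hM y Ky; lra.
apply: le_trans h1 _; rewrite mulrDr -[leLHS]add0r; apply: lerD.
  by rewrite !mulr_ge0 // addr_ge0 ?dot_ge0 // ltW.
have -> : chord2 (enorm (x - y)) * (4 * M ^+ 2 / chord2 s ^+ 2 * chord2 (enorm (x - y))) =
   4 * M ^+ 2 * (chord2 (enorm (x - y)) / chord2 s) ^+ 2 by field; rewrite gt_eqF.
apply: ler_peMr; first by rewrite mulr_ge0 ?sqr_ge0.
by apply: exprn_ege1; rewrite ler_pdivlMr // mul1r.
Qed.

End C1Functions.

Section ContinuousArith.
Variables (R : realType) (d : nat).
Implicit Types f g : 'rV[R]_d -> R.

Lemma continuous_addr f g : continuous f -> continuous g ->
  continuous (fun x => f x + g x).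
Proof. by move=> cf cg x; apply: continuousD; [exact: cf|exact: cg]. Qed.

Lemma continuous_subr f g : continuous f -> continuous g ->
  continuous (fun x => f x - g x).
Proof. by move=> cf cg x; apply: continuousB; [exact: cf|exact: cg]. Qed.

Lemma continuous_mulr f g : continuous f -> continuous g ->
  continuous (fun x => f x * g x).
Proof. by move=> cf cg x; apply: continuousM; [exact: cf|exact: cg]. Qed.

End ContinuousArith.

(** * Increments of averages bounded by the cost of plans *)

Section Averages.
Variables (R : realType) (d : nat) (Omega : set 'rV[R]_d).
Hypothesis kOmega : compact Omega.
Hypothesis Omega0 : Omega !=set0.
Implicit Types (m : measure_on Omega) (f h a eta : 'rV[R]_d -> R).
Local Notation C := (cone R d).
Local Notation E := (euclidean R d).
Local Notation J m f := (\int[m]_(x in Omega) f x)%R.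

Let cOmega : closed Omega.
Proof. exact: compact_closed kOmega. Qed.

Lemma measurable_compact : measurable (Omega : set E).
Proof. exact: closed_measurable_euclidean. Qed.
Local Notation mOmega := measurable_compact.

Lemma integrable_continuous m f : continuous f -> m.-integrable Omega (EFin \o f).
Proof.
move=> cf; have [M M0 hM] := compact_bound kOmega cf.
apply: measurable_bounded_integrable.
- exact: mOmega.
- by rewrite ltey_eq fin_num_measure //; exact: mOmega.
- by apply: measurable_funS (continuous_measurable_euclidean cf) => //; exact: measurableT.
- exists M; split; first exact: num_real.
  by move=> x Mx y /hM /le_trans; apply; exact: ltW.
Qed.

Lemma avg_EFin m f : continuous f -> (\int[m]_(x in Omega) (f x)%:E = (J m f)%:E)%E.
Proof.
move=> cf; rewrite /Rintegral fineK // integrable_fin_num //; first exact: mOmega.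
exact: integrable_continuous.
Qed.

Lemma avg_EFin_ge0 m f : continuous f -> (forall x, 0 <= f x) ->
  (\int[m]_x (f x)%:E = (J m f)%:E)%E.
Proof.
move=> cf f0; rewrite -avg_EFin // -(integral_measure_on cOmega) //.
by apply/measurable_EFinP; exact: continuous_measurable_euclidean.
Qed.

Lemma avgD m f h : continuous f -> continuous h ->
  J m (fun x => f x + h x) = J m f + J m h.
Proof.
by move=> cf ch; apply: RintegralD; [exact: mOmega|exact: integrable_continuous..].
Qed.

Lemma avgB m f h : continuous f -> continuous h ->
  J m (fun x => f x - h x) = J m f - J m h.
Proof.
by move=> cf ch; apply: RintegralB; [exact: mOmega|exact: integrable_continuous..].
Qed.

Lemma avgZ m f (c : R) : continuous f -> J m (fun x => c * f x) = c * J m f.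
Proof. by move=> cf; apply: RintegralZl; [exact: mOmega|exact: integrable_continuous]. Qed.

Lemma avgN m f : continuous f -> J m (fun x => - f x) = - J m f.
Proof.
move=> cf; transitivity (J m (fun x => -1 * f x)).
  by apply: eq_Rintegral => x _; rewrite mulN1r.
by rewrite avgZ // mulN1r.
Qed.

Lemma avg_le m f h : continuous f -> continuous h ->
  (forall x, Omega x -> f x <= h x) -> J m f <= J m h.
Proof.
by move=> cf ch fh; apply: le_Rintegral => //; [exact: mOmega|exact: integrable_continuous..].
Qed.

(** r^2 times the indicator of the complement of Omega has integral 0. Pointwise inequalities on
    plans are then needed only for base points in the compact set Omega. *)
Lemma plan_support (g : {measure set (C * C)%type -> \bar R}) m (pr : C * C -> C) :
  measurable_fun setT pr ->
  (forall phi : E -> \bar R, measurable_fun setT phi -> (forall x, 0 <= phi x)%E ->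
     (\int[g]_p ((cone_rad (pr p) ^+ 2)%:E * phi (cone_pos (pr p))) =
      \int[m]_x phi x)%E) ->
  {ae g, forall p, cone_rad (pr p) = 0 \/ Omega (cone_pos (pr p))}.
Proof.
move=> mpr gm.
have mN : measurable_fun setT (EFin \o \1_(~` Omega) : E -> \bar R).
  by apply/measurable_EFinP; apply: measurable_indic; exact: measurableC mOmega.
have mF : measurable_fun setT (fun p => ((cone_rad (pr p) ^+ 2)%:E *
    (EFin \o \1_(~` Omega)) (cone_pos (pr p)))%E).
  exact: (measurableT_comp (measurable_rad2_pos mN) mpr).
have : (\int[g]_p `|(cone_rad (pr p) ^+ 2)%:E *
    (EFin \o \1_(~` Omega)) (cone_pos (pr p))| = 0)%E.
  under eq_integral do rewrite gee0_abs ?mule_ge0 ?lee_fin ?sqr_ge0 //.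
  rewrite gm //; last by move=> z; rewrite lee_fin.
  transitivity (m (~` (Omega : set E))); last exact: measure_on_setC.
  by rewrite integral_indic ?setIT //; exact: measurableC mOmega.
move=> /(ae_eq_integral_abs _ measurableT mF) [N [mN' N0 sN]].
exists N; split => // p /= hp; apply: sN => /= /(_ Logic.I).
move/eqP; rewrite -EFinM eqe mulf_eq0 sqrf_eq0 => /orP[/eqP h|].
  by apply: hp; left.
rewrite indicE; case: (boolP (_ \in _)) => [|/negP h _]; first by rewrite /= oner_eq0.
by apply: hp; right; apply: contrapT => h'; apply: h; apply/mem_set.
Qed.

Section PlanEstimate.
Variables (g : {measure set (C * C)%type -> \bar R}) (m0 m1 : measure_on Omega).
Hypothesis hg : hkplan g m0 m1.
Hypothesis cg : (plan_cost g < +oo)%E.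

Let p0 h (p : C * C) : R := cone_rad p.1 ^+ 2 * h (cone_pos p.1).
Let p1 h (p : C * C) : R := cone_rad p.2 ^+ 2 * h (cone_pos p.2).

Let mp0 h : continuous h -> measurable_fun setT (p0 h).
Proof.
move=> ch; have mh := continuous_measurable_euclidean ch.
apply: measurable_funM.
  exact: measurable_funX (measurableT_comp (@measurable_cone_rad R d) measurable_fst).
exact: (measurableT_comp mh (measurableT_comp (@measurable_cone_pos R d) measurable_fst)).
Qed.

Let mp1 h : continuous h -> measurable_fun setT (p1 h).
Proof.
move=> ch; have mh := continuous_measurable_euclidean ch.
apply: measurable_funM.
  exact: measurable_funX (measurableT_comp (@measurable_cone_rad R d) measurable_snd).
exact: (measurableT_comp mh (measurableT_comp (@measurable_cone_pos R d) measurable_snd)).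
Qed.

Let i0 h : continuous h -> (forall x, 0 <= h x) ->
  (\int[g]_p (p0 h p)%:E = (J m0 h)%:E)%E.
Proof.
move=> ch h0; rewrite -avg_EFin_ge0 //.
case: hg => _ <- // ; last by apply/measurable_EFinP; exact: continuous_measurable_euclidean.
Qed.

Let i1 h : continuous h -> (forall x, 0 <= h x) ->
  (\int[g]_p (p1 h p)%:E = (J m1 h)%:E)%E.
Proof.
move=> ch h0; rewrite -avg_EFin_ge0 //.
case: hg => _ _ <- // ; last by apply/measurable_EFinP; exact: continuous_measurable_euclidean.
Qed.

Let intD (u v : C * C -> R) : measurable_fun setT u -> measurable_fun setT v ->
  (forall p, 0 <= u p) -> (forall p, 0 <= v p) ->
  (\int[g]_p (u p + v p)%:E = \int[g]_p (u p)%:E + \int[g]_p (v p)%:E)%E.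
Proof.
move=> mu mv u0 v0; under eq_integral do rewrite EFinD.
rewrite ge0_integralD //.
- by move=> p _; rewrite lee_fin.
- exact/measurable_EFinP.
- by move=> p _; rewrite lee_fin.
- exact/measurable_EFinP.
Qed.

(** The pointwise inequality is integrated over the plan. Since the marginal identities concern
    nonnegative functions, f is split as fp - fm and negative terms change sides first. *)
Lemma plan_estimate f a (c : R) : continuous f -> continuous a ->
  (forall x, 0 <= a x) -> 0 <= c ->
  (forall x0 x1 r0 r1, Omega x0 -> Omega x1 -> 0 <= r0 -> 0 <= r1 ->
     r1 ^+ 2 * f x1 - r0 ^+ 2 * f x0 <=
     r0 ^+ 2 * a x0 + r1 ^+ 2 * a x1 + c * cdist2 r0 r1 (enorm (x0 - x1))) ->
  J m1 f - J m0 f <= J m0 a + J m1 a + c * fine (plan_cost g).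
Proof.
move=> cf ca a0 c0 fa.
pose fp (x : 'rV[R]_d) : R := (`|f x| + f x) / 2.
pose fm (x : 'rV[R]_d) : R := (`|f x| - f x) / 2.
have cnf : continuous (fun x => `|f x|) by move=> x; apply: continuous_comp; [exact: cf|exact: norm_continuous].
have cfp : continuous fp.
  by apply: continuous_mulr; [exact: continuous_addr|exact: cst_continuous].
have cfm : continuous fm.
  by apply: continuous_mulr; [exact: continuous_subr|exact: cst_continuous].
have fp0 x : 0 <= fp x by rewrite divr_ge0 // -lerBlDr sub0r -normrN ler_norm.
have fm0 x : 0 <= fm x by rewrite divr_ge0 // subr_ge0 ler_norm.
have fE : f = fun x => fp x - fm x by apply/funext => x; rewrite /fp /fm; field.
pose cost (p : C * C) := c * dcone p.1 p.2 ^+ 2.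
have mcost : measurable_fun setT cost.
  apply: measurable_funM => //.
  by apply: measurable_dcone2; [exact: measurable_fst|exact: measurable_snd].
have r0 z h : (forall x, 0 <= h x) -> 0 <= p0 h z by move=> h0; rewrite mulr_ge0 ?sqr_ge0.
have r1 z h : (forall x, 0 <= h x) -> 0 <= p1 h z by move=> h0; rewrite mulr_ge0 ?sqr_ge0.
have cost0 p : 0 <= cost p by rewrite mulr_ge0 ?sqr_ge0.
pose u p := p1 fp p + p0 fm p.
pose v p := p0 fp p + (p1 fm p + (p0 a p + (p1 a p + cost p))).
have mu : measurable_fun setT u by apply: measurable_funD; [exact: mp1|exact: mp0].
have mv4 : measurable_fun setT (fun p => p1 a p + cost p).
  by apply: measurable_funD; [exact: mp1|].
have mv3 : measurable_fun setT (fun p => p0 a p + (p1 a p + cost p)).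
  by apply: measurable_funD; [exact: mp0|].
have mv2 : measurable_fun setT (fun p => p1 fm p + (p0 a p + (p1 a p + cost p))).
  by apply: measurable_funD; [exact: mp1|].
have mv : measurable_fun setT v by apply: measurable_funD; [exact: mp0|].
have v4 p : 0 <= p1 a p + cost p by rewrite addr_ge0 ?r1.
have v3 p : 0 <= p0 a p + (p1 a p + cost p) by rewrite addr_ge0 ?r0.
have v2 p : 0 <= p1 fm p + (p0 a p + (p1 a p + cost p)) by rewrite addr_ge0 ?r1.
have v0 p : 0 <= v p by rewrite addr_ge0 ?r0.
have u0 p : 0 <= u p by rewrite addr_ge0 ?r0 ?r1.
have ae_uv : {ae g, forall p, setT p -> ((u p)%:E <= (v p)%:E)%E}.
  case: hg => _ g0 g1.
  have := plan_support measurable_snd g1; apply: filterS2 (plan_support measurable_fst g0).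
  move=> p h0 h1 _; rewrite lee_fin /u /v /cost /p0 /p1 dcone2E.
  (* At radius 0 the base point may be replaced by any point of Omega, every term that contains it
     being multiplied by the radius. *)
  have {h0}[x0 Ox0 [e0 e0']] : exists2 x0, Omega x0 &
      (forall h, cone_rad p.1 ^+ 2 * h (cone_pos p.1) = cone_rad p.1 ^+ 2 * h x0) /\
      (forall L y, cone_rad p.1 * L (enorm (cone_pos p.1 - y)) = cone_rad p.1 * L (enorm (x0 - y)) :> R).
    case: h0 => [->|O]; last by exists (cone_pos p.1).
    by case: Omega0 => x Ox; exists x => //; split => *; rewrite ?expr0n !mul0r.
  have {h1}[x1 Ox1 [e1 e1']] : exists2 x1, Omega x1 &
      (forall h, cone_rad p.2 ^+ 2 * h (cone_pos p.2) = cone_rad p.2 ^+ 2 * h x1) /\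
      (forall L y, cone_rad p.2 * L (enorm (y - cone_pos p.2)) = cone_rad p.2 * L (enorm (y - x1)) :> R).
    case: h1 => [->|O]; last by exists (cone_pos p.2).
    by case: Omega0 => x Ox; exists x => //; split => *; rewrite ?expr0n !mul0r.
  rewrite !e0 !e1 /cdist2.
  have -> : 2 * cone_rad p.1 * cone_rad p.2 * cospi (enorm (cone_pos p.1 - cone_pos p.2)) =
     2 * cone_rad p.1 * cone_rad p.2 * cospi (enorm (x0 - x1)).
    have E0 := e0' (fun L => cospi L) (cone_pos p.2).
    have E1 := e1' (fun L => cospi L) x0.
    transitivity (2 * cone_rad p.2 * (cone_rad p.1 * cospi (enorm (cone_pos p.1 - cone_pos p.2)))); first by ring.
    rewrite {}E0.
    transitivity (2 * cone_rad p.1 * (cone_rad p.2 * cospi (enorm (x0 - cone_pos p.2)))); first by ring.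
    by rewrite {}E1; ring.
  have := fa x0 x1 (cone_rad p.1) (cone_rad p.2) Ox0 Ox1 (cone_rad_ge0 _) (cone_rad_ge0 _).
  by rewrite /cdist2 fE /=; lra.
have key : (\int[g]_p (u p)%:E <= \int[g]_p (v p)%:E)%E.
  apply: ae_ge0_le_integral => //.
  - by move=> p _; rewrite lee_fin.
  - exact/measurable_EFinP.
  - by move=> p _; rewrite lee_fin.
  - exact/measurable_EFinP.
have costE : (\int[g]_p (cost p)%:E = (c * fine (plan_cost g))%:E)%E.
  rewrite EFinM fineK; last by rewrite ge0_fin_numE ?plan_cost_ge0.
  rewrite /plan_cost -ge0_integralZl_EFin //.
  - by move=> p _; rewrite lee_fin sqr_ge0.
  - by apply/measurable_EFinP; apply: measurable_dcone2; [exact: measurable_fst|exact: measurable_snd].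
move: key; rewrite /u /v intD; [|exact: mp1|exact: mp0|by move=> p; exact: r1|by move=> p; exact: r0].
rewrite intD //; [|exact: mp0|by move=> p; exact: r0].
rewrite intD //; [|exact: mp1|by move=> p; exact: r1].
rewrite intD //; [|exact: mp0|by move=> p; exact: r0].
rewrite intD //; [|exact: mp1|by move=> p; exact: r1].
rewrite costE !i0 // !i1 // -!EFinD lee_fin.
have -> : J m1 f = J m1 fp - J m1 fm by rewrite -avgB //; congr (Rintegral _ _ _).
have -> : J m0 f = J m0 fp - J m0 fm by rewrite -avgB //; congr (Rintegral _ _ _).
by lra.
Qed.

End PlanEstimate.

Lemma HK_estimate f a (c D : R) m0 m1 : continuous f -> continuous a ->
  (forall x, 0 <= a x) -> 0 <= c ->
  (forall x0 x1 r0 r1, Omega x0 -> Omega x1 -> 0 <= r0 -> 0 <= r1 ->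
     `|r1 ^+ 2 * f x1 - r0 ^+ 2 * f x0| <=
     r0 ^+ 2 * a x0 + r1 ^+ 2 * a x1 + c * cdist2 r0 r1 (enorm (x0 - x1))) ->
  (HK m0 m1 <= D%:E)%E ->
  `|J m1 f - J m0 f| <= J m0 a + J m1 a + c * D ^+ 2.
Proof.
move=> cf ca a0 c0 fa hD.
have D0 : 0 <= D by rewrite -lee_fin (le_trans (HK_ge0 _ _) hD).
apply/ler_addgt0Pr => e e0.
(* For t <= 1, (D + t)^2 <= D^2 + t (2 D + 1); this t makes c times the excess at most e. *)
pose t := Num.min 1 (e / (c * (2 * D + 1) + 1)).
have k0 : 0 < c * (2 * D + 1) + 1 by rewrite ltr_wpDl // mulr_ge0 //; lra.
have t0 : 0 < t by rewrite lt_min ltr01 divr_gt0.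
have t1 : t <= 1 by rewrite ge_min lexx.
have te : t * (c * (2 * D + 1) + 1) <= e by rewrite -ler_pdivlMr // ge_min lexx orbT.
have : (HK m0 m1 < (D + t)%:E)%E by apply: (le_lt_trans hD); rewrite lte_fin; lra.
move=> /(HK_lt_plan cOmega Omega0)[g [hg gc]].
have gfin : (plan_cost g < +oo)%E by apply: lt_trans gc _; rewrite ltry.
have gc' : fine (plan_cost g) <= (D + t) ^+ 2.
  by rewrite -lee_fin fineK ?ltW // ge0_fin_numE ?plan_cost_ge0.
have cgc : c * fine (plan_cost g) <= c * D ^+ 2 + e.
  apply: le_trans (ler_wpM2l c0 gc') _.
  have h1 : 0 <= t * (1 - t) by rewrite mulr_ge0 ?subr_ge0 // ltW.
  have := mulr_ge0 c0 h1; nra.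
have up := plan_estimate hg gfin cf ca a0 c0.
have cNf : continuous (fun x => - f x) by move=> x; apply: continuousN; exact: cf.
have dn := plan_estimate hg gfin cNf ca a0 c0.
rewrite !avgN // in dn.
rewrite ler_norml; apply/andP; split.
  suff : - J m1 f - - J m0 f <= J m0 a + J m1 a + c * fine (plan_cost g) by lra.
  apply: dn => x0 x1 r0 r1 Ox0 Ox1 r00 r10; have := fa _ _ _ _ Ox0 Ox1 r00 r10.
  by rewrite ler_norml => /andP[]; lra.
suff : J m1 f - J m0 f <= J m0 a + J m1 a + c * fine (plan_cost g) by lra.
apply: up => x0 x1 r0 r1 Ox0 Ox1 r00 r10; have := fa _ _ _ _ Ox0 Ox1 r00 r10.
by rewrite ler_norml => /andP[]; lra.
Qed.

(** |r1^2 - r0^2| <= (r1 - r0)^2 + (r0 + r1)^2 / 4 <= (r1 - r0)^2 + (r0^2 + r1^2) / 2, so half of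
    the mass of m1 moves to the left-hand side. This will bound the masses along the curve. *)
Lemma HK_mass (D : R) m0 m1 : (HK m0 m1 <= D%:E)%E ->
  J m1 (cst 1) <= 3 * J m0 (cst 1) + 2 * D ^+ 2.
Proof.
move=> hD; have c1 (c : R) : continuous (cst c : 'rV[R]_d -> R) by exact: cst_continuous.
have half m : J m (cst 2^-1) = 2^-1 * J m (cst 1).
  by rewrite -avgZ //; apply: eq_Rintegral => x _; rewrite /= mulr1.
suff hh : forall (x0 x1 : 'rV[R]_d) r0 r1, Omega x0 -> Omega x1 -> 0 <= r0 -> 0 <= r1 ->
     `|r1 ^+ 2 * cst 1 x1 - r0 ^+ 2 * cst 1 x0| <=
     r0 ^+ 2 * cst 2^-1 x0 + r1 ^+ 2 * cst 2^-1 x1 + 1 * cdist2 r0 r1 (enorm (x0 - x1)).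
  have half0 : (0 : R) <= 2^-1 by rewrite invr_ge0.
  have := @HK_estimate (cst 1) (cst 2^-1) 1 D m0 m1 (c1 1) (c1 _) (fun _ => half0) ler01 hh hD.
  rewrite !half ler_norml => /andP[_]; lra.
move=> x0 x1 r0 r1 _ _ r00 r10 /=.
have := cdist2_ge (enorm (x0 - x1)) r00 r10.
rewrite !mulr1 mul1r ler_norml => h.
by apply/andP; split; have := sqr_ge0 (r0 + r1); have := sqr_ge0 (r0 - r1);
  have := sqr_ge0 (r1 - r0 + (r0 + r1) / 2); have := sqr_ge0 (r1 - r0 - (r0 + r1) / 2); nra.
Qed.

(** Meant for functions that are merely continuous, such as |grad eta|^2. In c, M^2 / e comes from
    Young's inequality for the radial increment, and 2 M / chord2 s from pairs of distant base
    points. *)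
Lemma HK_continuity f (e : R) : continuous f -> 0 < e ->
  exists2 c : R, 0 <= c & forall m0 m1 (D : R), (HK m0 m1 <= D%:E)%E ->
    `|J m1 f - J m0 f| <= e * (J m0 (cst 1) + J m1 (cst 1)) + c * D ^+ 2.
Proof.
move=> cf e0; have [M M0 hM] := compact_bound kOmega cf.
have [b b0 hb] := compact_uniform kOmega cf e0.
have [k k0 hk] := @chord2_small R 1 ltr01.
pose s := Num.min b k / 2.
have bk0 : 0 < Num.min b k by rewrite lt_min b0 k0.
have s0 : 0 < s by rewrite divr_gt0.
have [sb sk] : s < b /\ s < k.
  have : s < Num.min b k by rewrite /s; lra.
  by rewrite lt_min => /andP.
have cs : 0 < chord2 s.
  have := hk s (ltW s0) sk; have : 0 < s ^+ 2 by rewrite exprn_gt0.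
  by move=> h1 /(lt_le_trans h1); lra.
pose c := M ^+ 2 / e + 2 * M / chord2 s.
have c0 : 0 <= c by rewrite addr_ge0 ?divr_ge0 ?sqr_ge0 ?mulr_ge0 ?(ltW M0) ?(ltW e0) ?(ltW cs).
exists c => // m0 m1 D hD.
have ce : continuous (cst e : 'rV[R]_d -> R) by exact: cst_continuous.
have c1 : continuous (cst 1 : 'rV[R]_d -> R) by exact: cst_continuous.
have JE m : J m (cst e) = e * J m (cst 1).
  by rewrite -avgZ //; apply: eq_Rintegral => x _; rewrite /= mulr1.
have := @HK_estimate f (cst e) c D m0 m1 cf ce (fun _ => ltW e0) c0 _ hD.
rewrite !JE mulrDr; apply => x0 x1 r0 r1 Ox0 Ox1 r00 r10 /=.
rewrite cdist2_chord2; set S := chord2 _.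
have S0 : 0 <= S by exact: chord2_ge0.
have rr : 0 <= r0 * r1 by exact: mulr_ge0.
have q1 : M ^+ 2 / e * (r0 - r1) ^+ 2 + e * (r0 ^+ 2 + r1 ^+ 2) / 2 >=
    `|(r1 - r0) * ((r1 * f x1 + r0 * f x0))|.
  have h1 : `|r1 * f x1 + r0 * f x0| <= M * (r0 + r1).
    apply: le_trans (ler_normD _ _) _; rewrite !normrM !(ger0_norm r00, ger0_norm r10).
    have := ler_wpM2l r00 (hM _ Ox0); have := ler_wpM2l r10 (hM _ Ox1); lra.
  rewrite normrM; apply: le_trans (ler_wpM2l (normr_ge0 _) h1) _.
  have <- : `|r1 - r0| ^+ 2 = (r0 - r1) ^+ 2 by rewrite real_normK ?num_real //; ring.
  set P := `|r1 - r0|.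
  have -> : M ^+ 2 / e * P ^+ 2 = (M * P) ^+ 2 / e by field; rewrite gt_eqF.
  have h2 : (M * P) * (r0 + r1) <= (M * P) ^+ 2 / e + e * (r0 + r1) ^+ 2 / 4.
    have : 0 <= (M * P - e * (r0 + r1) / 2) ^+ 2 / e by rewrite divr_ge0 ?sqr_ge0 // ltW.
    have -> : (M * P - e * (r0 + r1) / 2) ^+ 2 / e =
      (M * P) ^+ 2 / e - (M * P) * (r0 + r1) + e * (r0 + r1) ^+ 2 / 4 by field; rewrite gt_eqF.
    lra.
  have : 0 <= e * (r0 - r1) ^+ 2 by rewrite mulr_ge0 ?sqr_ge0 // ltW.
  by nra.
have q2 : `|r0 * r1 * (f x1 - f x0)| <= e * (r0 ^+ 2 + r1 ^+ 2) / 2 +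
    2 * M / chord2 s * (r0 * r1 * S).
  rewrite normrM (ger0_norm rr).
  have h3 : 0 <= 2 * M / chord2 s * (r0 * r1 * S).
    by rewrite !mulr_ge0 // ?invr_ge0 ?(ltW M0) ?(ltW cs).
  have [xs|sx] := ltP (enorm (x0 - x1)) s.
    have := hb x0 x1 Ox0 (lt_trans xs sb); rewrite distrC => /ltW h.
    have := ler_wpM2l rr h; have : 0 <= e * (r0 - r1) ^+ 2 by rewrite mulr_ge0 ?sqr_ge0 // ltW.
    by nra.
  have sS : chord2 s <= S by apply: chord2_homo => //; exact: ltW.
  have h4 : 2 * M * (r0 * r1) <= 2 * M / chord2 s * (r0 * r1 * S).
    have -> : 2 * M / chord2 s * (r0 * r1 * S) = 2 * M * (r0 * r1) * (S / chord2 s) by ring.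
    by rewrite ler_peMr ?mulr_ge0 ?(ltW M0) // ler_pdivlMr // mul1r.
  have h5 : `|f x1 - f x0| <= 2 * M.
    by apply: le_trans (ler_normB _ _) _; have := hM _ Ox0; have := hM _ Ox1; lra.
  have := ler_wpM2l rr h5; have : 0 <= e * (r0 ^+ 2 + r1 ^+ 2).
    by rewrite mulr_ge0 ?addr_ge0 ?sqr_ge0 // ltW.
  by lra.
have -> : r1 ^+ 2 * f x1 - r0 ^+ 2 * f x0 =
  (r1 - r0) * (r1 * f x1 + r0 * f x0) + r0 * r1 * (f x1 - f x0) by ring.
apply: le_trans (ler_normD _ _) _.
have h6 : 0 <= M ^+ 2 / e * (r0 * r1 * S).
  by rewrite mulr_ge0 ?(mulr_ge0 rr S0) // divr_ge0 ?sqr_ge0 // ltW.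
have h7 : 0 <= 2 * M / chord2 s * (r0 - r1) ^+ 2.
  by rewrite mulr_ge0 ?sqr_ge0 // divr_ge0 ?mulr_ge0 ?(ltW M0) ?(ltW cs).
by rewrite /c; lra.
Qed.


(** At e = 0 this is a quarter of |grad eta|^2 + 4 eta^2; e > 0 carries the errors of
    [C1_increment]. *)
Definition energy (e : R) (eta : 'rV[R]_d -> R) (x : 'rV[R]_d) : R :=
  eta x ^+ 2 + (1 + e) * (dot (grad eta x) (grad eta x) + e) / 4.

Lemma continuous_energy e eta : C1 eta -> continuous (energy e eta).
Proof.
move=> ceta; have cE := C1_continuous ceta; have cG := continuous_grad2 ceta.
apply: continuous_addr; first exact: continuous_mulr.
apply: continuous_mulr; last exact: cst_continuous.
apply: continuous_mulr; first exact: cst_continuous.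
by apply: continuous_addr => //; exact: cst_continuous.
Qed.

Lemma energy_ge0 e eta x : 0 < e -> 0 <= energy e eta x.
Proof.
move=> e0; rewrite addr_ge0 ?sqr_ge0 // divr_ge0 // mulr_ge0 ?addr_ge0 ?dot_ge0 //.
  exact: ltW.
exact: ltW.
Qed.

(** tau is the parameter of Young's inequality, left free: the time step gives the derivative
    estimate, and tau = D the Lipschitz estimate. *)
Lemma HK_C1 eta (e : R) : C1 eta -> 0 < e ->
  exists2 c : R, 0 <= c & forall (tau D : R) m0 m1, 0 < tau -> (HK m0 m1 <= D%:E)%E ->
    `|J m1 eta - J m0 eta| <=
      tau * (J m0 (energy e eta) + J m1 (energy e eta)) + ((2 * tau)^-1 + tau * c / 2) * D ^+ 2.
Proof.
move=> ceta e0; have [c c0 hc] := C1_increment kOmega ceta e0.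
exists c; first exact: ltW.
move=> tau D m0 m1 tau0 hD.
pose b := energy e eta; rewrite -/b.
have cb : continuous b by exact: continuous_energy.
have b0 x : 0 <= b x by exact: energy_ge0.
have cF : continuous (fun x => tau * b x).
  by move=> x; apply: continuousM; [exact: cst_continuous|exact: cb].
have k0 : 0 <= (2 * tau)^-1 + tau * c / 2.
  by rewrite addr_ge0 ?invr_ge0 ?divr_ge0 ?mulr_ge0 ?(ltW tau0) ?(ltW c0).
have := @HK_estimate eta (fun x => tau * b x) _ D m0 m1 (C1_continuous ceta) cF _ k0 _ hD.
rewrite !avgZ // mulrDr; apply; first by move=> x; rewrite mulr_ge0 // ltW.
move=> x0 x1 r0 r1 Ox0 Ox1 r00 r10; rewrite cdist2_chord2.
have i01 := hc x0 x1 Ox0 Ox1; have i10 := hc x1 x0 Ox1 Ox0.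
rewrite enormB in i10; move: i01 i10; set S := chord2 _.
have S0 : 0 <= S by exact: chord2_ge0.
rewrite /b /energy; set g0 := (1 + e) * _; set g1 := (1 + e) * _.
have -> : (eta x1 - eta x0) ^+ 2 = (eta x0 - eta x1) ^+ 2 by ring.
set P := eta x0 - eta x1 => i01 i10.
have rr : 0 <= r0 * r1 by exact: mulr_ge0.
have [g00 g10] : 0 <= g0 /\ 0 <= g1.
  by split; rewrite mulr_ge0 ?addr_ge0 ?dot_ge0 // ltW.
(* Cauchy-Schwarz for the decomposition
   [r1^2 f1 - r0^2 f0 = (r1 - r0) (r1 f1 + r0 f0) + r0 r1 (f1 - f0)]. *)
have mid : r0 * r1 * `|P| <= r0 * r1 * S / (2 * tau) +
    tau / 2 * ((r0 ^+ 2 * g0 + r1 ^+ 2 * g1) / 2 + c * (r0 * r1 * S)).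
  (* [C1_increment] holds with the gradient at either end. The smaller value is used, as r0 r1
     min(g0, g1) <= (r0^2 g0 + r1^2 g1) / 2. *)
  pose B := Num.min g0 g1 + c * S.
  have B0 : 0 <= B by rewrite addr_ge0 ?mulr_ge0 ?(ltW c0) // le_min g00.
  have PB : P ^+ 2 <= S * B.
    by rewrite /B minEle; case: ifP => _; rewrite ?i01 ?i10.
  have PB' : `|P| <= S / (2 * tau) + tau / 2 * B.
    rewrite -ler_sqr ?nnegrE ?addr_ge0 ?mulr_ge0 ?invr_ge0 ?divr_ge0 ?mulr_ge0 ?(ltW tau0) //.
    rewrite real_normK ?num_real //; apply: (le_trans PB).
    have : 0 <= (S / (2 * tau) - tau / 2 * B) ^+ 2 by exact: sqr_ge0.
    have -> : (S / (2 * tau) + tau / 2 * B) ^+ 2 = (S / (2 * tau) - tau / 2 * B) ^+ 2 + S * B.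
      by field; rewrite gt_eqF.
    lra.
  apply: le_trans (ler_wpM2l rr PB') _.
  have : r0 * r1 * Num.min g0 g1 <= (r0 ^+ 2 * g0 + r1 ^+ 2 * g1) / 2.
    have : 0 <= Num.min g0 g1 by rewrite le_min g00.
    have h0 : Num.min g0 g1 <= g0 by rewrite ge_min lexx.
    have h1 : Num.min g0 g1 <= g1 by rewrite ge_min lexx orbT.
    move: (Num.min g0 g1) h0 h1 => B' h0 h1 B0'.
    have := ler_wpM2l (sqr_ge0 r0) h0; have := ler_wpM2l (sqr_ge0 r1) h1.
    have := mulr_ge0 B0' (sqr_ge0 (r0 - r1)); nra.
  have t2 : 0 <= tau / 2 by rewrite divr_ge0 // ltW.
  move=> /(ler_wpM2l t2); rewrite /B; move: (Num.min g0 g1) => B'; nra.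
have left : `|(r1 - r0) * (r1 * eta x1 + r0 * eta x0)| <=
    (r0 - r1) ^+ 2 / (2 * tau) + tau * (r0 ^+ 2 * eta x0 ^+ 2 + r1 ^+ 2 * eta x1 ^+ 2).
  rewrite normrM; set Q := `|r1 * eta x1 + r0 * eta x0|; set N := `|r1 - r0|.
  have -> : (r0 - r1) ^+ 2 = N ^+ 2 by rewrite /N real_normK ?num_real //; ring.
  have QE : Q ^+ 2 <= 2 * (r0 ^+ 2 * eta x0 ^+ 2 + r1 ^+ 2 * eta x1 ^+ 2).
    rewrite /Q real_normK ?num_real //.
    by have := sqr_ge0 (r1 * eta x1 - r0 * eta x0); lra.
  have : N * Q <= N ^+ 2 / (2 * tau) + tau / 2 * Q ^+ 2.
    have : 0 <= (N - tau * Q) ^+ 2 / (2 * tau).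
      by rewrite divr_ge0 ?sqr_ge0 // mulr_ge0 // ltW.
    have -> : (N - tau * Q) ^+ 2 / (2 * tau) = N ^+ 2 / (2 * tau) - N * Q + tau / 2 * Q ^+ 2.
      by field; rewrite gt_eqF.
    lra.
  have t2 : 0 <= tau / 2 by rewrite divr_ge0 // ltW.
  have := ler_wpM2l t2 QE; lra.
have -> : r1 ^+ 2 * eta x1 - r0 ^+ 2 * eta x0 =
  (r1 - r0) * (r1 * eta x1 + r0 * eta x0) + r0 * r1 * (eta x1 - eta x0) by ring.
apply: le_trans (ler_normD _ _) _.
rewrite [`|r0 * r1 * _|]normrM (ger0_norm rr) (distrC (eta x1)) -/P.
have : 0 <= tau * c / 2 * (r0 - r1) ^+ 2.
  by rewrite mulr_ge0 ?sqr_ge0 // divr_ge0 // mulr_ge0 // ltW.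
lra.
Qed.

End Averages.

(** * Absolutely continuous functions and metric speed *)

Section MonotoneDensity.
Variable R : realType.
Local Notation leb := (@lebesgue_measure R).
Variable m : R -> R.
Hypothesis im : leb.-integrable setT (EFin \o m).
Hypothesis m0 : forall x, 0 <= m x.

Lemma integral_itv_small (e : R) : 0 < e ->
  exists2 a : R, 0 < a & forall s t, s <= t -> t - s < a -> \int[leb]_(x in `]s, t]) m x < e.
Proof.
move=> e0; have [a [a0 ha]] := integral_normr_continuous im e0.
exists a => // s t st sta.
have sa : (lebesgue_measure (`]s, t]%classic : set R) < a%:E)%E.
  by rewrite lebesgue_measure_itv /=; case: ifP => _; rewrite -?EFinD lte_fin.
have := ha _ (measurable_itv `]s, t]) sa.
by under eq_Rintegral do rewrite ger0_norm //.
Qed.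

Lemma continuous_integral_bound (F : R -> R) :
  (forall s t, s <= t -> `|F t - F s| <= \int[leb]_(x in `]s, t]) m x) -> continuous F.
Proof.
move=> hF x; apply/cvgrPdist_lt => e /integral_itv_small [a a0 ha].
apply/nbhs_ballP; exists a => // y /=; rewrite /ball /= => xy.
have [h|h] := leP x y.
  rewrite distrC; apply: le_lt_trans (hF _ _ h) _; apply: ha => //.
  by apply: le_lt_trans (ler_norm _) _; rewrite distrC.
apply: le_lt_trans (hF _ _ (ltW h)) _; apply: ha; first exact: ltW.
exact: le_lt_trans (ler_norm _) _.
Qed.

Let M x := \int[leb]_(y in `]-oo, x]) m y.

Lemma integral_oc_B s t : s <= t -> M t - M s = \int[leb]_(x in `]s, t]) m x.
Proof.
move=> st; rewrite /M Rintegral_itvB //.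
by apply: integrableS im => //; exact: measurable_itv.
Qed.

Lemma lebesgue_stieltjes_oc (G : cumulative R R) s t : s <= t ->
  lebesgue_stieltjes_measure G `]s, t]%classic = (G t - G s)%:E.
Proof.
move=> st; rewrite /lebesgue_stieltjes_measure/= /measure_extension measurable_mu_extE /=; last exact: is_ocitv.
by rewrite wlength_itv_bnd.
Qed.

(** H = M - G is increasing too, so the Stieltjes measures of G and H add up to m dx, by uniqueness
    on half-open intervals. That of G is thus dominated by m dx, and Radon-Nikodym gives its
    density. *)
Lemma monotone_density (G : R -> R) : {homo G : x y / x <= y} ->
  (forall s t, s <= t -> G t - G s <= \int[leb]_(x in `]s, t]) m x) ->
  exists g : R -> R, leb.-integrable setT (EFin \o g) /\
    forall s t, s <= t -> G t - G s = \int[leb]_(x in `]s, t]) g x.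
Proof.
move=> ndG hG.
pose H x := M x - G x.
have ndM : {homo M : x y / x <= y}.
  by move=> s t st; rewrite -subr_ge0 integral_oc_B // Rintegral_ge0.
have ndH : {homo H : x y / x <= y}.
  move=> s t st; have := hG _ _ st; rewrite -integral_oc_B // /H; lra.
have bM s t : s <= t -> `|M t - M s| <= \int[leb]_(x in `]s, t]) m x.
  by move=> st; rewrite -integral_oc_B // ger0_norm // subr_ge0 ndM.
have bG s t : s <= t -> `|G t - G s| <= \int[leb]_(x in `]s, t]) m x.
  by move=> st; rewrite ger0_norm ?hG // subr_ge0 ndG.
have bH s t : s <= t -> `|H t - H s| <= \int[leb]_(x in `]s, t]) m x.
  move=> st; rewrite ger0_norm; last by rewrite subr_ge0 ndH.
  have := ndG _ _ st; rewrite -integral_oc_B // /H; lra.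
have rc (F : R -> R) : (forall s t, s <= t -> `|F t - F s| <= \int[leb]_(x in `]s, t]) m x) ->
    right_continuous F.
  by move=> hF; apply: right_continuousW; exact: continuous_integral_bound.
pose HM := isCumulative.Build R _ R M ndM (rc _ bM).
pose HG := isCumulative.Build R _ R G ndG (rc _ bG).
pose HH := isCumulative.Build R _ R H ndH (rc _ bH).
pose cM : cumulative R R := HB.pack M HM.
pose cG : cumulative R R := HB.pack G HG.
pose cH : cumulative R R := HB.pack H HH.
have mm : measurable_fun setT m by apply/measurable_EFinP; case/integrableP: im.
have [n [nA _]] := density_measure leb mm m0.
have nfin : (n setT < +oo)%E.
  rewrite nA; case/integrableP: im => _; congr (_ < _)%E.
  by apply: eq_integral => x _ /=; rewrite ger0_norm.
have noc s t : s <= t -> n `]s, t]%classic = (M t - M s)%:E.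
  move=> st; rewrite nA integral_oc_B // /Rintegral fineK // integrable_fin_num //=.
  by apply: integrableS im => //; exact: measurable_itv.
pose nGH := measure_add (lebesgue_stieltjes_measure cG) (lebesgue_stieltjes_measure cH).
have sumE A : measurable A ->
    (lebesgue_stieltjes_measure cG A + lebesgue_stieltjes_measure cH A = n A)%E.
  move=> mA; transitivity (lebesgue_stieltjes_measure cM A).
    rewrite -[LHS]measure_addE; apply/esym.
    apply: (@lebesgue_stieltjes_measure_unique _ cM nGH _ A mA) => X [[s t] _ <-].
    have [ts|st] := ltP t s; first by rewrite set_itv_ge ?measure0 // bnd_simp -leNgt ltW.
    rewrite [RHS]measure_addE (lebesgue_stieltjes_oc cM st).
    transitivity ((G t - G s)%:E + (H t - H s)%:E)%E; last first.
      by congr (_ + _)%E; apply/esym; exact: lebesgue_stieltjes_oc.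
    by congr (_%:E); rewrite /H /=; ring.
  apply: (@lebesgue_stieltjes_measure_unique _ cM n _ A mA) => X [[s t] _ <-] /=.
  have [ts|st] := ltP t s; first by rewrite set_itv_ge ?measure0 // bnd_simp -leNgt ltW.
  by rewrite lebesgue_stieltjes_oc // noc.
have leG A : measurable A -> (lebesgue_stieltjes_measure cG A <= n A)%E.
  by move=> mA; rewrite -sumE // leeDl.
have Gfin : (lebesgue_stieltjes_measure cG setT < +oo)%E.
  exact: le_lt_trans (leG _ measurableT) nfin.
have [nu nuE] := finite_measure_pack Gfin.
have dom : nu `<< leb.
  apply/null_content_dominatesP => A mA A0.
  apply/eqP; rewrite -measure_le0.
  apply: (@le_trans _ _ (lebesgue_stieltjes_measure cG A)).
    by rewrite le_eqVlt; apply/orP; left; apply/eqP; exact: nuE.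
  apply: le_trans (leG _ mA) _.
  rewrite nA null_set_integral //; first exact/measurable_EFinP/measurable_funTS.
have [g [g0 gfin ig gE]] := radon_nikodym_sigma_finite dom.
have gEF : EFin \o (fine \o g) = g by apply/funext => x /=; rewrite fineK.
exists (fine \o g); split; first by rewrite gEF.
move=> s t st; rewrite /Rintegral.
have -> : (\int[leb]_(x in `]s, t]) ((fine \o g) x)%:E = \int[leb]_(x in `]s, t]) g x)%E.
  by apply: eq_integral => x _; rewrite /= fineK.
rewrite -gE // nuE.
transitivity (fine (G t - G s)%:E); first by [].
by congr fine; apply/esym; exact: lebesgue_stieltjes_oc.
Qed.

End MonotoneDensity.

Section AbsolutelyContinuous.
Variable R : realType.
Local Notation leb := (@lebesgue_measure R).
Variable m : R -> R.
Hypothesis im : leb.-integrable setT (EFin \o m).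
Hypothesis m0 : forall x, 0 <= m x.

(** With M the primitive of m, F + M is increasing and its increments are at most the integrals of 2
    m; m is subtracted from its density. *)
Lemma abs_cont_density (F : R -> R) :
  (forall s t, s <= t -> `|F t - F s| <= \int[leb]_(x in `]s, t]) m x) ->
  exists f : R -> R, leb.-integrable setT (EFin \o f) /\
    forall s t, s <= t -> F t - F s = \int[leb]_(x in `]s, t]) f x.
Proof.
move=> hF.
pose m2 x := 2 * m x.
have im2 : leb.-integrable setT (EFin \o m2).
  by rewrite (_ : EFin \o m2 = (fun x => 2%:E * (EFin \o m) x)%E) //; exact: integrableZl.
have i2 s t : \int[leb]_(x in `]s, t]) m2 x = 2 * \int[leb]_(x in `]s, t]) m x.
  rewrite RintegralZl //; exact: integrableS im.
pose M x := \int[leb]_(y in `]-oo, x]) m y.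
pose G x := M x + F x.
have GE s t : s <= t -> G t - G s = \int[leb]_(x in `]s, t]) m x + (F t - F s).
  by move=> st; rewrite -(integral_oc_B im st) /G /M; ring.
have m20 x : 0 <= m2 x by rewrite mulr_ge0.
have ndG : {homo G : x y / x <= y}.
  move=> s t st; rewrite -subr_ge0 GE //.
  by have := hF _ _ st; rewrite ler_norml => /andP[]; lra.
have G2 s t : s <= t -> G t - G s <= \int[leb]_(x in `]s, t]) m2 x.
  move=> st; rewrite GE // i2.
  rewrite mulr_natl mulr2n lerD2l.
  exact: le_trans (ler_norm _) (hF _ _ st).
have [g [ig gE]] := monotone_density im2 m20 ndG G2.
exists (fun x => g x - m x); split.
  have h := integrableB measurableT ig im. exact: (eq_integrable measurableT _ _ _ h).
move=> s t st; rewrite RintegralB //.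
- by rewrite -gE // GE //; ring.
- exact: integrableS ig.
- exact: integrableS im.
Qed.

(** F differs by a constant from the primitive started at -oo, to which the Lebesgue differentiation
    theorem applies. *)
Lemma abs_cont_derivative (F f : R -> R) : leb.-integrable setT (EFin \o f) ->
  (forall s t, s <= t -> F t - F s = \int[leb]_(x in `]s, t]) f x) ->
  {ae leb, forall x, derivable F x 1 /\ derive1 F x = f x}.
Proof.
move=> jf fE; pose F1 x := \int[leb]_(y in `]-oo, x]) f y.
have F1E s t : s <= t -> F1 t - F1 s = F t - F s.
  move=> st; rewrite fE // /F1 Rintegral_itvB //.
  by apply: integrableS jf => //; exact: measurable_itv.
have FE : F = F1 + cst (F 0 - F1 0).
  apply/funext => x; rewrite fctE /=; have [x0|x0] := leP 0 x.
    by have := F1E _ _ x0; lra.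
  by have := F1E _ _ (ltW x0); lra.
have jy y : leb.-integrable `]-oo, y] (EFin \o f) by exact: integrableS jf.
have := FTC1Ny jy (open_integrable_locally openT jf); rewrite /= -/F1.
apply: filterS; first exact: (ae_filter_ringOfSetsType leb).
move=> x [dF1 <-]; rewrite FE.
have dc : derivable (cst (F 0 - F1 0) : R -> R) x 1 by exact: derivable_cst.
split; first exact: derivableD.
by rewrite !derive1E deriveD // derive_cst addr0.
Qed.

End AbsolutelyContinuous.

Section MetricSpeed.
Variable R : realType.
Local Notation leb := (@lebesgue_measure R).

Lemma derive1_near (F : R -> R) x (l e : R) : derivable F x 1 -> derive1 F x = l -> 0 < e ->
  exists2 a : R, 0 < a & forall s, `|s - x| < a ->
    `|F s - F x - l * (s - x)| <= e * `|s - x|.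
Proof.
move=> dF lE e0.
have := dF; rewrite /derivable => /cvgrPdist_le /(_ _ e0).
have -> : lim (h^-1 *: ((F \o shift x) (h *: 1) - F x) @[h --> 0^']) = l.
  by rewrite -lE derive1E.
move=> /nbhs_ballP [a /= a0 ha]; exists a => // s sx.
have [->|sn] := eqVneq s x; first by rewrite !subrr mulr0 subr0 normr0 mulr0.
have sx0 : s - x != 0 by rewrite subr_eq0.
have := ha (s - x); rewrite /ball /= sub0r normrN => /(_ sx sx0).
rewrite [(s - x)%:A]mulr1 subrK => h.
have -> : F s - F x - l * (s - x) = - ((l - (s - x)^-1 *: (F s - F x)) * (s - x)).
  by rewrite /GRing.scale /=; field.
by rewrite normrN normrM ler_wpM2r.
Qed.

Variable m : R -> R.
Hypothesis im : leb.-integrable setT (EFin \o m).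
Hypothesis m0 : forall x, 0 <= m x.
Variable D : R -> R -> R.
Hypothesis D0 : forall s t, 0 <= D s t.
Hypothesis DC : forall s t, D s t = D t s.
Hypothesis Dtri : forall s t u, D s u <= D s t + D t u.
Hypothesis Dm : forall s t, s <= t -> D s t <= \int[leb]_(x in `]s, t]) m x.

(** Enumerates the rationals; a natural number that encodes none gives 0. *)
Let q (n : nat) : R := ratr (odflt 0 (choice.unpickle n)).
Let d n t := D (q n) t.

Let d_le n s t : `|d n t - d n s| <= D s t.
Proof.
have := Dtri (q n) s t; have := Dtri (q n) t s; rewrite (DC t s) /d ler_norml => h1 h2.
by apply/andP; split; lra.
Qed.

Let fex n : exists f : R -> R, leb.-integrable setT (EFin \o f) /\
  forall s t, s <= t -> d n t - d n s = \int[leb]_(x in `]s, t]) f x.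
Proof. by apply: (abs_cont_density im m0) => s t st; exact: le_trans (d_le _ _ _) (Dm st). Qed.

Let f n := sval (cid (fex n)).
Let if_ n : leb.-integrable setT (EFin \o f n).
Proof. by rewrite /f; case: cid => ? []. Qed.
Let fE n s t : s <= t -> d n t - d n s = \int[leb]_(x in `]s, t]) f n x.
Proof. by rewrite /f; case: cid => ? [] /= _; apply. Qed.

Let M x := \int[leb]_(y in `]-oo, x]) m y.
Let ME s t : s <= t -> M t - M s = \int[leb]_(x in `]s, t]) m x.
Proof. exact: integral_oc_B. Qed.

Let f_le_m : {ae leb, forall x, forall n, `|f n x| <= m x}.
Proof.
apply/ae_foralln => n.
have h1 := abs_cont_derivative (if_ n) (@fE n).
have := abs_cont_derivative im ME; move: h1.
apply: filterS2; first exact: (ae_filter_ringOfSetsType leb).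
move=> x [d1 e1] [d2 e2].
apply/ler_addgt0Pr => e e0; have e2' : 0 < e / 2 by rewrite divr_gt0.
have [a a0 ha] := derive1_near d1 e1 e2'.
have [b b0 hb] := derive1_near d2 e2 e2'.
pose h := Num.min a b / 2.
have ab0 : 0 < Num.min a b by rewrite lt_min a0 b0.
have h0 : 0 < h by rewrite divr_gt0.
have [sa sb] : h < a /\ h < b.
  have : h < Num.min a b by rewrite /h; lra.
  by rewrite lt_min => /andP.
have xh : (x + h) - x = h by ring.
have := ha (x + h); have := hb (x + h); rewrite xh gtr0_norm // => /(_ sb) + /(_ sa).
have xxh : x <= x + h by lra.
have := le_trans (d_le n x (x + h)) (Dm xxh); rewrite -ME //.
move=> h1 /(le_trans (ler_norm _)) h2 h3.
have h4 := ler_normB (d n (x + h) - d n x) (d n (x + h) - d n x - f n x * h).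
have E : d n (x + h) - d n x - (d n (x + h) - d n x - f n x * h) = f n x * h by ring.
rewrite E normrM (gtr0_norm h0) in h4.
by rewrite -(ler_pM2r h0); lra.
Qed.

(** The truncation changes nothing almost everywhere, by [f_le_m], and keeps the supremum [v] below
    m at every point. *)
Let g n x := Num.min `|f n x| (m x).
Let v x := sups (g^~ x) 0.

Let mm : measurable_fun setT m.
Proof. by apply/measurable_EFinP; case/integrableP: im. Qed.

Let g_ub x : has_ubound (range (g^~ x)).
Proof. by exists (m x) => _ [n _ <-]; rewrite ge_min lexx orbT. Qed.

Let mv : measurable_fun setT v.
Proof.
apply: measurable_fun_sups => [t _|n]; first exact: g_ub.
apply: measurable_minr => //; apply: measurableT_comp => //.
by apply/measurable_EFinP; case/integrableP: (if_ n).
Qed.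

Let vE x : v x = sup (range (g^~ x)).
Proof. by congr sup; apply/seteqP; split => y [n _ <-]; exists n. Qed.

Let g_le_v n x : g n x <= v x.
Proof. by rewrite vE; apply: ub_le_sup; [exact: g_ub|exists n]. Qed.

Let v_le_m x : v x <= m x.
Proof.
apply: ge_sup; first by exists (g 0%N x), 0%N.
by move=> _ [n _ <-]; rewrite ge_min lexx orbT.
Qed.

Let v_ge0 x : 0 <= v x.
Proof. by apply: le_trans (g_le_v 0%N x); rewrite le_min normr_ge0 m0. Qed.

Let iv : leb.-integrable setT (EFin \o v).
Proof.
apply: le_integrable im => //; first exact/measurable_EFinP.
by move=> x _ /=; rewrite lee_fin !ger0_norm.
Qed.

(** For a rational q just after s, D(s, t) <= |D(q, t) - D(q, s)| + 2 D(s, q). The last term is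
    arbitrarily small, and the first is at most the integral of |f n|, hence of v. *)
Let D_le_v s t : s <= t -> D s t <= \int[leb]_(x in `]s, t]) v x.
Proof.
move=> st; apply/ler_addgt0Pr => e e0; have e2 : 0 < e / 2 by rewrite divr_gt0.
have [a a0 ha] := integral_itv_small im m0 e2.
have : s < s + a by rewrite ltrDl.
move=> /rat_in_itvoo[r]; rewrite in_itv /= => /andP[sr ra].
pose n := choice.pickle r.
have qn : q n = ratr r by rewrite /q /n choice.pickleK.
have Dq : D s (q n) < e / 2.
  rewrite qn; apply: le_lt_trans (Dm (ltW sr)) _; apply: ha; [exact: ltW|lra].
have h1 : D s t <= `|d n t - d n s| + e.
  have : D (q n) t - D s (q n) <= `|d n t - d n s| by rewrite (DC s) ler_norm.
  by have := Dtri s (q n) t; lra.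
apply: le_trans h1 _; rewrite lerD2r fE //.
have js : leb.-integrable `]s, t] (EFin \o f n) by exact: integrableS (if_ n).
apply: (@le_trans _ _ (\int[leb]_(x in `]s, t]) `|f n x|)); first exact: le_normr_Rintegral.
have jn : leb.-integrable `]s, t] (EFin \o (fun x => `|f n x|)) by exact: integrable_norm.
have jv : leb.-integrable `]s, t] (EFin \o v) by exact: integrableS iv.
rewrite /Rintegral fine_le ?integrable_fin_num //.
apply: ae_ge0_le_integral => //.
- by case/integrableP: jn.
- by move=> x _; rewrite lee_fin.
- by case/integrableP: jv.
move: f_le_m; apply: filterS; first exact: (ae_filter_ringOfSetsType leb).
move=> x hx _; rewrite lee_fin; apply: le_trans (g_le_v n x).
by rewrite le_min lexx hx.
Qed.

(* [v] is the supremum over a countable dense set of times [q] of the absolute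
   values of the derivatives of [t |-> D q t]. *)
Lemma metric_speed : exists v : R -> R,
  [/\ measurable_fun setT v, forall t, 0 <= v t <= m t
    & {ae leb, forall t, forall e, 0 < e -> exists2 a : R, 0 < a &
        forall s, `|s - t| < a -> `|D t s - v t * `|s - t| | <= e * `|s - t|}].
Proof.
exists v; split; [exact: mv|by move=> t; rewrite v_ge0 v_le_m|].
pose V x := \int[leb]_(y in `]-oo, x]) v y.
have VE s t : s <= t -> V t - V s = \int[leb]_(x in `]s, t]) v x by exact: integral_oc_B.
have aeV := abs_cont_derivative iv VE.
have aed : {ae leb, forall x, forall n, derivable (d n) x 1 /\ derive1 (d n) x = f n x}.
  by apply/ae_foralln => n; exact: (abs_cont_derivative (if_ n) (@fE n)).
move: aeV aed.
apply: filterS2; first exact: (ae_filter_ringOfSetsType leb).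
move=> t [dV eV] dd e e0.
have e2 : 0 < e / 2 by rewrite divr_gt0.
have [a a0 ha] := derive1_near dV eV e0.
have hs : has_sup (range (g^~ t)) by split => //; exists (g 0%N t), 0%N.
have [_ [n _ <-]] := sup_adherent e2 hs.
rewrite -vE => vg.
have [b b0 hb] := derive1_near (dd n).1 (dd n).2 e2.
exists (Num.min a b); first by rewrite lt_min a0 b0.
move=> s; rewrite lt_min => /andP[/ha {}ha /hb {}hb].
(* Upper bound: D is at most the increment of V, whose derivative at t is v t. Lower bound: n was
   chosen with |f n t| > v t - e / 2, and D dominates the increments of d n. *)
have Dle : D t s <= `|V s - V t|.
  have [st|ts] := leP s t.
    by rewrite distrC VE // DC ger0_norm ?D_le_v // Rintegral_ge0.
  by rewrite VE ?(ltW ts) // ger0_norm ?Rintegral_ge0 // D_le_v // ltW.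
set h := `|s - t| in ha hb *.
have h0 : 0 <= h by exact: normr_ge0.
have vh : `|v t * (s - t)| = v t * h by rewrite normrM ger0_norm.
have fh : `|f n t * (s - t)| = `|f n t| * h by rewrite normrM.
have up : D t s <= v t * h + e * h.
  have := ler_normD (v t * (s - t)) (V s - V t - v t * (s - t)).
  have -> : v t * (s - t) + (V s - V t - v t * (s - t)) = V s - V t by ring.
  by rewrite vh; lra.
have low : v t * h <= D t s + e * h.
  have := ler_normB (d n s - d n t) (d n s - d n t - f n t * (s - t)).
  have -> : d n s - d n t - (d n s - d n t - f n t * (s - t)) = f n t * (s - t) by ring.
  rewrite fh => h1; have h2 := d_le n t s.
  have : g n t <= `|f n t| by rewrite ge_min lexx.
  move=> /(lt_le_trans vg) /ltW /(ler_wpM2r h0).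
  by lra.
by rewrite ler_norml; apply/andP; split; lra.
Qed.

End MetricSpeed.

(** * Square-integrable fields *)

Section SquareIntegrable.
Context dT (T : measurableType dT) (R : realType) (n : nat).
Variable m : {measure set T -> \bar R}.
Implicit Types g h w : T -> 'rV[R]_n.

Definition coord_measurable g := forall i, measurable_fun setT (fun x => g x 0 i).

Definition square_integrable g := coord_measurable g /\
  m.-integrable setT (EFin \o (fun x => dot (g x) (g x))).

Definition inner g h : R := \int[m]_x dot (g x) (h x).

Lemma measurable_dot2 g h : coord_measurable g -> coord_measurable h ->
  measurable_fun setT (fun x => (dot (g x) (h x))%:E).
Proof. by move=> mg mh; apply/measurable_EFinP; exact: measurable_dot. Qed.

Lemma dot_young (u v : 'rV[R]_n) : `|dot u v| <= dot u u + dot v v.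
Proof.
have := dot_ge0 (u + v); have := dot_ge0 (u - v).
have := dot_ge0 u; have := dot_ge0 v.
rewrite !(dotDl, dotDr, dotNl, dotNr) (dotC v u) ler_norml => *.
by apply/andP; split; lra.
Qed.

Lemma integrable_dot g h : square_integrable g -> square_integrable h ->
  m.-integrable setT (EFin \o (fun x => dot (g x) (h x))).
Proof.
move=> [mg jg] [mh jh]; apply: le_integrable (integrableD measurableT jg jh) => //.
  exact: measurable_dot2.
move=> x _ /=; rewrite lee_fin.
by apply: le_trans (dot_young _ _) _; exact: ler_norm.
Qed.

Lemma coord_measurable_lin (a : R) g h : coord_measurable g -> coord_measurable h ->
  coord_measurable (fun x => a *: g x + h x).
Proof.
move=> mg mh i; under eq_fun do rewrite !mxE.
by apply: measurable_funD => //; exact: measurable_funM.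
Qed.

Lemma coord_measurableB g h : coord_measurable g -> coord_measurable h ->
  coord_measurable (fun x => g x - h x).
Proof.
move=> mg mh i; have := measurable_funB (mg i) (mh i); congr (measurable_fun _ _).
by apply/funext => x; rewrite !mxE.
Qed.

Lemma square_integrable_lin (a : R) g h : square_integrable g -> square_integrable h ->
  square_integrable (fun x => a *: g x + h x).
Proof.
move=> g2 h2; have [mg jg] := g2; have [mh jh] := h2; split; first exact: coord_measurable_lin.
have jgh := integrable_dot g2 h2.
have j1 := integrableZl measurableT (a ^+ 2) jg.
have j2 := integrableZl measurableT (2 * a) jgh.
apply: eq_integrable (integrableD measurableT (integrableD measurableT j1 j2) jh) => // x _ /=.
rewrite -!EFinM -!EFinD; congr (_%:E).
by rewrite !(dotDl, dotDr, dotZl, dotZr) (dotC (h x)); ring.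
Qed.

Lemma inner_lin (a : R) g h w : square_integrable g -> square_integrable h ->
  square_integrable w -> inner (fun x => a *: g x + h x) w = a * inner g w + inner h w.
Proof.
move=> g2 h2 w2; rewrite /inner -RintegralZl //; last exact: integrable_dot.
rewrite -RintegralD //; last 2 first.
- have jgw := integrable_dot g2 w2.
  by apply: eq_integrable (integrableZl measurableT a jgw).
- exact: integrable_dot.
by apply: eq_Rintegral => x _; rewrite dotDl dotZl.
Qed.

Lemma innerC g h : inner g h = inner h g.
Proof. by apply: eq_Rintegral => x _; rewrite dotC. Qed.

Lemma inner_ge0 g : 0 <= inner g g.
Proof. by apply: Rintegral_ge0 => x _; exact: dot_ge0. Qed.

Lemma inner_sqr_lin (a : R) g h : square_integrable g -> square_integrable h ->
  inner (fun x => a *: g x + h x) (fun x => a *: g x + h x) =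
  a ^+ 2 * inner g g + 2 * a * inner g h + inner h h.
Proof.
move=> g2 h2; have l2 := square_integrable_lin a g2 h2.
set L := (fun x => a *: g x + h x) in l2 *.
have E1 : inner L L = a * inner g L + inner h L by exact: inner_lin.
have E2 := inner_lin a g2 h2 g2.
have E3 : inner L h = a * inner g h + inner h h by exact: inner_lin.
by rewrite E1 (innerC g L) E2 (innerC h L) E3 (innerC h g); ring.
Qed.

Lemma inner_EFin g : square_integrable g ->
  (\int[m]_x (dot (g x) (g x))%:E = (inner g g)%:E)%E.
Proof. by move=> g2; rewrite /inner /Rintegral fineK // integrable_fin_num //; case: g2. Qed.

Lemma square_integrable_lt g : coord_measurable g ->
  (\int[m]_x (dot (g x) (g x))%:E < +oo)%E -> square_integrable g.
Proof.
move=> mg gfin; split => //; apply/integrableP; split; first exact: measurable_dot2.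
by under eq_integral do rewrite /= ger0_norm ?dot_ge0 //.
Qed.

Lemma cvg_of_fast (u : nat -> R) (A : R) :
  (forall k, `|u k.+1 - u k| <= A / 2 ^+ k) -> cvgn u.
Proof.
move=> hu; have uE : u = (fun k => u 0%N + series (telescope u) k).
  by apply/funext => k; rewrite telescopeK /=; ring.
rewrite uE; apply: is_cvgD; first exact: is_cvg_cst.
apply: normed_cvg; apply: (@series_le_cvg _ _ (geometric A (2^-1))) => //.
- by move=> k; exact: normr_ge0.
- move=> k; rewrite /geometric /= mulr_ge0 ?exprn_ge0 //.
  by apply: le_trans (normr_ge0 (u 1%N - u 0%N)) _; have := hu 0%N; rewrite expr0 divr1.
- by move=> k; rewrite /geometric /= exprVn; exact: hu.
- by apply: is_cvg_geometric_series; rewrite ger0_norm // invf_lt1 // ltr1n.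
Qed.

(** The series a of 4^k |u (k+1) - u k|^2 has integral at most the sum of 4 / 2^k, which is 8. Where
    a is finite, increments are at most sqrt a / 2^k. Taking w as an upper limit makes it measurable
    everywhere. *)
Lemma fast_cauchy_limit (u : nat -> T -> 'rV[R]_n) :
  (forall k, coord_measurable (u k)) ->
  (forall k, \int[m]_x (dot (u k.+1 x - u k x) (u k.+1 x - u k x))%:E <=
             (4 / 8 ^+ k)%:E)%E ->
  exists w, coord_measurable w /\
    {ae m, forall x, forall i, (fun k => u k x 0 i) @ \oo --> w x 0 i}.
Proof.
move=> mu hu.
pose D k x := dot (u k.+1 x - u k x) (u k.+1 x - u k x).
have mD k : measurable_fun setT (D k).
  by apply: measurable_dot; exact: coord_measurableB.
pose a x : \bar R := (\sum_(k <oo) (4 ^+ k * D k x)%:E)%E.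
have D0 k x : 0 <= D k x by exact: dot_ge0.
have t0 k x : (0 <= (4 ^+ k * D k x)%:E)%E by rewrite lee_fin mulr_ge0.
have mt k : measurable_fun setT (fun x => (4 ^+ k * D k x)%:E).
  by apply/measurable_EFinP; exact: measurable_funM.
have ma : measurable_fun setT a by apply: ge0_emeasurable_sum => *; [exact: t0|exact: mt].
have ia : (\int[m]_x a x <= 8%:E)%E.
  rewrite integral_nneseries //.
  apply: le_trans (@epsilon_trick0 _ 8%:R xpredT _) => //.
  apply: lee_nneseries => [k *|k *]; first by apply: integral_ge0.
  under eq_integral do rewrite EFinM.
  rewrite ge0_integralZl_EFin //.
  - apply: le_trans (lee_wpmul2l _ (hu k)) _; first by rewrite lee_fin.
    rewrite -EFinM lee_fin natrX exprS.
    have -> : (8 : R) ^+ k = 4 ^+ k * 2 ^+ k by rewrite -exprMn; congr (_ ^+ _); ring.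
    have p4 : (4 : R) ^+ k != 0 by rewrite expf_neq0.
    have p2 : (2 : R) ^+ k != 0 by rewrite expf_neq0.
    by rewrite le_eqVlt; apply/orP; left; apply/eqP; field; rewrite p2.
  - by move=> x _; rewrite lee_fin.
  - exact/measurable_EFinP.
pose w x : 'rV[R]_n := \row_i fine (limn_esup (fun k => (u k x 0 i)%:E)).
exists w; split.
  move=> i; under eq_fun do rewrite mxE.
  apply: (@measurableT_comp _ _ _ _ _ _ (@fine R)) => //.
  by apply: measurable_fun_limn_esup => k; apply/measurable_EFinP; exact: mu.
have iaT : m.-integrable setT a.
  apply/integrableP; split => //.
  under eq_integral do rewrite gee0_abs ?nneseries_ge0 //.
  by apply: le_lt_trans ia _; rewrite ltry.
have := integrable_ae measurableT iaT; apply: filterS => x ax i.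
have {}ax := ax Logic.I.
have aD k : D k x <= fine (a x) / 4 ^+ k.
  rewrite ler_pdivlMr ?exprn_gt0 // mulrC -lee_fin fineK //.
  have := @nneseries_lim_ge _ (fun k => (4 ^+ k * D k x)%:E) xpredT 0%N k.+1 (fun i _ _ => t0 i x).
  rewrite big_nat_recr //=; apply: le_trans.
  by rewrite leeDr // sume_ge0.
have cu : cvgn (fun k => u k x 0 i).
  apply: (@cvg_of_fast _ (Num.sqrt (fine (a x)))) => k.
  have -> : u k.+1 x 0 i - u k x 0 i = (u k.+1 x - u k x) 0 i by rewrite !mxE.
  apply: le_trans (coord_le_enorm _ _) _; rewrite /enorm -/(D k x).
  have -> : Num.sqrt (fine (a x)) / 2 ^+ k = Num.sqrt (fine (a x) / 4 ^+ k).
    rewrite sqrtrM ?fine_ge0 ?nneseries_ge0 // sqrtrV ?exprn_ge0 //.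
    by rewrite -[4](_ : 2 ^+ 2 = _ :> R) -?exprM ?[(2 * k)%N]mulnC ?exprM ?sqrtr_sqr ?ger0_norm ?exprn_ge0 // expr2; ring.
  by rewrite ler_sqrt // divr_ge0 ?exprn_ge0 // fine_ge0 // nneseries_ge0.
have := cu; rewrite mxE; set l := lim _ => cul.
have : (fun k => (u k x 0 i)%:E) @ \oo --> l%:E by apply: cvg_EFin => //; exact: nearW.
by move=> /cvg_limn_einf_sup [_ ->].
Qed.

End SquareIntegrable.

Lemma cvg_sum_seq (R : realType) (I : Type) (r : seq I) (f : I -> nat -> R) (l : I -> R) :
  (forall i, f i @ \oo --> l i) ->
  (fun k => \sum_(i <- r) f i k) @ \oo --> \sum_(i <- r) l i.
Proof.
move=> fl; elim: r => [|i r IH].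
  by under eq_fun do rewrite big_nil; rewrite big_nil; exact: cvg_cst.
by under eq_fun do rewrite big_cons; rewrite big_cons; exact: cvgD.
Qed.

(** * Riesz representation on the closure of a space of fields *)

Section Riesz.
Context dT (T : measurableType dT) (R : realType) (n : nat).
Variable m : {measure set T -> \bar R}.
Implicit Types g h w : T -> 'rV[R]_n.
Local Notation ip := (inner m).

Lemma eq_square_integrable g h : g =1 h -> square_integrable m g -> square_integrable m h.
Proof. by move=> /funext ->. Qed.

Variable S : (T -> 'rV[R]_n) -> R -> Prop.
Variable K : R.
Hypothesis S_L2 : forall g c, S g c -> square_integrable m g.
Hypothesis S_lin : forall (a : R) g c h e, S g c -> S h e ->
  S (fun x => a *: g x + h x) (a * c + e).
Hypothesis S_bound : forall g c, S g c -> c ^+ 2 <= K * ip g g.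
Hypothesis S_ne : exists g c, S g c.

Let S0 : S (fun=> 0) 0.
Proof.
have [g [c Sgc]] := S_ne; have := S_lin (-1) Sgc Sgc.
rewrite mulN1r addNr; congr (S _ _).
by apply/funext => x; rewrite scaleN1r addNr.
Qed.

Let inner0 : ip (fun=> 0 : 'rV[R]_n) (fun=> 0 : 'rV[R]_n) = 0.
Proof.
rewrite /inner /Rintegral integral0_eq // => x _.
by rewrite dot0l.
Qed.

(** If c = ip w g this is |g - w|^2 - |w|^2, so minimizing it approximates the unknown w. *)
Let value (g : T -> 'rV[R]_n) (c : R) := ip g g - 2 * c.

Let values : set R := [set value p.1 p.2 | p in [set p | S p.1 p.2]].

(* [ip g g + K >= 2 sqrt (K * ip g g) >= 2 c]. *)
Let value_ge g c : S g c -> - `|K| <= value g c.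
Proof.
move=> Sgc; have N0 := inner_ge0 m g; have := S_bound Sgc.
rewrite /value; set N := ip g g => h.
have h1 : c ^+ 2 <= `|K| * N by apply: le_trans h _; rewrite ler_wpM2r // ler_norm.
have k0 : 0 <= `|K| by exact: normr_ge0.
have h2 : (2 * c) ^+ 2 <= (N + `|K|) ^+ 2.
  by have := sqr_ge0 (N - `|K|); nra.
have : `|2 * c| <= N + `|K|.
  by rewrite -ler_sqr ?nnegrE ?addr_ge0 // real_normK ?num_real.
by have := ler_norm (2 * c); lra.
Qed.

Let I := inf values.

Let I_le g c : S g c -> I <= value g c.
Proof.
move=> Sgc; apply: ge_inf; last by exists (g, c).
by exists (- `|K|) => _ [[g' c'] Sg <-]; exact: value_ge.
Qed.

Let near_inf (e : R) : 0 < e -> exists p : (T -> 'rV[R]_n) * R,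
  S p.1 p.2 /\ value p.1 p.2 < I + e.
Proof.
move=> e0; have hi : has_inf values.
  split; first by exists (value (fun=> 0) 0), (fun=> 0, 0).
  by exists (- `|K|) => _ [[g' c'] Sg <-]; exact: value_ge.
have [_ [[g c] Sgc <-] gc] := inf_adherent e0 hi.
by exists (g, c).
Qed.

(** The half-sum of g and h also has value at least I; the parallelogram identity turns
    near-minimality of both into closeness. *)
Let parallelogram g c h e a b : S g c -> S h e ->
  value g c < I + a -> value h e < I + b ->
  ip (fun x => g x - h x) (fun x => g x - h x) <= 2 * (a + b).
Proof.
move=> Sg Sh ga hb; have g2 := S_L2 Sg; have h2 := S_L2 Sh.
have E1 := inner_sqr_lin (-1) h2 g2.
have -> : (fun x => g x - h x) = (fun x => -1 *: h x + g x).
  by apply/funext => x; rewrite scaleN1r addrC.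
rewrite {}E1.
have Sm := S_lin (2^-1) Sg (S_lin (2^-1) Sh S0).
have := I_le Sm; rewrite /value.
have E2 : ip (fun x => 2^-1 *: g x + (2^-1 *: h x + 0)) (fun x => 2^-1 *: g x + (2^-1 *: h x + 0)) =
    4^-1 * (ip g g + 2 * ip g h + ip h h).
  have -> : (fun x => 2^-1 *: g x + (2^-1 *: h x + 0)) = (fun x => 2^-1 *: (1 *: g x + h x) + 0).
    by apply/funext => x; rewrite !addr0 scale1r scalerDr.
  have gh2 := square_integrable_lin 1 g2 h2.
  have z2 := S_L2 S0.
  rewrite (inner_sqr_lin _ gh2 z2) (inner_sqr_lin _ g2 h2) inner0.
  have -> : ip (fun x => 1 *: g x + h x) (fun=> 0) = 0.
    rewrite /inner /Rintegral integral0_eq // => x _.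
    by rewrite dotC dot0l.
  by field.
rewrite E2; move: ga hb; rewrite /value (innerC m h g).
by lra.
Qed.

(* [S] is the graph of a bounded linear functional, and [w] the limit of a
   minimizing sequence of [ip g g - 2 * c]. *)
Lemma riesz_representation : exists w, [/\ square_integrable m w,
  forall g c, S g c -> c = ip w g &
  forall e : R, 0 < e -> exists g c, S g c /\
    ip (fun x => w x - g x) (fun x => w x - g x) <= e].
Proof.
have e8 k : 0 < (8 ^+ k)^-1 :> R by rewrite invr_gt0 exprn_gt0.
(* With tolerance 8^-k, [parallelogram] bounds the squared distance from p k to any later term by 4
   / 8^k, as [fast_cauchy_limit] asks. *)
pose p k := sval (cid (near_inf (e8 k))).
have pS k : S (p k).1 (p k).2 by rewrite /p; case: cid => ? [].
have pI k : value (p k).1 (p k).2 < I + (8 ^+ k)^-1 by rewrite /p; case: cid => ? [].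
have pm k : coord_measurable (p k).1 by have [] := S_L2 (pS k).
have e8_le k l : (k <= l)%N -> (8 ^+ l)^-1 <= (8 ^+ k)^-1 :> R.
  by move=> kl; rewrite lef_pV2 ?posrE ?exprn_gt0 // ler_weXn2l // ler1n.
have sub2 g h : square_integrable m g -> square_integrable m h ->
    square_integrable m (fun x => g x - h x).
  move=> g2 h2; apply: eq_square_integrable (square_integrable_lin (-1) h2 g2) => x.
  by rewrite scaleN1r addrC.
have pp k l : (k <= l)%N ->
    (\int[m]_x (dot ((p l).1 x - (p k).1 x) ((p l).1 x - (p k).1 x))%:E <= (4 / 8 ^+ k)%:E)%E.
  move=> kl; rewrite inner_EFin; last by apply: sub2; exact: S_L2.
  rewrite lee_fin; apply: le_trans (parallelogram (pS l) (pS k) (pI l) (pI k)) _.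
  by have := e8_le _ _ kl; lra.
have [w [mw aew]] := fast_cauchy_limit pm (fun k => pp k k.+1 (leqnSn k)).
(* By Fatou's lemma the distance from p k to the pointwise limit obeys the same bound. *)
have fat k : (\int[m]_x (dot (w x - (p k).1 x) (w x - (p k).1 x))%:E <= (4 / 8 ^+ k)%:E)%E.
  pose u l x := (dot ((p (l + k)%N).1 x - (p k).1 x) ((p (l + k)%N).1 x - (p k).1 x))%:E.
  have mu l : measurable_fun setT (u l).
    by apply: measurable_dot2; apply: coord_measurableB.
  have u0 l x : (0 <= u l x)%E by rewrite lee_fin dot_ge0.
  apply: (@le_trans _ _ (\int[m]_x limn_einf (u^~ x))%E).
    apply: ae_ge0_le_integral => //.
    - by move=> x _; rewrite lee_fin dot_ge0.
    - by apply: measurable_dot2; apply: coord_measurableB.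
    - move=> x _; rewrite limn_einf_lim; apply: lime_ge; first exact: is_cvg_einfs.
      by apply: nearW => l; apply: le_ereal_inf_tmp => _ [j _ <-].
    - rewrite /limn_einf; apply: (@measurableT_comp _ _ _ _ _ _ (@oppe R)) => //.
      by apply: measurable_fun_limn_esup => l; exact: (@measurableT_comp _ _ _ _ _ _ (@oppe R)).
    move: aew; apply: filterS => x cx _.
    have : (u^~ x) @ \oo --> (dot (w x - (p k).1 x) (w x - (p k).1 x))%:E.
      apply: cvg_EFin; first exact: nearW.
      rewrite /dot; apply: cvg_sum_seq => i.
      rewrite !mxE; under eq_fun do rewrite /= !mxE.
      have ci : (fun l => (p (l + k)%N).1 x 0 i - (p k).1 x 0 i) @ \oo --> w x 0 i - (p k).1 x 0 i.
        apply: cvgB; last exact: cvg_cst.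
        by have := cx i; rewrite -(cvg_shiftn k).
      exact: cvgM.
    by move=> /cvg_limn_einf_sup [-> _].
  apply: le_trans (fatou m measurableT (fun l => mu l) (fun l x _ => u0 l x)) _.
  rewrite limn_einf_lim; apply: lime_le; first exact: is_cvg_einfs.
  apply: nearW => l; apply: (@le_trans _ _ (\int[m]_x u l x)%E); last exact: pp (leq_addl _ _).
  by apply: ereal_inf_lbound; exists l => //=.
have d2 k : square_integrable m (fun x => w x - (p k).1 x).
  apply: square_integrable_lt; first exact: coord_measurableB.
  by apply: le_lt_trans (fat k) _; rewrite ltry.
have fatN k : ip (fun x => w x - (p k).1 x) (fun x => w x - (p k).1 x) <= 4 / 8 ^+ k.
  by rewrite -lee_fin -inner_EFin.
have w2 : square_integrable m w.
  apply: eq_square_integrable (square_integrable_lin 1 (d2 0%N) (S_L2 (pS 0%N))) => x.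
  by rewrite scale1r subrK.
have small (e : R) : 0 < e -> exists k, 5 / 8 ^+ k < e.
  move=> e0; have := @cvg_geometric R 5 (8^-1) _.
  have -> : `|8^-1| < 1 :> R by rewrite ger0_norm // invf_lt1 // ltr1n.
  move=> /(_ erefl) /cvgrPdist_lt /(_ _ e0) [k _ /(_ k (leqnn k))].
  rewrite sub0r normrN /geometric /= exprVn ger0_norm ?divr_ge0 ?exprn_ge0 // => hk.
  by exists k.
exists w; split => //; last first.
  move=> e /small [k hk]; exists (p k).1, (p k).2; split => //.
  apply: le_trans (fatN k) _; apply: le_trans (ltW hk).
  by rewrite ler_pM2r ?invr_gt0 ?exprn_gt0 // ler_nat.
move=> g c Sg; have g2 := S_L2 Sg.
(* First variation: adding t g to p k lowers the value by at most 8^-k. Replacing p k by w in the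
   cross term costs another t^2 ip g g by Young's inequality, whence the second factor 2. *)
have key t : 0 <= 2 * t * (ip w g - c) + 2 * t ^+ 2 * ip g g.
  rewrite -[leRHS]opprK oppr_ge0; apply/ler_addgt0Pr => e /small [k hk]; rewrite add0r.
  apply: le_trans (ltW hk).
  have pk2 := S_L2 (pS k).
  have h1 := I_le (S_lin t Sg (pS k)); rewrite /value (inner_sqr_lin t g2 pk2) in h1.
  have h2 := pI k; rewrite /value in h2.
  have wE : ip w g = ip (fun x => w x - (p k).1 x) g + ip (p k).1 g.
    rewrite -[X in X + _]mul1r -(inner_lin 1 (d2 k) pk2 g2); congr (inner _ _ _).
    by apply/funext => x; rewrite scale1r subrK.
  have h3 : - (2 * t * ip (fun x => w x - (p k).1 x) g) <=
      t ^+ 2 * ip g g + ip (fun x => w x - (p k).1 x) (fun x => w x - (p k).1 x).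
    have := inner_ge0 m (fun x => t *: g x + (w x - (p k).1 x)).
    rewrite (inner_sqr_lin t g2 (d2 k)) (innerC m g (fun x => w x - (p k).1 x)).
    by move: (ip g g) (ip _ g) (ip _ _) => ? ? ?; lra.
  have h4 := fatN k; have h5 : 5 / 8 ^+ k = 4 / 8 ^+ k + (8 ^+ k)^-1 :> R by ring.
  rewrite wE h5 (innerC m (p k).1 g); lra.
have [N0|N0] := eqVneq (ip g g) 0.
  by have := key 1; have := key (-1); rewrite N0; lra.
have {}N0 : 0 < ip g g by rewrite lt_neqAle eq_sym N0 inner_ge0.
(* The minimizing t, where the polynomial equals - (ip w g - c)^2 / (2 ip g g). *)
have := key (- (ip w g - c) / (2 * ip g g)).
have -> : 2 * (- (ip w g - c) / (2 * ip g g)) * (ip w g - c) +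
    2 * (- (ip w g - c) / (2 * ip g g)) ^+ 2 * ip g g =
    - ((ip w g - c) ^+ 2 / (2 * ip g g)) by field; rewrite gt_eqF.
rewrite oppr_ge0 pmulr_lle0 ?invr_gt0 ?mulr_gt0 // => h.
have : (ip w g - c) ^+ 2 == 0 by rewrite eq_le h sqr_ge0.
by rewrite sqrf_eq0 subr_eq0 => /eqP.
Qed.

End Riesz.

(** * Measures in space-time *)

(** The sets A with t -> nu t A measurable form a Dynkin class, which contains the open sets by
    [open_indic_approx]. *)
Lemma measurable_family_euclidean (R : realType) (d : nat) dX (X : measurableType dX)
    (nu : X -> {finite_measure set (euclidean R d) -> \bar R}) :
  (forall f : 'rV[R]_d -> R, continuous f -> (forall x, 0 <= f x <= 1) ->
     measurable_fun setT (fun t => \int[nu t]_x (f x)%:E)%E) ->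
  forall A, measurable A -> measurable_fun setT (fun t => nu t A).
Proof.
move=> mnu.
have mnuT : measurable_fun setT (fun t => nu t setT).
  have := mnu (cst 1) (@cst_continuous _ _ _) _.
  have -> : (fun t => \int[nu t]_x (cst 1 x)%:E)%E = fun t => nu t setT.
    apply/funext => t; transitivity (\int[nu t]_x cst 1%E x)%E; first by [].
    by rewrite integral_cst // mul1e.
  by apply => x; rewrite /= ler01 lexx.
apply: (@dynkin_induction _ (euclidean R d) (@open 'rV[R]_d)) => //.
- by move=> A B; exact: openI.
- move=> U oU; have [f [fc f01 fnd fU]] := open_indic_approx oU.
  apply: (@emeasurable_fun_cvg _ _ _ _ (fun k t => \int[nu t]_x (f k x)%:E)%E) => //.
    by move=> k; exact: mnu.
  by move=> t _; exact: measure_open_cvg.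
- move=> A mA hA.
  have -> : (fun t => nu t (~` A)) = (fun t => nu t setT - nu t A)%E.
    apply/funext => t; rewrite -setTD measureD // ?setTI //.
    by rewrite ltey_eq fin_num_measure.
  exact: emeasurable_funB.
- move=> F mF tF hF.
  have -> : (fun t => nu t (\bigcup_k F k)) = (fun t => \sum_(k <oo) nu t (F k))%E.
    by apply/funext => t; rewrite measure_semi_bigcup //; exact: bigcup_measurable.
  by apply: ge0_emeasurable_sum => *; [exact: measure_ge0|exact: hF].
Qed.

(** nu t (dx) l (dt) is a composition of kernels: l viewed as a kernel from [unit], then the image
    of nu t under x -> (t, x). The bound B makes them finite kernels. *)
Lemma fibered_measure (R : realType) dX (X : measurableType dX) dY (Y : measurableType dY)
    (l : {finite_measure set X -> \bar R}) (nu : X -> {finite_measure set Y -> \bar R}) (B : R) :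
  (forall A, measurable A -> measurable_fun setT (fun t => nu t A)) ->
  (forall t, nu t setT <= B%:E)%E ->
  exists M : {measure set (X * Y)%type -> \bar R},
    forall f : X * Y -> \bar R, measurable_fun setT f -> (forall p, 0 <= f p)%E ->
      measurable_fun setT (fun t => \int[nu t]_x f (t, x))%E /\
      (\int[M]_p f p = \int[l]_t \int[nu t]_x f (t, x))%E.
Proof.
move=> mnu nuB.
pose nu0 t : {measure set Y -> \bar R} := nu t.
have uub : measure_fam_uub nu0.
  by exists (B + 1) => t; apply: le_lt_trans (nuB t) _; rewrite lte_fin ltrDl.
pose Hk := isKernel.Build _ _ X Y R nu0 mnu.
pose k0 : R.-ker X ~> Y := HB.pack nu0 Hk.
pose Hf := Kernel_isFinite.Build _ _ X Y R (k0 : X -> {measure set Y -> \bar R}) uub.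
pose k1 : R.-fker X ~> Y := HB.pack nu0 Hk Hf.
have pairm (t : X) : measurable_fun setT (fun x : Y => (t, x)) 
  by apply/measurable_fun_pairP; split; [exact: measurable_cst|exact: measurable_id].
pose n t := sval (cid (image_measure (nu t) (pairm t))).
have nA (t : X) A : n t A = nu t ((fun x => (t, x)) @^-1` A) by rewrite /n; case: cid => ? [].
have nE (t : X) f : measurable_fun setT f -> (forall p, 0 <= f p)%E ->
    (\int[n t]_p f p = \int[nu t]_x f (t, x))%E.
  by rewrite /n; case: cid => ? [_ h] /=; exact: h.
pose l1 (_ : unit) : {measure set X -> \bar R} := l.
have ml1 U : measurable U -> measurable_fun setT (l1 ^~ U) by move=> _; exact: measurable_cst.
pose Hl := isKernel.Build _ _ unit X R l1 ml1.
pose l1' : R.-ker unit ~> X := HB.pack l1 Hl.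
have ul : measure_fam_uub l1.
  exists (fine (l setT) + 1) => u.
  have lT : l setT \is a fin_num by exact: fin_num_measure.
  by rewrite EFinD fineK // lteDl // lte_fin.
pose Hl' := Kernel_isFinite.Build _ _ unit X R (l1' : unit -> {measure set X -> \bar R}) ul.
pose l2 : R.-fker unit ~> X := HB.pack l1 Hl Hl'.
pose n1 (p : unit * X) : {measure set (X * Y)%type -> \bar R} := n p.2.
have mn1 U : measurable U -> measurable_fun setT (n1 ^~ U).
  move=> mU; have -> : n1 ^~ U = (fun t => k1 t (xsection U t)) \o snd.
    apply/funext => -[u t] /=; rewrite /n1 nA; congr (nu t _).
    by apply/seteqP; split => x /=; rewrite /xsection /= inE.
  apply: measurableT_comp => //.
  by apply: measurable_fun_xsection_finite_kernel; rewrite inE.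
pose Hn := isKernel.Build _ _ (unit * X)%type (X * Y)%type R n1 mn1.
pose n1' : R.-ker (unit * X)%type ~> (X * Y)%type := HB.pack n1 Hn.
have un : measure_fam_uub n1.
  exists (B + 1) => p; rewrite /n1 nA preimage_setT.
  by apply: le_lt_trans (nuB _) _; rewrite lte_fin ltrDl.
pose Hn' := Kernel_isFinite.Build _ _ (unit * X)%type (X * Y)%type R
  (n1' : unit * X -> {measure set (X * Y)%type -> \bar R}) un.
pose n2 : R.-fker (unit * X)%type ~> (X * Y)%type := HB.pack n1 Hn Hn'.
exists (mkcomp l2 n2 tt) => f mf f0; split.
  exact: (measurable_fun_integral_finite_kernel f k1).
transitivity (\int[l]_t \int[n t]_p f p)%E; first exact: (integral_kcomp l2 n2 tt f0 mf).
by apply: eq_integral => t _; exact: nE.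
Qed.

(** The diagonal image of m at radius 1 is a plan of cost 0. This serves where the extended curve is
    constant. *)
Lemma HK_refl (R : realType) (d : nat) (Omega : set 'rV[R]_d) (m : measure_on Omega) :
  closed Omega -> Omega !=set0 -> HK m m = 0%E.
Proof.
move=> cOmega Omega0; pose F (x : euclidean R d) := (cpt x 1, cpt x 1).
have mc : measurable_fun setT (fun x : euclidean R d => cpt x 1 : cone R d).
  by apply: measurable_cpt => [i|]; [exact: measurable_coord|exact: measurable_cst].
have mF : measurable_fun setT F by apply/measurable_fun_pairP; split; exact: mc.
have [g [gA gE]] := image_measure m mF.
have hg : hkplan g m m.
  have id2 (phi : euclidean R d -> \bar R) x :
      ((cone_rad (cpt x 1) ^+ 2)%:E * phi (cone_pos (cpt x 1)) = phi x)%E.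
    by rewrite cone_rad_cpt // cone_pos_cpt // expr1n mul1e.
  split => [|phi mphi phi0|phi mphi phi0].
  - by rewrite gA preimage_setT ltey_eq fin_num_measure.
  - rewrite (gE (fun p => (cone_rad p.1 ^+ 2)%:E * phi (cone_pos p.1))%E).
    + by apply: eq_integral => x _; exact: id2.
    + exact: (measurableT_comp (measurable_rad2_pos mphi) measurable_fst).
    + by move=> p; rewrite mule_ge0 // lee_fin sqr_ge0.
  - rewrite (gE (fun p => (cone_rad p.2 ^+ 2)%:E * phi (cone_pos p.2))%E).
    + by apply: eq_integral => x _; exact: id2.
    + exact: (measurableT_comp (measurable_rad2_pos mphi) measurable_snd).
    + by move=> p; rewrite mule_ge0 // lee_fin sqr_ge0.
apply/eqP; rewrite eq_le HK_ge0 andbT; apply: le_trans (HK_le_plan cOmega Omega0 hg) _.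
rewrite /plan_cost gE.
- rewrite integral0_eq ?sqrte0 // => x _; rewrite dcone2E /F /= !cone_rad_cpt // subrr enorm0.
  by rewrite /cdist2 cospi0; congr (_%:E); ring.
- by apply/measurable_EFinP; apply: measurable_dcone2; [exact: measurable_fst|exact: measurable_snd].
- by move=> p; rewrite lee_fin sqr_ge0.
Qed.

(** * Curves of measures *)

Section CurveEstimates.
Variables (R : realType) (d : nat) (Omega : set 'rV[R]_d).
Hypothesis kOmega : compact Omega.
Hypothesis Omega0 : Omega !=set0.
Local Notation leb := (@lebesgue_measure R).
Local Notation J m f := (\int[m]_(x in Omega) f x)%R.
Variables (nu : R -> measure_on Omega) (m : R -> R).
Hypothesis im : leb.-integrable setT (EFin \o m).
Hypothesis m0 : forall x, 0 <= m x.
Hypothesis hHK : forall s t, s <= t ->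
  (HK (nu s) (nu t) <= (\int[leb]_(x in `]s, t]) m x)%:E)%E.
Implicit Types (f eta : 'rV[R]_d -> R).

Let cOmega : closed Omega.
Proof. exact: compact_closed kOmega. Qed.

Definition curve_dist s t : R := fine (HK (nu s) (nu t)).
Local Notation D := curve_dist.

Lemma curve_distE s t : HK (nu s) (nu t) = (D s t)%:E.
Proof.
have fin s' t' : s' <= t' -> HK (nu s') (nu t') \is a fin_num.
  by move=> st; rewrite ge0_fin_numE ?HK_ge0 //; apply: le_lt_trans (hHK st) _; rewrite ltry.
rewrite /D fineK //; have [/fin//|/ltW/fin] := leP s t.
by rewrite HKC.
Qed.

Lemma curve_dist_ge0 s t : 0 <= D s t.
Proof. by rewrite -lee_fin -curve_distE HK_ge0. Qed.

Lemma curve_distC s t : D s t = D t s.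
Proof. by rewrite /D HKC. Qed.

Lemma curve_dist_triangle s t u : D s u <= D s t + D t u.
Proof. by rewrite -lee_fin EFinD -!curve_distE; exact: HK_triangle. Qed.

Lemma curve_dist_le s t : s <= t -> D s t <= \int[leb]_(x in `]s, t]) m x.
Proof. by move=> st; rewrite -lee_fin -curve_distE; exact: hHK. Qed.

Lemma curve_dist_small (e : R) : 0 < e ->
  exists2 a : R, 0 < a & forall s t, `|s - t| < a -> D s t < e.
Proof.
move=> e0; have [a a0 ha] := integral_itv_small im m0 e0; exists a => // s t.
have [st|ts] := leP s t.
  rewrite distrC => h; apply: le_lt_trans (curve_dist_le st) _; apply: ha => //.
  exact: le_lt_trans (ler_norm _) h.
move=> h; rewrite curve_distC; apply: le_lt_trans (curve_dist_le (ltW ts)) _.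
by apply: ha; [exact: ltW|exact: le_lt_trans (ler_norm _) h].
Qed.

Lemma curve_dist_bounded : exists2 B : R, 0 <= B & forall s t, D s t <= B.
Proof.
exists (\int[leb]_x m x); first exact: Rintegral_ge0.
have le s t : s <= t -> D s t <= \int[leb]_x m x.
  move=> st; apply: le_trans (curve_dist_le st) _.
  rewrite /Rintegral fine_le ?integrable_fin_num //; first exact: integrableS im.
  apply: ge0_subset_integral => //; first by case/integrableP: im.
  by move=> x _; rewrite lee_fin.
move=> s t; have [/le//|/ltW/le] := leP s t.
by rewrite curve_distC.
Qed.

Lemma curve_mass_bounded : exists2 B : R, 0 < B & forall t, J (nu t) (cst 1) <= B.
Proof.
have [b b0 hb] := curve_dist_bounded.
have M0 : 0 <= J (nu 0) (cst 1) by apply: Rintegral_ge0.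
exists (3 * J (nu 0) (cst 1) + 2 * b ^+ 2 + 1).
  by rewrite ltr_wpDl // addr_ge0 ?mulr_ge0 // sqr_ge0.
move=> t; have h : (HK (nu 0) (nu t) <= b%:E)%E by rewrite curve_distE lee_fin.
by have := HK_mass kOmega Omega0 h; lra.
Qed.

Lemma avg_mass_le (t M : R) f : continuous f -> (forall x, Omega x -> f x <= M) ->
  J (nu t) f <= M * J (nu t) (cst 1).
Proof.
move=> cf fM; have c1 : continuous (cst 1 : 'rV[R]_d -> R) by exact: cst_continuous.
rewrite -avgZ //; apply: avg_le => //.
  by apply: continuous_mulr => //; exact: cst_continuous.
by move=> x Ox; rewrite /= mulr1 fM.
Qed.

(** [HK_continuity] with tolerance e / (4 B), masses being at most B; near t the distance D is so
    small that c D^2 <= c D <= e / 2. *)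
Lemma curve_avg_near f (t e : R) : continuous f -> 0 < e ->
  exists2 a : R, 0 < a & forall s, `|s - t| < a -> `|J (nu s) f - J (nu t) f| <= e.
Proof.
move=> cf e0; have [B B0 hB] := curve_mass_bounded.
have k0 : 0 < e / (4 * B) by rewrite divr_gt0 // mulr_gt0.
have [c c0 hc] := HK_continuity kOmega Omega0 cf k0.
pose b := Num.min 1 (e / (2 * (c + 1))).
have c1 : 0 < 2 * (c + 1) by rewrite mulr_gt0 // ltr_wpDl.
have b0 : 0 < b by rewrite lt_min ltr01 divr_gt0.
have [a a0 ha] := curve_dist_small b0.
exists a => // s st.
have hst : (HK (nu t) (nu s) <= (D t s)%:E)%E by rewrite curve_distE.
apply: le_trans (hc _ _ _ hst) _.
have Db : D t s < b by apply: ha; rewrite distrC.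
have D0 := curve_dist_ge0 t s.
have D1 : D t s < 1 by apply: lt_le_trans Db _; rewrite ge_min lexx.
have De : D t s * (2 * (c + 1)) <= e.
  by rewrite -ler_pdivlMr //; apply: le_trans (ltW Db) _; rewrite ge_min lexx orbT.
have h1 : e / (4 * B) * (J (nu t) (cst 1) + J (nu s) (cst 1)) <= e / 2.
  have -> : e / 2 = e / (4 * B) * (2 * B) by field; rewrite gt_eqF.
  by rewrite ler_pM2l //; have := hB t; have := hB s; lra.
have h2 : c * D t s ^+ 2 <= e / 2.
  have : D t s ^+ 2 <= D t s by rewrite expr2 ler_piMl // ltW.
  by move=> /(ler_wpM2l c0); lra.
by lra.
Qed.

Lemma continuous_curve_avg f : continuous f -> continuous (fun t => J (nu t) f).
Proof.
move=> cf t; apply/cvgrPdist_le => e e0; have [a a0 ha] := curve_avg_near t cf e0.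
apply/nbhs_ballP; exists a => // s /=; rewrite /ball /= => st.
by rewrite distrC; apply: ha; rewrite distrC.
Qed.

(** With tau = D s t in [HK_C1], the terms in tau and D^2 / tau are both of order D, and the
    remainder tau D^2 is controlled by the bound b on distances. If D s t = 0, arbitrarily small tau
    are used. *)
Lemma curve_avg_lipschitz eta : C1 eta ->
  exists2 L : R, 0 <= L & forall s t, `|J (nu t) eta - J (nu s) eta| <= L * D s t.
Proof.
move=> ceta; have [B B0 hB] := curve_mass_bounded.
have [b b0 hb] := curve_dist_bounded.
have cb := continuous_energy (e := 1) ceta.
have [M M0 hM] := compact_bound kOmega cb.
have [c c0 hc] := HK_C1 kOmega Omega0 ceta ltr01.
have JB t : J (nu t) (energy 1 eta) <= M * B.
  apply: le_trans (avg_mass_le (M := M) t cb _) _.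
    by move=> x Ox; apply: le_trans (ler_norm _) (hM _ Ox).
  by rewrite ler_pM2l.
have key s t tau : 0 < tau -> `|J (nu t) eta - J (nu s) eta| <=
    tau * (2 * M * B) + ((2 * tau)^-1 + tau * c / 2) * D s t ^+ 2.
  move=> t0; have hst : (HK (nu s) (nu t) <= (D s t)%:E)%E by rewrite curve_distE.
  apply: le_trans (hc _ _ _ _ t0 hst) _; rewrite lerD2r ler_pM2l //.
  by have := JB s; have := JB t; lra.
exists (2 * M * B + 2^-1 + c * b ^+ 2 / 2).
  by rewrite !addr_ge0 ?mulr_ge0 ?sqr_ge0 ?invr_ge0 ?(ltW M0) ?(ltW B0).
move=> s t; have D0 := curve_dist_ge0 s t.
have [D00|Dn] := eqVneq (D s t) 0.
  rewrite D00 mulr0; apply/ler_addgt0Pr => e e0; rewrite add0r.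
  have k0 : 0 < 2 * M * B by rewrite !mulr_gt0.
  have := key s t (e / (2 * M * B)); rewrite divr_gt0 // => /(_ erefl).
  by rewrite D00 expr0n mulr0 addr0 divfK // gt_eqF.
have {Dn}D0' : 0 < D s t by rewrite lt_neqAle eq_sym Dn.
apply: le_trans (key s t _ D0') _.
have -> : D s t * (2 * M * B) + ((2 * D s t)^-1 + D s t * c / 2) * D s t ^+ 2 =
  (2 * M * B + 2^-1 + c * D s t ^+ 2 / 2) * D s t by field; rewrite gt_eqF.
rewrite ler_pM2r // lerD2l ler_pM2r ?invr_gt0 // ler_wpM2l //.
by rewrite ler_sqr ?nnegrE.
Qed.

Lemma curve_avg_density eta : C1 eta -> exists e : R -> R,
  [/\ leb.-integrable setT (EFin \o e),
      forall s t, s <= t -> J (nu t) eta - J (nu s) eta = \int[leb]_(x in `]s, t]) e x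
    & {ae leb, forall t, derivable (fun t => J (nu t) eta) t 1 /\
        derive1 (fun t => J (nu t) eta) t = e t}].
Proof.
move=> ceta; have [L L0 hL] := curve_avg_lipschitz ceta.
have iL : leb.-integrable setT (EFin \o (fun x => L * m x)).
  by have h := integrableZl measurableT L im; exact: (eq_integrable measurableT _ _ _ h).
have Lm0 x : 0 <= L * m x by rewrite mulr_ge0.
have hF s t : s <= t -> `|J (nu t) eta - J (nu s) eta| <= \int[leb]_(x in `]s, t]) (L * m x).
  move=> st; rewrite RintegralZl //; last exact: integrableS im.
  by apply: le_trans (hL s t) _; rewrite ler_wpM2l // curve_dist_le.
have [e [ie eE]] := abs_cont_density iL Lm0 (F := fun t => J (nu t) eta) hF.
by exists e; split => //; exact: abs_cont_derivative.
Qed.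

Definition tangent2 eta (x : 'rV[R]_d) : R := dot (grad eta x) (grad eta x) + 4 * eta x ^+ 2.

Lemma continuous_tangent2 eta : C1 eta -> continuous (tangent2 eta).
Proof.
move=> ceta; have cE := C1_continuous ceta; have cG := continuous_grad2 ceta.
apply: continuous_addr => //; apply: continuous_mulr; first exact: cst_continuous.
exact: continuous_mulr.
Qed.

(* The tangent estimate [(d/dt J eta)^2 <= v^2 J (tangent2 eta)], in the form
   given by AM-GM, which integrates in time. *)
Lemma curve_avg_derivative_le eta (t v l : R) : C1 eta -> 0 <= v ->
  (forall e, 0 < e -> exists2 a : R, 0 < a &
     forall s, `|s - t| < a -> `|D t s - v * `|s - t| | <= e * `|s - t|) ->
  derivable (fun t => J (nu t) eta) t 1 -> derive1 (fun t => J (nu t) eta) t = l ->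
  2 * l <= J (nu t) (tangent2 eta) + v ^+ 2.
Proof.
move=> ceta v0 hv dE lE.
(* The inequality with perturbed energy; e is made small at the end, through [energyE]. *)
have step1 e : 0 < e -> 2 * l <= 4 * J (nu t) (energy e eta) + v ^+ 2.
  move=> e0; have cb := continuous_energy (e := e) ceta.
  have [c c0 hc] := HK_C1 kOmega Omega0 ceta e0.
  (* K collects the errors of size u: 2 for the difference quotient and for the energy at t + h, v +
     1 for (v + u)^2 / 2, and the rest for the remainder of [HK_C1]. *)
  pose K := 2 + v + 1 + c * (v + 1) ^+ 2 / 2.
  have K0 : 0 < K.
    have : 0 <= c * (v + 1) ^+ 2 / 2 by rewrite divr_ge0 // mulr_ge0 // sqr_ge0.
    by rewrite /K; lra.
  have step2 u : 0 < u -> u <= 1 -> l <= 2 * J (nu t) (energy e eta) + v ^+ 2 / 2 + u * K.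
    move=> u0 u1.
    have [a1 a10 h1] := hv _ u0.
    have [a2 a20 h2] := derive1_near dE lE u0.
    have [a3 a30 h3] := curve_avg_near t cb u0.
    pose h := Num.min (Num.min a1 a2) (Num.min a3 u) / 2.
    have n0 : 0 < Num.min (Num.min a1 a2) (Num.min a3 u) by rewrite !lt_min a10 a20 a30 u0.
    have hn : h < Num.min (Num.min a1 a2) (Num.min a3 u) by rewrite /h; lra.
    have h0 : 0 < h by rewrite divr_gt0.
    have : [/\ h < a1, h < a2, h < a3 & h < u].
      by move: hn; rewrite !lt_min => /andP[/andP[-> ->] /andP[-> ->]].
    move=> [ha1 ha2 ha3 hu].
    have ths : `|(t + h) - t| = h by rewrite addrAC subrr add0r gtr0_norm.
    have th : (t + h) - t = h by rewrite addrAC subrr add0r.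
    have := h1 (t + h); have := h2 (t + h); have := h3 (t + h).
    rewrite ths => /(_ ha3) + /(_ ha2) + /(_ ha1); rewrite th => g3 g2 g1.
    have hst : (HK (nu t) (nu (t + h)) <= (D t (t + h))%:E)%E by rewrite curve_distE.
    (* tau is the time step h: divided by h, the bound is the energy at both times plus about v^2 /
       2. *)
    have g4 := hc _ _ _ _ h0 hst.
    have D0 := curve_dist_ge0 t (t + h).
    move: g1 g2 g3 g4 D0; move: (D t (t + h)) => Dh.
    move: (J (nu (t + h)) eta) (J (nu t) eta) => E1 E0.
    move: (J (nu (t + h)) (energy e eta)) (J (nu t) (energy e eta)) => B1 B0.
    move=> /(le_trans (ler_norm _)) g1 + /(le_trans (ler_norm _)) g3 g4 D0.
    rewrite ler_norml => /andP[g2 _].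
    have g4' := le_trans (ler_norm _) g4.
    have Dv : Dh <= (v + u) * h by rewrite mulrDl; lra.
    have D2 : Dh ^+ 2 <= (v + u) ^+ 2 * h ^+ 2.
      by rewrite -exprMn ler_sqr ?nnegrE // mulr_ge0 ?addr_ge0 // ltW.
    have kk : 0 <= (2 * h)^-1 + h * c / 2.
      by rewrite addr_ge0 ?invr_ge0 ?divr_ge0 ?mulr_ge0 // ltW.
    have := ler_wpM2l kk D2.
    have -> : ((2 * h)^-1 + h * c / 2) * ((v + u) ^+ 2 * h ^+ 2) =
      ((v + u) ^+ 2 / 2 + c * (v + u) ^+ 2 / 2 * h ^+ 2) * h by field; rewrite gt_eqF.
    move=> g5.
    have g6 : (l - u) * h <= (B0 + B1 + ((v + u) ^+ 2 / 2 + c * (v + u) ^+ 2 / 2 * h ^+ 2)) * h.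
      by lra.
    rewrite ler_pM2r // in g6.
    have g7 : (v + u) ^+ 2 <= (v + 1) ^+ 2 by rewrite ler_sqr ?nnegrE ?addr_ge0 ?(ltW u0) // lerD2l.
    have g8 : h ^+ 2 <= u.
      rewrite expr2; apply: (@le_trans _ _ (h * 1)); last by rewrite mulr1 ltW.
      by rewrite ler_pM2l // (le_trans (ltW hu)).
    have g9 : c * (v + u) ^+ 2 / 2 * h ^+ 2 <= c * (v + 1) ^+ 2 / 2 * u.
      apply: ler_pM => //.
      - by rewrite divr_ge0 // mulr_ge0 // sqr_ge0.
      - exact: sqr_ge0.
      - by rewrite ler_pM2r // ler_wpM2l.
    have g10 : (v + u) ^+ 2 / 2 <= v ^+ 2 / 2 + u * (v + 1).
      have : u ^+ 2 <= u by rewrite expr2 ler_piMl // ltW.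
      by nra.
    by rewrite /K; nra.
  suff : l <= 2 * J (nu t) (energy e eta) + v ^+ 2 / 2 by lra.
  apply/ler_addgt0Pr => a a0.
  pose u := Num.min 1 (a / K).
  have u0 : 0 < u by rewrite lt_min ltr01 divr_gt0.
  have u1 : u <= 1 by rewrite ge_min lexx.
  apply: le_trans (step2 _ u0 u1) _; rewrite lerD2l -ler_pdivlMr //.
  by rewrite ge_min lexx orbT.
have c1 : continuous (cst 1 : 'rV[R]_d -> R) by exact: cst_continuous.
have cG := continuous_grad2 ceta.
have cT := continuous_tangent2 ceta.
pose G := J (nu t) (fun x => dot (grad eta x) (grad eta x)).
pose N := J (nu t) (cst 1).
have G0 : 0 <= G by apply: Rintegral_ge0 => x _; exact: dot_ge0.
have N0 : 0 <= N by apply: Rintegral_ge0.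
have energyE e : 4 * J (nu t) (energy e eta) = J (nu t) (tangent2 eta) + e * G + (e + e ^+ 2) * N.
  have cb := continuous_energy (e := e) ceta.
  have cg : continuous (fun x => e * dot (grad eta x) (grad eta x)).
    by apply: continuous_mulr => //; exact: cst_continuous.
  have ck : continuous (fun x : 'rV[R]_d => (e + e ^+ 2) * cst 1 x).
    by apply: continuous_mulr => //; exact: cst_continuous.
  rewrite -(avgZ kOmega (nu t) 4 cb) -(avgZ kOmega (nu t) e cG) -(avgZ kOmega (nu t) _ c1) -addrA.
  rewrite -(avgD kOmega (nu t) cg ck) -(avgD kOmega (nu t) cT (continuous_addr cg ck)).
  by apply: eq_Rintegral => x _; rewrite /energy /tangent2 /=; field.
apply/ler_addgt0Pr => a a0.
have K0 : 0 < G + 2 * N + 1 by rewrite ltr_wpDl // addr_ge0 // mulr_ge0.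
pose e := Num.min 1 (a / (G + 2 * N + 1)).
have e0 : 0 < e by rewrite lt_min ltr01 divr_gt0.
have e1 : e <= 1 by rewrite ge_min lexx.
have ea : e * (G + 2 * N + 1) <= a by rewrite -ler_pdivlMr // ge_min lexx orbT.
have := step1 _ e0; rewrite energyE.
have : e ^+ 2 * N <= e * N by rewrite ler_wpM2r // expr2 ler_piMl // ltW.
by lra.
Qed.

End CurveEstimates.

Section Lift.
Variables (R : realType) (d : nat).
Implicit Types (eta theta : 'rV[R]_d -> R).

Lemma dot_row_mx n1 n2 (a a' : 'rV[R]_n1) (b b' : 'rV[R]_n2) :
  dot (row_mx a b) (row_mx a' b') = dot a a' + dot b b'.
Proof.
rewrite /dot big_split_ord /=; congr (_ + _); apply: eq_bigr => i _.
  by rewrite !row_mxEl.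
by rewrite !row_mxEr.
Qed.

(* With fields (Xi, xi) encoded as [row_mx Xi (2 xi)], the Euclidean structure of
   R^(d+1) gives |Xi|^2 + 4 xi^2 and grad eta . Xi + 4 eta xi. *)
Definition lift eta (x : 'rV[R]_d) : 'rV[R]_(d + 1) :=
  row_mx (grad eta x) (const_mx (2 * eta x)).

Lemma dot_lift eta x : dot (lift eta x) (lift eta x) = tangent2 eta x.
Proof.
rewrite /lift dot_row_mx /tangent2; congr (_ + _).
by rewrite /dot big_ord1 !mxE; ring.
Qed.

Lemma C1_lin (a : R) eta theta : C1 eta -> C1 theta ->
  C1 (fun x => a * eta x + theta x) /\
  forall x, lift (fun x => a * eta x + theta x) x = a *: lift eta x + lift theta x.
Proof.
move=> [de cde] [dt cdt].
have dl x : differentiable (fun x => a * eta x + theta x) x.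
  by apply: differentiableD => //; exact: differentiableZ.
have gE x : grad (fun x => a * eta x + theta x) x = a *: grad eta x + grad theta x.
  apply/rowP => i; rewrite !mxE.
  rewrite (@deriveD _ _ _ (fun x => a *: eta x) theta); last 2 first.
  - by apply: derivableZ; exact: diff_derivable.
  - exact: diff_derivable.
  by rewrite deriveZ //; exact: diff_derivable.
split.
  split; first exact: dl.
  move=> x; rewrite (_ : grad (fun x => a * eta x + theta x) = fun x => a *: grad eta x + grad theta x);
    last by apply/funext.
  have h : {for x, continuous (fun x => a *: grad eta x)}.
    by apply: (@continuous_comp _ _ _ (grad eta) ( *:%R a)); [exact: cde|exact: scaler_continuous].
  exact: (continuousD h (cdt x)).
move=> x; rewrite /lift gE scale_row_mx add_row_mx; congr row_mx.
by apply/rowP => i; rewrite !mxE; ring.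
Qed.

Lemma C1_cst0 : C1 (cst 0 : 'rV[R]_d -> R) /\ forall x, lift (cst 0) x = 0.
Proof.
have g0 x : grad (cst 0) x = 0 :> 'rV[R]_d by apply/rowP => i; rewrite !mxE derive_cst.
split; first split.
- by move=> x; exact: differentiable_cst.
- by rewrite (_ : grad (cst 0) = cst 0); [exact: cst_continuous|exact/funext].
move=> x; rewrite /lift g0; apply/rowP => i.
by case: (split_ordP i) => j ->; rewrite ?row_mxEl ?row_mxEr !mxE ?mulr0.
Qed.

Lemma continuous_lift eta i : C1 eta -> continuous (fun x => lift eta x 0 i).
Proof.
move=> ceta; rewrite /lift.
have := ceta.2 => cg; have cE := C1_continuous ceta.
case: (split_ordP i) => j ->.
  have -> : (fun x => row_mx (grad eta x) (const_mx (2 * eta x)) 0 (lshift 1 j)) =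
      (fun y : 'rV[R]_d => y 0 j) \o grad eta.
    by apply/funext => x; rewrite row_mxEl.
  by move=> x; apply: continuous_comp; [exact: cg|exact: coord_continuous].
have -> : (fun x => row_mx (grad eta x) (const_mx (2 * eta x)) 0 (rshift d j)) =
    (fun x => 2 * eta x).
  by apply/funext => x; rewrite row_mxEr mxE.
by apply: continuous_mulr => //; exact: cst_continuous.
Qed.

End Lift.

(** * The velocity field *)

Lemma derivable_lin (R : realType) (a : R) (F G : R -> R) t :
  derivable F t 1 -> derivable G t 1 ->
  derivable (fun s => a * F s + G s) t 1 /\
  derive1 (fun s => a * F s + G s) t = a * derive1 F t + derive1 G t.
Proof.
move=> dF dG; rewrite !derive1E.
have h := is_deriveD (is_deriveZ a (derivableP dF)) (derivableP dG).
by split; case: h.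
Qed.

Section Velocity.
Variables (R : realType) (d : nat) (Omega : set 'rV[R]_d).
Hypothesis kOmega : compact Omega.
Hypothesis Omega0 : Omega !=set0.
Local Notation leb := (@lebesgue_measure R).
Local Notation E := (euclidean R d).
Local Notation I := (`]0, 1[%classic : set R).
Local Notation J m f := (\int[m]_(x in Omega) f x)%R.
Variables (nu : R -> measure_on Omega) (m : R -> R).
Hypothesis im : leb.-integrable setT (EFin \o m).
Hypothesis im2 : leb.-integrable setT (EFin \o (fun x => m x ^+ 2)).
Hypothesis m0 : forall x, 0 <= m x.
Hypothesis hHK : forall s t, s <= t ->
  (HK (nu s) (nu t) <= (\int[leb]_(x in `]s, t]) m x)%:E)%E.
Variable v : R -> R.
Hypothesis mv : measurable_fun setT v.
Hypothesis v0m : forall t, 0 <= v t <= m t.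
Hypothesis aev : {ae leb, forall t, forall e, 0 < e -> exists2 a : R, 0 < a &
  forall s, `|s - t| < a ->
    `|curve_dist nu t s - v t * `|s - t| | <= e * `|s - t|}.
Implicit Types (eta : 'rV[R]_d -> R).

Let cOmega : closed Omega.
Proof. exact: compact_closed kOmega. Qed.

Let mI : measurable (I : set (measurableTypeR R)).
Proof. exact: measurable_itv. Qed.

Let leb_I : leb I = 1%E.
Proof. by rewrite /= lebesgue_measure_itv /= lte_fin ltr01 -EFinD subr0. Qed.

Let integral_I (c : \bar R) : (\int[leb]_(t in I) cst c t = c)%E.
Proof. by rewrite integral_cst // -[RHS]mule1; congr (_ * _)%E; exact: leb_I. Qed.

(** Lebesgue measure is restricted to ]0, 1[ to be finite, as [fibered_measure] asks; the continuity
    of averages in time makes t -> nu t A measurable. *)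
Lemma slab_measure : exists M : {measure set (R * E)%type -> \bar R},
  forall f : R * E -> \bar R, measurable_fun setT f -> (forall p, 0 <= f p)%E ->
    measurable_fun setT (fun t => \int[nu t]_x f (t, x))%E /\
    (\int[M]_p f p = \int[leb]_(t in I) \int[nu t]_x f (t, x))%E.
Proof.
have [B B0 hB] := curve_mass_bounded kOmega Omega0 im m0 hHK.
have mi : measurable_fun setT (\1_I : R -> R) by exact: measurable_indic.
have [l [lA lE]] := density_measure leb mi (fun x => ler0n _ _).
have lT : (l setT < +oo)%E.
  rewrite lA (_ : (\int[leb]_x (\1_I x)%:E)%E = 1%E) ?ltry //.
  by rewrite integral_indic // setIT; exact: leb_I.
(* Identity from [measurableTypeR R], the carrier of [leb], to R, the first factor of the slab. *)
have mid : measurable_fun setT (fun t : measurableTypeR R => t : R).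
  by move=> _ A mA; rewrite setTI.
have [l1 [l1A l1E]] := image_measure l mid.
have l1T : (l1 setT < +oo)%E by rewrite l1A preimage_setT.
have [l' l'E] := finite_measure_pack l1T.
pose nu0 t : {finite_measure set E -> \bar R} := nu t.
have nu0T t : (nu0 t setT <= B%:E)%E.
  have := avg_EFin_ge0 kOmega (nu t) (@cst_continuous _ _ (1 : R)) (fun _ => ler01).
  have -> : (\int[nu t]_x (cst 1 x)%:E)%E = nu0 t setT.
    by transitivity (\int[nu t]_x cst 1%E x)%E => //; rewrite integral_cst // mul1e.
  by move=> ->; rewrite lee_fin.
have mnu0 A : measurable A -> measurable_fun setT (fun t => nu0 t A).
  apply: measurable_family_euclidean => f cf f01.
  have -> : (fun t => \int[nu0 t]_x (f x)%:E)%E = EFin \o (fun t => J (nu t) f).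
    by apply/funext => t; rewrite /= avg_EFin_ge0 // => x; case/andP: (f01 x).
  apply/measurable_EFinP; apply: continuous_measurable_fun.
  exact: (continuous_curve_avg kOmega Omega0 im m0 hHK).
have [M hM] := fibered_measure l' mnu0 nu0T.
exists M => f mf f0; have [mF ->] := hM f mf f0; split => //.
rewrite (eq_measure_integral l1) => [|A _ _]; last exact: l'E.
have F0 t : (0 <= \int[nu t]_x f (t, x))%E by apply: integral_ge0.
rewrite l1E // lE //.
rewrite [RHS]integral_mkcond; apply: eq_integral => t _.
by rewrite patchE indicE; case: ifPn => _; rewrite ?mul1e ?mul0e.
Qed.

Section Field.
Variable M : {measure set (R * E)%type -> \bar R}.
Hypothesis hM : forall f : R * E -> \bar R, measurable_fun setT f -> (forall p, 0 <= f p)%E ->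
    measurable_fun setT (fun t => \int[nu t]_x f (t, x))%E /\
    (\int[M]_p f p = \int[leb]_(t in I) \int[nu t]_x f (t, x))%E.

Lemma slab_integral (f : R * E -> R) : M.-integrable setT (EFin \o f) ->
  (\int[M]_p (f p)%:E = \int[leb]_(t in I) \int[nu t]_x (f (t, x))%:E)%E.
Proof.
move=> jf; have mf : measurable_fun setT (EFin \o f) by case/integrableP: jf.
have mp := measurable_funepos mf; have mn := measurable_funeneg mf.
have [mP hP] := hM mp (fun p => funepos_ge0 (EFin \o f) p).
have [mN hN] := hM mn (fun p => funeneg_ge0 (EFin \o f) p).
have ge0P t : (0 <= \int[nu t]_x (EFin \o f)^\+ (t, x))%E by apply: integral_ge0.
have ge0N t : (0 <= \int[nu t]_x (EFin \o f)^\- (t, x))%E by apply: integral_ge0.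
have ltP : (\int[leb]_(t in I) \int[nu t]_x (EFin \o f)^\+ (t, x) < +oo)%E.
  by rewrite -hP; apply: integral_funepos_lt_pinfty jf.
have ltN : (\int[leb]_(t in I) \int[nu t]_x (EFin \o f)^\- (t, x) < +oo)%E.
  by rewrite -hN; apply: integral_funeneg_lt_pinfty jf.
have jP : leb.-integrable I (fun t => \int[nu t]_x (EFin \o f)^\+ (t, x))%E.
  apply/integrableP; split; first exact: measurable_funTS.
  by under eq_integral do rewrite gee0_abs //.
have jN : leb.-integrable I (fun t => \int[nu t]_x (EFin \o f)^\- (t, x))%E.
  apply/integrableP; split; first exact: measurable_funTS.
  by under eq_integral do rewrite gee0_abs //.
rewrite integralE hP hN -integralB //.
apply: eq_integral => t _; rewrite [RHS]integralE; congr (_ - _)%E;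
  by apply: eq_integral => x _; rewrite ?funeposE ?funenegE.
Qed.

(* [c] is the value at [g] of the linear functional to be represented. The test
   function [eta] may depend on the time without any regularity, so that these
   pairs are stable under restriction to a Borel set of times. *)
Definition tangent_pair (g : R * E -> 'rV[R]_(d + 1)) (c : R) : Prop :=
  [/\ coord_measurable g,
      exists K : R, forall t x, Omega x -> dot (g (t, x)) (g (t, x)) <= K
    & exists cd : R -> R, [/\ leb.-integrable I (EFin \o cd),
        c = \int[leb]_(t in I) cd t
      & {ae leb, forall t, exists eta, [/\ C1 eta, forall x, g (t, x) = lift eta x,
           derivable (fun t => J (nu t) eta) t 1 &
           derive1 (fun t => J (nu t) eta) t = cd t]}]].

Let V : R := \int[leb]_(t in I) (v t ^+ 2).

Let iv2 A : measurable A -> leb.-integrable A (EFin \o (fun t => v t ^+ 2)).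
Proof.
move=> mA; apply: integrableS measurableT mA _ _ => //.
apply: le_integrable im2 => //; first by apply/measurable_EFinP; exact: measurable_funX.
move=> t _ /=; rewrite lee_fin !ger0_norm ?sqr_ge0 // ler_sqr ?nnegrE //.
  by case/andP: (v0m t).
by case/andP: (v0m t).
Qed.

Lemma tangent_pair_integrable g c : tangent_pair g c -> square_integrable M g.
Proof.
move=> [mg [K hK] _]; apply: square_integrable_lt => //.
have [B B0 hB] := curve_mass_bounded kOmega Omega0 im m0 hHK.
have md : measurable_fun setT (fun p => (dot (g p) (g p))%:E) by exact: measurable_dot2.
have [mq ->] := hM md (fun p => dot_ge0 _).
have qK t : (\int[nu t]_x (dot (g (t, x)) (g (t, x)))%:E <= (`|K| * B)%:E)%E.
  have mgt : measurable_fun setT (fun x : E => (dot (g (t, x)) (g (t, x)))%:E).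
    exact: (measurableT_comp md (pair1_measurable t)).
  rewrite -(integral_measure_on cOmega) //; last by move=> x; rewrite lee_fin dot_ge0.
  apply: (@le_trans _ _ (\int[nu t]_(x in Omega) (cst `|K| x)%:E)%E).
    apply: ge0_le_integral.
    - exact: measurable_compact.
    - by move=> x _; rewrite lee_fin dot_ge0.
    - exact: measurable_funTS.
    - by apply/measurable_EFinP; exact: measurable_cst.
    - by move=> x Ox; rewrite lee_fin; apply: le_trans (hK t x Ox) (ler_norm _).
  rewrite avg_EFin //; last exact: cst_continuous.
  rewrite lee_fin; have -> : J (nu t) (cst `|K|) = `|K| * J (nu t) (cst 1).
    rewrite -avgZ //; last exact: cst_continuous.
    by apply: eq_Rintegral => x _ /=; rewrite mulr1.
  by rewrite ler_wpM2l.
apply: (@le_lt_trans _ _ (\int[leb]_(t in I) (cst (`|K| * B)%:E t))%E).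
  apply: ge0_le_integral => //.
  - by move=> t _; apply: integral_ge0 => x _; rewrite lee_fin dot_ge0.
  - exact: measurable_funTS.
by rewrite integral_I ltry.
Qed.

Lemma tangent_pair_lin (a : R) g c h e : tangent_pair g c -> tangent_pair h e ->
  tangent_pair (fun p => a *: g p + h p) (a * c + e).
Proof.
move=> [mg [K hK] [cd [jc -> ac]]] [mh [L hL] [ce [je -> ae_]]]; split.
- exact: coord_measurable_lin.
- exists (2 * (a ^+ 2 * K + L)) => t x Ox.
  have := dot_ge0 (a *: g (t, x) - h (t, x)).
  have := ler_wpM2l (sqr_ge0 a) (hK t x Ox); have := hL t x Ox.
  by rewrite !(dotDl, dotDr, dotNl, dotNr, dotZl, dotZr) (dotC (h (t, x))); lra.
exists (fun t => a * cd t + ce t); split.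
- have h1 := integrableD mI (integrableZl mI a jc) je.
  exact: (eq_integrable mI _ _ _ h1).
- rewrite RintegralD //; last first.
    have h1 := integrableZl mI a jc; exact: (eq_integrable mI _ _ _ h1).
  by rewrite RintegralZl.
move: ac ae_; apply: filterS2; first exact: (ae_filter_ringOfSetsType leb).
move=> t [eta [ceta gE deta <-]] [theta [ctheta hE dtheta <-]].
have [cl lE] := C1_lin a ceta ctheta.
have fE : (fun t => J (nu t) (fun x => a * eta x + theta x)) =
    fun t => a * J (nu t) eta + J (nu t) theta.
  apply/funext => s; rewrite avgD ?avgZ //.
  - exact: C1_continuous.
  - by apply: continuous_mulr; [exact: cst_continuous|exact: C1_continuous].
  - exact: C1_continuous.
have [dl ld] := derivable_lin a deta dtheta.
exists (fun x => a * eta x + theta x); split; first exact: cl.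
- by move=> x; rewrite gE hE lE.
- by rewrite fE; exact: dl.
- by rewrite fE; exact: ld.
Qed.

Lemma tangent_pair_restrict (A : set R) g c : measurable A -> tangent_pair g c ->
  exists cA, tangent_pair (fun p => (\1_A p.1 : R) *: g p) cA.
Proof.
move=> mA [mg [K hK] [cd [jc _ ac]]].
have mi : measurable_fun setT (\1_A : R -> R) by exact: measurable_indic.
exists (\int[leb]_(t in I) (\1_A t * cd t)); split.
- move=> i; under eq_fun do rewrite mxE.
  by apply: measurable_funM => //; exact: (measurableT_comp mi measurable_fst).
- exists `|K| => t x Ox; rewrite dotZl dotZr indicE.
  have := hK t x Ox; have := ler_norm K.
  by case: (_ \in _); rewrite /= ?mul1r ?mul0r //; lra.
exists (fun t => \1_A t * cd t); split => //.
  apply: (le_integrable mI _ _ jc).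
    apply/measurable_EFinP; apply: measurable_funM; first exact: measurable_funTS.
    by apply/measurable_EFinP; case/integrableP: jc.
  move=> t _ /=; rewrite lee_fin normrM indicE.
  by case: (_ \in _); rewrite /= ?normr1 ?normr0 ?mul1r ?mul0r.
move: ac; apply: filterS; first exact: (ae_filter_ringOfSetsType leb).
move=> t [eta [ceta gE deta <-]]; rewrite indicE.
have [C0 l0] := C1_cst0 R d.
have J0 : (fun t => J (nu t) (cst 0)) = cst 0.
  by apply/funext => s; rewrite /Rintegral integral0.
case: (_ \in _) => /=.
  exists eta; split; [exact: ceta| |exact: deta|by rewrite mul1r].
  by move=> x; rewrite scale1r gE.
exists (cst 0); split; first exact: C0.
- by move=> x; rewrite scale0r l0.
- by rewrite J0; exact: derivable_cst.
- by rewrite J0 mul0r derive1E derive_cst.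
Qed.

(** The tangent estimate is integrated over the times of A. At other times g = 0 forces eta = 0,
    because the last entry of [lift eta] is 2 eta, and the derivative is 0. *)
Lemma tangent_pair_le (A : set R) g c : measurable A -> tangent_pair g c ->
  (forall t x, ~ A t -> g (t, x) = 0) ->
  2 * c <= inner M g g + \int[leb]_(t in I `&` A) (v t ^+ 2).
Proof.
move=> mA Sg gA; have g2 := tangent_pair_integrable Sg.
have [mg [K hK] [cd [jc -> ac]]] := Sg.
have md : measurable_fun setT (fun p => (dot (g p) (g p))%:E) by exact: measurable_dot2.
have [mq hq] := hM md (fun p => dot_ge0 _).
have jA := iv2 (measurableI _ _ mI mA).
pose u t : \bar R := ((\1_A t * v t ^+ 2)%:E)%E.
have mi : measurable_fun setT (\1_A : R -> R) by exact: measurable_indic.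
have mu : measurable_fun setT u.
  by apply/measurable_EFinP; apply: measurable_funM => //; exact: measurable_funX.
have u0 t : (0 <= u t)%E by rewrite lee_fin mulr_ge0 // sqr_ge0.
have uE : (\int[leb]_(t in I) u t = (\int[leb]_(t in I `&` A) (v t ^+ 2))%:E)%E.
  rewrite /Rintegral fineK ?integrable_fin_num //; last exact: measurableI.
  rewrite integral_mkcondr; apply: eq_integral => t _.
  by rewrite /u patchE indicE; case: ifPn => _; rewrite ?mul1r ?mul0r.
have q0 t : (0 <= \int[nu t]_x (dot (g (t, x)) (g (t, x)))%:E)%E.
  by apply: integral_ge0 => x _; rewrite lee_fin dot_ge0.
have key : (\int[leb]_(t in I) (2 * cd t)%:E <=
    \int[leb]_(t in I) (\int[nu t]_x (dot (g (t, x)) (g (t, x)))%:E + u t))%E.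
  (* The right-hand integrand is nonnegative, so it suffices that it dominates the positive part of
     2 cd. *)
  rewrite [leLHS]integralE; apply: le_trans.
    by apply: geeDl; rewrite oppe_le0 integral_ge0.
  have mcd : measurable_fun I (EFin \o (fun t => 2 * cd t)).
    apply/measurable_EFinP; apply: measurable_funM => //.
    by apply/measurable_EFinP; case/integrableP: jc.
  apply: ae_ge0_le_integral => //.
  - exact: measurable_funepos.
  - by move=> t _; rewrite adde_ge0.
  - by apply: emeasurable_funD; exact: measurable_funTS.
  move: ac aev; apply: filterS2; first exact: (ae_filter_ringOfSetsType leb).
  move=> t [eta [ceta gE deta eE]] hv It.
  rewrite funeposE ge_max andbC adde_ge0 //=.
  have -> : (\int[nu t]_x (dot (g (t, x)) (g (t, x)))%:E = (J (nu t) (tangent2 eta))%:E)%E.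
    rewrite -avg_EFin_ge0 //; [|exact: continuous_tangent2|by move=> x; rewrite -dot_lift dot_ge0].
    by apply: eq_integral => x _; rewrite gE dot_lift.
  rewrite /u -EFinD lee_fin; have [At|nA] := pselect (A t).
    rewrite indicE mem_set // mul1r.
    have /andP[v0 _] := v0m t.
    exact: (curve_avg_derivative_le kOmega Omega0 im m0 hHK ceta v0 hv deta eE).
  rewrite indicE memNset // mul0r addr0.
  have eta0 : eta = cst 0.
    apply/funext => x; have := congr1 (fun u : 'rV[R]_(d + 1) => u 0 (rshift d 0)) (gE x).
    rewrite gA // /lift row_mxEr !mxE => /esym/eqP.
    by rewrite mulf_eq0 pnatr_eq0 /= => /eqP.
  have J0 : (fun t => J (nu t) eta) = cst 0.
    by apply/funext => s; rewrite eta0 /Rintegral integral0.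
  rewrite -eE J0 derive1E derive_cst mulr0; apply: Rintegral_ge0 => x _.
  by rewrite -dot_lift dot_ge0.
rewrite -lee_fin; apply: (@le_trans _ _ (\int[leb]_(t in I) (2 * cd t)%:E)%E).
  rewrite -RintegralZl // /Rintegral fineK // integrable_fin_num //.
  by have h1 := integrableZl mI 2 jc; exact: (eq_integrable mI _ _ _ h1).
apply: (le_trans key); rewrite ge0_integralD //; [|exact: measurable_funTS|exact: measurable_funTS].
by rewrite -hq inner_EFin // uE -EFinD.
Qed.


Lemma tangent_pair0 : tangent_pair (fun=> 0) 0.
Proof.
have [C0 l0] := C1_cst0 R d; split.
- by move=> i; exact: measurable_cst.
- by exists 0 => t x _; rewrite dot0l.
exists (cst 0); split.
- exact: integrable0.
- by rewrite /Rintegral integral0.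
have J0 : (fun t => J (nu t) (cst 0)) = cst 0.
  by apply/funext => s; rewrite /Rintegral integral0.
apply: (@aeW _ _ _ leb) => t; exists (cst 0); split; first exact: C0.
- by move=> x; rewrite l0.
- by rewrite J0; exact: derivable_cst.
- by rewrite J0 derive1E derive_cst.
Qed.

(** Scaling g by s gives 2 s c <= s^2 |g|^2 + V for every s, and s = c / |g|^2 is optimal. If |g| =
    0 and c is nonzero, s = (V + 1) / c would give 2 (V + 1) <= V. *)
Lemma tangent_pair_bound g c : tangent_pair g c -> c ^+ 2 <= V * inner M g g.
Proof.
move=> Sg; have g2 := tangent_pair_integrable Sg.
have quad (s : R) : 2 * (s * c) <= s ^+ 2 * inner M g g + V.
  have Ss := tangent_pair_lin s Sg tangent_pair0.
  have := tangent_pair_le (@measurableT _ R) Ss; rewrite setIT addr0 => /(_ _)/le_trans; apply.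
    by move=> t x [].
  rewrite lerD2r [leLHS](_ : _ = s ^+ 2 * inner M g g) //.
  rewrite /inner -RintegralZl //; last by case: g2.
  by apply: eq_Rintegral => p _; rewrite addr0 dotZl dotZr; ring.
have N0 := inner_ge0 M g; have V0 : 0 <= V by apply: Rintegral_ge0 => t _; exact: sqr_ge0.
move: N0; rewrite le_eqVlt => /orP[/eqP N0|N0].
  have [->|c0] := eqVneq c 0; first by rewrite -N0 mulr0 expr2 mulr0.
  by have := quad ((V + 1) / c); rewrite -N0 mulr0 add0r divfK //; lra.
have := quad (c / inner M g g); rewrite -(ler_pM2r N0).
have -> : 2 * (c / inner M g g * c) * inner M g g = 2 * c ^+ 2 by field; rewrite gt_eqF.
have -> : ((c / inner M g g) ^+ 2 * inner M g g + V) * inner M g g =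
  c ^+ 2 + V * inner M g g by field; rewrite gt_eqF.
by lra.
Qed.

Definition fiber_energy (w : R * E -> 'rV[R]_(d + 1)) t : \bar R :=
  (\int[nu t]_x (dot (w (t, x)) (w (t, x)))%:E)%E.

Lemma fiber_energy_ge0 w t : (0 <= fiber_energy w t)%E.
Proof. by apply: integral_ge0 => x _; rewrite lee_fin dot_ge0. Qed.

Lemma measurable_fiber_energy w : coord_measurable w ->
  measurable_fun setT (fiber_energy w) /\
  (\int[M]_p (dot (w p) (w p))%:E = \int[leb]_(t in I) fiber_energy w t)%E.
Proof.
move=> mw; have md : measurable_fun setT (fun p => (dot (w p) (w p))%:E) by exact: measurable_dot2.
by have := hM md (fun p => dot_ge0 _).
Qed.

Lemma fiber_energy_restrict (A : set R) (w : R * E -> 'rV[R]_(d + 1)) t :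
  fiber_energy (fun p => (\1_A p.1 : R) *: w p) t = (fiber_energy w \_ A) t.
Proof.
rewrite /fiber_energy patchE; case: ifPn => At.
  by apply: eq_integral => x _; rewrite indicE At scale1r.
rewrite integral0_eq // => x _.
by rewrite indicE (negbTE At) scale0r dot0l.
Qed.

Lemma coord_measurable_restrict (A : set R) (w : R * E -> 'rV[R]_(d + 1)) : measurable A -> coord_measurable w ->
  coord_measurable (fun p => (\1_A p.1 : R) *: w p).
Proof.
move=> mA mw i; under eq_fun do rewrite mxE.
have mi : measurable_fun setT (\1_A : R -> R) by exact: measurable_indic.
by apply: measurable_funM => //; exact: (measurableT_comp mi measurable_fst).
Qed.

Lemma square_integrable_restrict (A : set R) (w : R * E -> 'rV[R]_(d + 1)) : measurable A -> square_integrable M w ->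
  square_integrable M (fun p => (\1_A p.1 : R) *: w p).
Proof.
move=> mA [mw jw]; have mAw := coord_measurable_restrict mA mw; split => //.
apply: le_integrable jw => //; first exact: measurable_dot2.
move=> p _ /=; rewrite lee_fin !ger0_norm ?dot_ge0 // dotZl dotZr indicE.
by case: (_ \in _); rewrite ?mul1r ?mul0r ?dot_ge0.
Qed.

Lemma inner_restrict (A : set R) (w : R * E -> 'rV[R]_(d + 1)) : measurable A -> square_integrable M w ->
  (\int[leb]_(t in I `&` A) fiber_energy w t =
   (inner M (fun p => (\1_A p.1 : R) *: w p) (fun p => (\1_A p.1 : R) *: w p))%:E)%E.
Proof.
move=> mA w2; have Aw2 := square_integrable_restrict mA w2.
rewrite -inner_EFin //; have [_ ->] := measurable_fiber_energy Aw2.1.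
by rewrite integral_mkcondr; apply: eq_integral => t _; rewrite fiber_energy_restrict.
Qed.

(** For g close to w, testing with 1_A g gives 2 <w, 1_A g> <= |1_A g|^2 + int_A v^2, that is |1_A
    w|^2 <= |1_A (w - g)|^2 + int_A v^2. *)
Lemma fiber_energy_integral_le w (A : set R) : measurable A -> square_integrable M w ->
  (forall g c, tangent_pair g c -> c = inner M w g) ->
  (forall e : R, 0 < e -> exists g c, tangent_pair g c /\
     inner M (fun x => w x - g x) (fun x => w x - g x) <= e) ->
  (\int[leb]_(t in I `&` A) fiber_energy w t <=
   (\int[leb]_(t in I `&` A) (v t ^+ 2))%:E)%E.
Proof.
move=> mA w2 wc wg; rewrite inner_restrict //; apply/lee_addgt0Pr => e e0.
have [g [c [Sg he]]] := wg e e0; rewrite -EFinD lee_fin.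
have [cA SA] := tangent_pair_restrict mA Sg.
have gA t x : ~ A t -> (\1_A (t, x).1 : R) *: g (t, x) = 0.
  by move=> nA; rewrite indicE memNset // scale0r.
have := tangent_pair_le mA SA gA; have := wc _ _ SA.
have Aw2 := square_integrable_restrict mA w2.
have g2 := tangent_pair_integrable Sg.
have Ag2 := square_integrable_restrict mA g2.
set gg := (fun p => _ *: g p) in Ag2 *; set ww := (fun p => _ *: w p) in Aw2 *.
have -> : inner M w gg = inner M gg ww.
  apply: eq_Rintegral => p _; rewrite /gg /ww !dotZl !dotZr indicE dotC.
  by case: (_ \in _); rewrite ?mul1r ?mul0r.
move=> ->.
have h := inner_sqr_lin (-1) Ag2 Aw2.
have : inner M (fun x => -1 *: gg x + ww x) (fun x => -1 *: gg x + ww x) <=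
    inner M (fun x => w x - g x) (fun x => w x - g x).
  have := square_integrable_lin (-1) Ag2 Aw2.
  have := square_integrable_lin (-1) g2 w2.
  set u := (fun x => _); set u' := (fun x => _) => u2 u2'.
  have -> : (fun x => w x - g x) = u by apply/funext => x; rewrite /u scaleN1r addrC.
  apply: le_Rintegral => //; [by case: u2'|by case: u2|].
  move=> p _; have -> : u' p = (\1_A p.1 : R) *: u p.
    by rewrite /u' /u /gg /ww scalerDr !scalerA mulrC.
  rewrite dotZl dotZr indicE; case: (_ \in _); rewrite ?mul1r ?mul0r ?dot_ge0 //.
by rewrite h; lra.
Qed.

(** The integrated bound is applied to the set A of times where the pointwise bound fails: a
    positive function then has integral at most 0 over A in ]0, 1[, so this set is null. *)
Lemma fiber_energy_le w : square_integrable M w ->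
  (forall g c, tangent_pair g c -> c = inner M w g) ->
  (forall e : R, 0 < e -> exists g c, tangent_pair g c /\
     inner M (fun x => w x - g x) (fun x => w x - g x) <= e) ->
  {ae leb, forall t, I t -> (fiber_energy w t <= (v t ^+ 2)%:E)%E}.
Proof.
move=> w2 wc wg; have [mq qE] := measurable_fiber_energy w2.1.
have mv2 : measurable_fun setT (fun t => (v t ^+ 2)%:E).
  by apply/measurable_EFinP; exact: measurable_funX.
pose A := [set t | ((v t ^+ 2)%:E < fiber_energy w t)%E].
have mA : measurable A by rewrite -[A]setTI; exact: emeasurable_fun_lt.
have mIA : measurable (I `&` A : set (measurableTypeR R)) by exact: measurableI.
have hA := fiber_energy_integral_le mA w2 wc wg.
have jv := iv2 mIA.
have jq : leb.-integrable (I `&` A) (fiber_energy w).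
  apply/integrableP; split; first exact: measurable_funTS.
  under eq_integral do rewrite gee0_abs ?fiber_energy_ge0 //.
  by apply: le_lt_trans hA _; rewrite ltry.
have dA t : A t -> (0 < fiber_energy w t - (v t ^+ 2)%:E)%E by rewrite sube_gt0.
have d0 : (\int[leb]_(t in I `&` A) `|fiber_energy w t - (v t ^+ 2)%:E| = 0)%E.
  apply/eqP; rewrite eq_le integral_ge0 ?andbT //.
  have -> : (\int[leb]_(t in I `&` A) `|fiber_energy w t - (v t ^+ 2)%:E| =
      \int[leb]_(t in I `&` A) (fiber_energy w t - (v t ^+ 2)%:E))%E.
    by apply: eq_integral => t; rewrite inE => -[_ At]; rewrite gee0_abs // ltW // dA.
  rewrite (integralB mIA jq jv).
  rewrite sube_le0; apply: (le_trans hA).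
  by rewrite /Rintegral fineK // integrable_fin_num.
have [/(_ d0) h _] := ae_eq_integral_abs leb mIA (f := fun t => (fiber_energy w t - (v t ^+ 2)%:E)%E)
   (emeasurable_funB (measurable_funTS mq) (measurable_funTS mv2)).
have {}h : {ae leb, forall t, (I `&` A) t -> (fiber_energy w t - (v t ^+ 2)%:E = 0)%E} := h.
move: h; apply: filterS; first exact: (ae_filter_ringOfSetsType leb).
move=> t h It; rewrite leNgt; apply/negP => At.
by have := dA t At; rewrite (h (conj It At)) ltxx.
Qed.

(** The fiberwise integrals of [curve_velocity] need finite energy at every time, so w is set to 0
    at the times of infinite energy. These are negligible in ]0, 1[, so the removed part has norm 0,
    is orthogonal to every g, and the representation persists. *)
Lemma velocity_field : exists w : R * E -> 'rV[R]_(d + 1),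
  [/\ square_integrable M w,
      forall g c, tangent_pair g c -> c = inner M w g,
      forall t, (fiber_energy w t < +oo)%E
    & {ae leb, forall t, I t -> (fiber_energy w t <= (v t ^+ 2)%:E)%E}].
Proof.
have [||||w [w2 wc wg]] := @riesz_representation _ _ _ _ M tangent_pair V.
- by move=> g c Sg; exact: (tangent_pair_integrable Sg).
- by move=> a g c h e; exact: tangent_pair_lin.
- exact: tangent_pair_bound.
- by exists (fun=> 0), 0; exact: tangent_pair0.
have wae := fiber_energy_le w2 wc wg.
have [mq qE] := measurable_fiber_energy w2.1.
pose F := [set t | (fiber_energy w t < +oo)%E].
have mF : measurable F by rewrite -[F]setTI; exact: emeasurable_fun_lt.
have mFc : measurable (~` F) by exact: measurableC.
have nullF : (\int[leb]_(t in I `&` ~` F) fiber_energy w t = 0)%E.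
  have mIF : measurable (I `&` ~` F : set (measurableTypeR R)) by exact: measurableI.
  apply: null_set_integral => //; first exact: measurable_funTS.
  apply/negligibleP => //; move: wae; apply: negligibleS => t /= [It nF] /(_ It) h.
  by apply: nF; apply: le_lt_trans h _; rewrite ltry.
have Fw2 := square_integrable_restrict mF w2.
have Fcw2 := square_integrable_restrict mFc w2.
exists (fun p => (\1_F p.1 : R) *: w p); split => //.
- move=> g c Sg; rewrite (wc _ _ Sg).
  have g2 := tangent_pair_integrable Sg.
  set wF := (fun p => _) in Fw2 *; set u := (fun p => _) in Fcw2.
  have wE : w = fun p => 1 *: u p + wF p.
    apply/funext => p; rewrite /u /wF scale1r -scalerDl !indicE in_setC.
    by case: (_ \in _); rewrite ?add0r ?addr0 scale1r.
  have u0 : inner M u u = 0.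
    by have := inner_restrict mFc w2; rewrite nullF => -[].
  have quad (s : R) : 0 <= 2 * s * inner M u g + inner M g g.
    have := inner_ge0 M (fun x => s *: u x + g x).
    by rewrite inner_sqr_lin // u0 mulr0 add0r.
  have ug : inner M u g = 0.
    apply/eqP; apply: contraT => n0.
    have := quad (- (inner M g g + 1) / (2 * inner M u g)).
    have -> : 2 * (- (inner M g g + 1) / (2 * inner M u g)) * inner M u g = - (inner M g g + 1).
      by field.
    by lra.
  have := inner_lin 1 Fcw2 Fw2 g2; rewrite -wE => ->.
  by rewrite -/u ug mulr0 add0r.
- move=> t; rewrite fiber_energy_restrict patchE; case: ifPn => [|_].
    by rewrite inE.
  by rewrite [X in (X < _)%E](_ : _ = 0%E) ?ltry.
move: wae; apply: filterS; first exact: (ae_filter_ringOfSetsType leb).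
move=> t h It; rewrite fiber_energy_restrict patchE; case: ifPn => _; first exact: h.
by rewrite lee_fin sqr_ge0.
Qed.

End Field.
End Velocity.

(** * Weak formulation *)

Section Parts.
Variable R : realType.
Local Notation leb := (@lebesgue_measure R).
Implicit Types (F G f g psi : R -> R).

Definition primitive F f := leb.-integrable setT (EFin \o f) /\
  forall s t, s <= t -> F t - F s = \int[leb]_(x in `]s, t]) f x.

Lemma primitive_increment F f s t : primitive F f -> s <= t ->
  `|F t - F s| <= \int[leb]_(x in `]s, t]) `|f x|.
Proof.
move=> [jf FE] st; rewrite FE //; apply: le_normr_Rintegral => //.
exact: integrableS jf.
Qed.

Lemma integrable_abs f : leb.-integrable setT (EFin \o f) ->
  leb.-integrable setT (EFin \o (fun x => `|f x|)).
Proof. by move=> jf; exact: integrable_norm. Qed.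

Lemma primitive_continuous F f : primitive F f -> continuous F.
Proof.
move=> pF; apply: (continuous_integral_bound (integrable_abs pF.1)) => // s t st.
exact: primitive_increment.
Qed.

Lemma primitive_bounded F f : primitive F f -> exists K, forall t, `|F t| <= K.
Proof.
move=> pF; have ja := integrable_abs pF.1.
pose K := \int[leb]_x `|f x|; exists (`|F 0| + K) => t.
have incr (s u : R) : s <= u -> `|F u - F s| <= K.
  move=> su; apply: le_trans (primitive_increment pF su) _.
  rewrite /K /Rintegral fine_le ?integrable_fin_num //.
    exact: integrableS ja.
  have mj : measurable_fun setT (fun x : measurableTypeR R => `|f x|%:E) by case/integrableP: ja.
  apply: (@ge0_subset_integral _ _ _ leb) => //; exact: mj.
have : `|F t - F 0| <= K by have [/incr//|/ltW/incr] := leP 0 t; rewrite distrC.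
have := ler_normD (F t - F 0) (F 0); rewrite subrK; lra.
Qed.

Lemma integrable_bounded_mul F f : continuous F -> (exists K, forall t, `|F t| <= K) ->
  leb.-integrable setT (EFin \o f) -> leb.-integrable setT (EFin \o (fun t => F t * f t)).
Proof.
move=> cF [K hK] jf; 
have mF : measurable_fun (setT : set (measurableTypeR R)) F by exact: continuous_measurable_fun.
have h : [bounded F x | x in [set: measurableTypeR R]].
  by exists K; split; [exact: num_real|move=> M KM x _; apply: le_trans (hK x) (ltW KM)].
have := integrableMr measurableT mF h jf.
by move=> j; exact: (eq_integrable measurableT _ _ _ j).
Qed.

(** The increments of F G are bounded by integrals of b, so F G has a density. It is the derivative
    almost everywhere, which the product rule identifies with F g + G f. *)
Lemma integral_by_parts F f G g s t : primitive F f -> primitive G g -> s <= t ->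
  \int[leb]_(x in `]s, t]) (F x * g x + G x * f x) = F t * G t - F s * G s.
Proof.
move=> pF pG st.
have cF := primitive_continuous pF; have cG := primitive_continuous pG.
have [KF hF] := primitive_bounded pF; have [KG hG] := primitive_bounded pG.
have jFg := integrable_bounded_mul cF (ex_intro _ _ hF) pG.1.
have jGf := integrable_bounded_mul cG (ex_intro _ _ hG) pF.1.
have jsum : leb.-integrable setT (EFin \o (fun x => F x * g x + G x * f x)).
  have j := integrableD measurableT jFg jGf; exact: (eq_integrable measurableT _ _ _ j).
pose b x := KF * `|g x| + KG * `|f x|.
have KF0 : 0 <= KF by apply: le_trans (normr_ge0 _) (hF 0).
have KG0 : 0 <= KG by apply: le_trans (normr_ge0 _) (hG 0).
have jaf := integrable_abs pF.1; have jag := integrable_abs pG.1.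
have jb1 : leb.-integrable setT (EFin \o (fun x => KF * `|g x|)).
  have j := integrableZl measurableT KF jag; exact: (eq_integrable measurableT _ _ _ j).
have jb2 : leb.-integrable setT (EFin \o (fun x => KG * `|f x|)).
  have j := integrableZl measurableT KG jaf; exact: (eq_integrable measurableT _ _ _ j).
have jb : leb.-integrable setT (EFin \o b).
  have j := integrableD measurableT jb1 jb2; exact: (eq_integrable measurableT _ _ _ j).
have b0 x : 0 <= b x by rewrite addr_ge0 // mulr_ge0.
pose H x := F x * G x.
have HE u w : u <= w -> `|H w - H u| <= \int[leb]_(x in `]u, w]) b x.
  move=> uw; have mi : measurable (`]u, w]%classic : set (measurableTypeR R)) by exact: measurable_itv.
  have jS (h : R -> R) : leb.-integrable setT (EFin \o h) -> leb.-integrable `]u, w] (EFin \o h).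
    by move=> jh; exact: integrableS jh.
  rewrite RintegralD //; [|exact: jS|exact: jS].
  rewrite !RintegralZl //; [|exact: jS|exact: jS].
  have := primitive_increment pF uw; have := primitive_increment pG uw.
  set a1 := \int[leb]_(x in _) _; set a2 := \int[leb]_(x in _) _ => h1 h2.
  have -> : H w - H u = F w * (G w - G u) + G u * (F w - F u) by rewrite /H; ring.
  apply: le_trans (ler_normD _ _) _; rewrite !normrM.
  by apply: lerD; apply: ler_pM.
have [h [jh hE]] := abs_cont_density jb b0 HE.
have aeH := abs_cont_derivative jh hE.
have aeF := abs_cont_derivative pF.1 pF.2.
have aeG := abs_cont_derivative pG.1 pG.2.
have aeE : {ae leb, forall x, h x = F x * g x + G x * f x}.
  have aeFG : {ae leb, forall x, [/\ derivable F x 1, derive1 F x = f x,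
      derivable G x 1 & derive1 G x = g x]}.
    move: aeF aeG; apply: filterS2; first exact: (ae_filter_ringOfSetsType leb).
    by move=> x [dF Ff] [dG Gg]; split.
  move: aeH aeFG; apply: filterS2; first exact: (ae_filter_ringOfSetsType leb).
  move=> x [dH <-] [dF <- dG <-]; rewrite !derive1E.
  have hM := is_deriveM (derivableP dF) (derivableP dG).
  by case: hM.
have -> : F t * G t - F s * G s = \int[leb]_(x in `]s, t]) h x by exact: hE.
apply/esym.
rewrite /Rintegral; congr fine; apply: ae_eq_integral => //.
- by apply: measurable_funTS; case/integrableP: jh.
- by apply: measurable_funTS; case/integrableP: jsum.
move: aeE; apply: filterS; first exact: (ae_filter_ringOfSetsType leb).
by move=> x -> _.
Qed.

(** Times outside ]0, 1[ are off the closed support, so psi and its derivative vanish there; the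
    derivative, continuous on [0, 1], is integrable on R. *)
Lemma C1c01_primitive psi : C1c01 psi ->
  [/\ primitive psi (derive1 psi), psi 0 = 0 & psi 1 = 0].
Proof.
move=> [dpsi cpsi _ supp]; set Z := closure _ in supp.
have nZ t : ~ Z t -> \near t, psi t = 0.
  move=> nZt; have oZ : open (~` Z) by apply: closed_openC; exact: closed_closure.
  have : nbhs t (~` Z) by exact: open_nbhs_nbhs.
  apply: filterS => s nZs; apply: contra_notP nZs => /eqP s0.
  exact: subset_closure.
have out t : ~ (0 < t < 1) -> psi t = 0.
  move=> nt; have := nbhs_singleton (nZ t _); apply.
  by move=> /supp; rewrite /= in_itv.
have dout t : ~ (0 < t < 1) -> derive1 psi t = 0.
  move=> nt; have h : \near t, psi t = cst 0 t.
    by apply: nZ => /supp; rewrite /= in_itv.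
  by rewrite derive1E (near_eq_derive _ h) // derive_cst.
split; [|by apply: out; rewrite ltxx|by apply: out; rewrite ltxx andbF].
have cw a b : {within `[a, b], continuous (derive1 psi)} by exact: continuous_subspaceT.
have jpsi a b : leb.-integrable `[a, b] (EFin \o derive1 psi).
  by apply: continuous_compact_integrable; [exact: segment_compact|exact: cw].
split.
  have m01 : measurable (`[0, 1]%classic : set (measurableTypeR R)) by exact: measurable_itv.
  have /(integrable_mkcond _ m01) := jpsi 0 1.
  congr (is_true (integrable _ _ _)); apply/funext => t; rewrite patchE; case: ifPn => //.
  rewrite notin_setE /= in_itv => /negP nt; rewrite /= dout //.
  by move=> /andP[/ltW t0 /ltW t1]; move: nt; rewrite /= t0 t1.
move=> s t; rewrite le_eqVlt => /orP[/eqP ->|st].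
  by rewrite subrr set_itvoc0 Rintegral_set0.
have cpsi0 x : psi y @[y --> x] --> psi x.
  by apply: differentiable_continuous; apply/derivable1_diffP.
have LR : derivable_oo_LRcontinuous psi s t.
  by split; [by move=> x _|exact: cvg_at_right_filter|exact: cvg_at_left_filter].
have := continuous_FTC2 st (cw s t) LR (fun _ _ => erefl).
rewrite Rintegral_itv_obnd_cbnd.
  by rewrite /Rintegral => ->.
have ms : measurable (`]s, t]%classic : set (measurableTypeR R)) by exact: measurable_itv.
by apply: integrableS (jpsi s t) => //; apply: subset_itv; rewrite bnd_simp.
Qed.

End Parts.

Section WeakFormulation.
Variables (R : realType) (d : nat) (Omega : set 'rV[R]_d).
Hypothesis kOmega : compact Omega.
Hypothesis Omega0 : Omega !=set0.
Local Notation leb := (@lebesgue_measure R).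
Local Notation E := (euclidean R d).
Local Notation I := (`]0, 1[%classic : set R).
Local Notation J m f := (\int[m]_(x in Omega) f x)%R.
Variables (nu : R -> measure_on Omega) (m : R -> R).
Hypothesis im : leb.-integrable setT (EFin \o m).
Hypothesis im2 : leb.-integrable setT (EFin \o (fun x => m x ^+ 2)).
Hypothesis m0 : forall x, 0 <= m x.
Hypothesis hHK : forall s t, s <= t ->
  (HK (nu s) (nu t) <= (\int[leb]_(x in `]s, t]) m x)%:E)%E.
Implicit Types (psi : R -> R) (eta : 'rV[R]_d -> R).

Let cOmega : closed Omega.
Proof. exact: compact_closed kOmega. Qed.

Let mI : measurable (I : set (measurableTypeR R)).
Proof. exact: measurable_itv. Qed.


(** At a fixed time psi t is a scalar and the field is the lift of psi t * eta, so the value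
    involves the derivative e of the average of eta and none of psi. The summand [cst 0] gives this
    function the form of [C1_lin]. *)
Lemma tangent_pair_product psi eta (e : R -> R) : continuous psi ->
  (exists K, forall t, `|psi t| <= K) -> C1 eta -> leb.-integrable setT (EFin \o e) ->
  {ae leb, forall t, derivable (fun t => J (nu t) eta) t 1 /\
     derive1 (fun t => J (nu t) eta) t = e t} ->
  tangent_pair nu (fun p => psi p.1 *: lift eta p.2) (\int[leb]_(t in I) (psi t * e t)).
Proof.
move=> cpsi [K hK] ceta je ae_e; split.
- move=> i; under eq_fun do rewrite mxE.
  apply: measurable_funM.
    exact: (measurableT_comp (continuous_measurable_fun cpsi) measurable_fst).
  have ml : measurable_fun setT (fun x : E => lift eta x 0 i).
    by apply: continuous_measurable_euclidean; exact: continuous_lift.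
  exact: (measurableT_comp ml measurable_snd).
- have [L L0 hL] := compact_bound kOmega (continuous_tangent2 ceta).
  exists (K ^+ 2 * L) => t x Ox; rewrite dotZl dotZr dot_lift mulrA.
  have K0 : 0 <= K by apply: le_trans (normr_ge0 _) (hK t).
  have h1 : psi t * psi t <= K ^+ 2.
    by rewrite -expr2 -real_normK ?num_real // ler_sqr ?nnegrE.
  apply: ler_pM => //; first by rewrite -expr2 sqr_ge0.
    by rewrite -dot_lift dot_ge0.
  exact: le_trans (ler_norm _) (hL x Ox).
exists (fun t => psi t * e t); split => //.
  by apply: integrableS (integrable_bounded_mul cpsi (ex_intro _ K hK) je).
move: ae_e; apply: filterS; first exact: (ae_filter_ringOfSetsType leb).
move=> t [deta <-]; have [C0 l0] := C1_cst0 R d.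
have [Ce lE] := C1_lin (psi t) ceta C0.
have fE : (fun s => J (nu s) (fun x => psi t * eta x + cst 0 x)) =
    fun s => psi t * J (nu s) eta + cst 0 s.
  apply/funext => s; rewrite -avgZ //; last exact: C1_continuous.
  by rewrite addr0; apply: eq_Rintegral => x _; rewrite addr0.
have [dl ld] := derivable_lin (psi t) deta (derivable_cst (0 : R) t 1).
exists (fun x => psi t * eta x + cst 0 x); split; first exact: Ce.
- by move=> x; rewrite lE l0 addr0.
- by rewrite fE; exact: dl.
- by rewrite fE ld derive1_cst addr0.
Qed.

(** The pairing of w with psi (grad eta, 2 eta) is the integral of psi e. Integration by parts turns
    it into minus the integral of psi' J eta, psi being 0 at both ends. *)
Lemma curve_velocity : exists (w : R * E -> 'rV[R]_(d + 1)) (v : R -> R),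
  [/\ coord_measurable w, forall t, 0 <= v t,
      {ae leb, forall t, forall e, 0 < e -> exists2 a : R, 0 < a &
        forall s, `|s - t| < a ->
          `|curve_dist nu t s - v t * `|s - t| | <= e * `|s - t|},
      {ae leb, forall t, I t ->
        (\int[nu t]_x (dot (w (t, x)) (w (t, x)))%:E <= (v t ^+ 2)%:E)%E}
    & forall psi eta, C1c01 psi -> C1 eta ->
        (\int[leb]_(t in I) (derive1 psi t * J (nu t) eta)%:E =
         - \int[leb]_(t in I)
             ((psi t)%:E * \int[nu t]_x (dot (w (t, x)) (lift eta x))%:E))%E].
Proof.
have [v [mv v0m aev]] : exists v : R -> R,
  [/\ measurable_fun setT v, forall t, 0 <= v t <= m t
    & {ae leb, forall t, forall e, 0 < e -> exists2 a : R, 0 < a &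
        forall s, `|s - t| < a ->
          `|curve_dist nu t s - v t * `|s - t| | <= e * `|s - t|}].
  apply: metric_speed => //.
  - by move=> s t; exact: curve_distC.
  - by move=> s t u; exact: (curve_dist_triangle kOmega Omega0 hHK).
  - by move=> s t; exact: (curve_dist_le kOmega Omega0 hHK).
have [M hM] := slab_measure kOmega Omega0 im m0 hHK.
have [w [w2 wc wfin wv]] := velocity_field kOmega Omega0 im im2 m0 hHK mv v0m aev hM.
exists w, v; split => //; [by case: w2|by move=> t; case/andP: (v0m t)|].
move=> psi eta cpsi ceta.
have [pp psi0 psi1] := C1c01_primitive cpsi.
have [e [je eE aee]] := curve_avg_density kOmega Omega0 im m0 hHK ceta.
have pE : primitive (fun t => J (nu t) eta) e by split.
have Sg := tangent_pair_product (primitive_continuous pp) (primitive_bounded pp) ceta je aee.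
have g2 := tangent_pair_integrable kOmega Omega0 im m0 hHK hM Sg.
have cI := wc _ _ Sg; have jwg := integrable_dot w2 g2.
have jpe := integrable_bounded_mul (primitive_continuous pp) (primitive_bounded pp) je.
have jdp := integrable_bounded_mul (primitive_continuous pE) (primitive_bounded pE) pp.1.
have inn : (\int[leb]_(t in I)
     ((psi t)%:E * \int[nu t]_x (dot (w (t, x)) (lift eta x))%:E) =
   (\int[leb]_(t in I) (psi t * e t))%:E)%E.
  rewrite cI /inner /Rintegral fineK; last by apply: integrable_fin_num jwg.
  rewrite (slab_integral hM jwg); apply: eq_integral => t _.
  have mwt i : measurable_fun setT (fun x : E => w (t, x) 0 i).
    exact: (measurableT_comp (w2.1 i) (pair1_measurable t)).
  have wt2 : square_integrable (nu t) (fun x => w (t, x)).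
    by apply: square_integrable_lt => //; exact: wfin.
  have lt2 : square_integrable (nu t) (lift eta).
    apply: square_integrable_lt.
      by move=> i; apply: continuous_measurable_euclidean; exact: continuous_lift.
    rewrite (_ : (\int[nu t]_x _)%E = (J (nu t) (tangent2 eta))%:E) ?ltry //.
    rewrite -avg_EFin_ge0 //; [|exact: continuous_tangent2|by move=> x; rewrite -dot_lift dot_ge0].
    by apply: eq_integral => x _; rewrite dot_lift.
  rewrite -(integralZl measurableT (integrable_dot wt2 lt2)).
  by apply: eq_integral => x _ /=; rewrite dotZr EFinM.
rewrite inn -EFinN.
have mI' : leb.-integrable I (EFin \o (fun t => J (nu t) eta * derive1 psi t)).
  by apply: integrableS jdp.
have mI'' : leb.-integrable I (EFin \o (fun t => psi t * e t)).
  by apply: integrableS jpe.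
have parts := integral_by_parts pE pp (ler01 : (0 : R) <= 1).
rewrite -Rintegral_itv_bndo_bndc in parts; last first.
  by have j := integrableD mI mI' mI''; exact: (eq_integrable mI _ _ _ j).
move: parts; rewrite RintegralD // psi0 psi1 !mulr0 subrr => /eqP.
rewrite addr_eq0 => /eqP <-.
rewrite /Rintegral fineK; last exact: integrable_fin_num.
by apply: eq_integral => t _; rewrite mulrC.
Qed.

End WeakFormulation.

(** * Extension of the curve to all times, and conclusion *)

Definition clamp (R : realType) (t : R) : R := Num.max 0 (Num.min t 1).

Lemma clamp_id (R : realType) (t : R) : 0 <= t <= 1 -> clamp t = t.
Proof. by move=> /andP[t0 t1]; rewrite /clamp (min_idPl t1) (max_idPr t0). Qed.

Lemma clamp_le (R : realType) (s t : R) : s <= t -> clamp s <= clamp t.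
Proof. by move=> st; rewrite /clamp le_max2 // le_min2. Qed.

Lemma clamp_itv (R : realType) (t : R) : 0 <= clamp t <= 1.
Proof. by rewrite /clamp le_max lexx /= ge_max ler01 ge_min lexx orbT. Qed.

Lemma clamp_lt (R : realType) (s t : R) : clamp s < clamp t -> s <= clamp s /\ clamp t <= t.
Proof.
move=> st; have /andP[s0 _] := clamp_itv s; have /andP[_ t1] := clamp_itv t; split.
  have [s1|s1] := leP s 1; first by rewrite /clamp (min_idPl s1) le_max lexx orbT.
  by have := lt_le_trans st t1; rewrite /clamp (min_idPr (ltW s1)) (max_idPr ler01) ltxx.
have [t0|t0] := leP 0 t; first by rewrite /clamp ge_max t0 ge_min lexx.
have := le_lt_trans s0 st; rewrite /clamp (max_idPl _) ?ltxx //.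
by rewrite ge_min (ltW t0).
Qed.

Section AC2.
Variables (R : realType) (d : nat) (Omega : set 'rV[R]_d).
Hypothesis kOmega : compact Omega.
Hypothesis Omega0 : Omega !=set0.
Variable mu : R -> measure_on Omega.
Local Notation leb := (@lebesgue_measure R).
Local Notation I := (`]0, 1[%classic : set R).

(** m is |n| on ]0, 1[ and 0 elsewhere, integrable because m <= 1 + m^2. The clamped interval lies
    in both ]s, t] and ]0, 1[ when it is not reduced to a point; otherwise [HK_refl] applies. *)
Lemma AC2_clamp : AC2 (@HK R d Omega) mu -> exists m : R -> R,
  [/\ leb.-integrable setT (EFin \o m),
      leb.-integrable setT (EFin \o (fun t => m t ^+ 2)),
      forall t, 0 <= m t
    & forall s t, s <= t -> (HK (mu (clamp s)) (mu (clamp t)) <=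
        (\int[leb]_(x in `]s, t]) m x)%:E)%E].
Proof.
move=> [n [mn n2 hn]].
have mI : measurable (I : set (measurableTypeR R)) by exact: measurable_itv.
pose m : R -> R := (fun t => `|n t|) \_ I.
have mE t : I t -> m t = `|n t| by move=> It; rewrite /m patchE mem_set.
have mN t : ~ I t -> m t = 0 by move=> It; rewrite /m patchE memNset.
have m0 t : 0 <= m t.
  by have [It|nIt] := pselect (I t); [rewrite mE|rewrite mN].
have mm : measurable_fun (setT : set (measurableTypeR R)) m.
  apply/(measurable_restrictT _ mI).
  exact: measurableT_comp.
have mm2 : measurable_fun (setT : set (measurableTypeR R)) (fun t => m t ^+ 2).
  exact: measurable_funX.
have jm2 : leb.-integrable setT (EFin \o (fun t => m t ^+ 2)).
  apply/integrableP; split; first exact/measurable_EFinP.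
  rewrite (_ : (\int[leb]_t _)%E = (\int[leb]_(t in I) (`|n t| ^+ 2)%:E)%E) //.
  rewrite [RHS]integral_mkcond; apply: eq_integral => t _ /=.
  rewrite ger0_norm ?sqr_ge0 // patchE; case: ifPn => [/set_mem It|nIt]; first by rewrite mE.
  by rewrite mN ?expr2 ?mulr0 // => It; move: nIt; rewrite mem_set.
have j1 : leb.-integrable setT (fun t => (\1_I t)%:E) by exact: integrable_indic_itv.
have jm : leb.-integrable setT (EFin \o m).
  apply: (le_integrable measurableT _ _ (integrableD measurableT j1 jm2)).
    exact/measurable_EFinP.
  move=> t _ /=; rewrite lee_fin indicE.
  have [It|nIt] := pselect (I t).
    rewrite mem_set // !ger0_norm ?addr_ge0 ?sqr_ge0 //=.
    by have := sqr_ge0 (m t - 1); have := m0 t; nra.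
  by rewrite mN // normr0.
exists m; split => // s t st.
have js : leb.-integrable `]s, t] (EFin \o m) by exact: integrableS jm.
have -> : ((\int[leb]_(x in `]s, t]) m x)%:E = \int[leb]_(x in `]s, t]) (m x)%:E)%E.
  by rewrite /Rintegral fineK // integrable_fin_num.
have := clamp_le st; rewrite le_eqVlt => /orP[/eqP->|ab].
  rewrite HK_refl //; last exact: compact_closed.
  by apply: integral_ge0 => x _; rewrite lee_fin.
have [sa bt] := clamp_lt ab.
have /andP[a0 _] := clamp_itv s; have /andP[_ b1] := clamp_itv t.
apply: (le_trans (hn _ _ a0 ab b1)).
have mab : measurable (`]clamp s, clamp t[%classic : set (measurableTypeR R)) by exact: measurable_itv.
have sub : `]clamp s, clamp t[%classic `<=` I.
  move=> x /=; rewrite !in_itv /= => /andP[x1 x2].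
  by rewrite (le_lt_trans a0 x1) (lt_le_trans x2 b1).
have mnab : measurable_fun (`]clamp s, clamp t[ : set (measurableTypeR R)) (EFin \o n).
  by apply/measurable_EFinP; apply: measurable_funS mn.
apply: (le_trans (lee_abs _)); apply: (le_trans (le_abse_integral leb mab mnab)).
rewrite [leLHS](_ : _ = (\int[leb]_(x in `]clamp s, clamp t[) (m x)%:E)%E); last first.
  by apply: eq_integral => x /set_mem /sub Ix; rewrite /= mE.
apply: (@ge0_subset_integral _ _ _ leb) => //.
- by case/integrableP: js.
- by move=> x _; rewrite lee_fin.
move=> x /=; rewrite !in_itv /= => /andP[x1 x2].
by rewrite (le_lt_trans sa x1) (ltW (lt_le_trans x2 bt)).
Qed.

Lemma metric_derivativeE (v t : R) : 0 < t < 1 ->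
  (forall s, 0 <= s <= 1 -> HK (mu t) (mu s) \is a fin_num) ->
  (forall e, 0 < e -> exists2 a : R, 0 < a & forall s, 0 <= s <= 1 -> `|s - t| < a ->
     `|fine (HK (mu t) (mu s)) - v * `|s - t| | <= e * `|s - t|) ->
  metric_derivative (@HK R d Omega) mu t = v%:E.
Proof.
move=> /andP[t0 t1] fin hv; rewrite /metric_derivative; apply: cvg_lim.
- exact: ereal_hausdorff.
(* Uniqueness of the limit needs a proper filter: t < 1 provides the times t + a / 2 of [0, 1] near
   t. *)
- apply: Build_ProperFilter => /nbhs_ballP[e /= e0 he].
  pose a := Num.min e (1 - t); have a0 : 0 < a by rewrite lt_min e0 subr_gt0.
  have ae : a <= e by rewrite ge_min lexx.
  have at1 : a <= 1 - t by rewrite ge_min lexx orbT.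
  apply: (he (t + a / 2)).
  + rewrite /ball /= opprD addrA subrr add0r normrN gtr0_norm; lra.
  + by apply/eqP; lra.
  + by rewrite /= in_itv /=; apply/andP; split; lra.
apply: cvg_EFin.
- apply/nbhs_ballP; exists 1 => //= s _ st; rewrite in_itv /= => s01.
  by rewrite fin_numM // fin.
apply/cvgrPdist_le => e e0; have [a a0 ha] := hv e e0.
apply/nbhs_ballP; exists a => //= s ts st; rewrite in_itv /= => s01.
have n0 : 0 < `|t - s| by rewrite normr_gt0 subr_eq0 eq_sym.
have := ha s s01; rewrite distrC => /(_ ts) h.
rewrite fineM ?fin //= -(ler_pM2r n0) -[X in _ * X]normr_id -normrM.
rewrite mulrBl mulfVK ?gt_eqF //.
by rewrite distrC.
Qed.

End AC2.

Lemma integral_measure_on_signed (R : realType) (d : nat) (Omega : set 'rV[R]_d)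
    (m : measure_on Omega) (f : euclidean R d -> \bar R) : closed Omega ->
  measurable_fun setT f -> (\int[m]_(x in Omega) f x = \int[m]_x f x)%E.
Proof.
move=> cOmega mf; rewrite integralE [RHS]integralE.
rewrite (integral_measure_on cOmega _ (measurable_funepos mf)) //.
by rewrite (integral_measure_on cOmega _ (measurable_funeneg mf)).
Qed.

Theorem theorem4p5 (R : realType) (d : nat) (Omega : set 'rV[R]_d)
    (Omega_convex : convex_set (Omega : set (convex_lmodType 'rV[R]_d)))
    (Omega_compact : compact Omega)
    (mu : R -> measure_on Omega) (mu_AC2 : AC2 (@HK R d Omega) mu) :
  exists (Xi : R -> 'rV[R]_d -> 'rV[R]_d) (xi : R -> 'rV[R]_d -> R),
    [/\ borel_field Omega Xi xi,
        continuity_equation mu Xi xi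
      & {ae lebesgue_measure, forall t : R, t \in `[0, 1] ->
          (\int[mu t]_(x in Omega) (enorm (Xi t x) ^+ 2 + 4 * `|xi t x| ^+ 2)%:E
           <= metric_derivative (@HK R d Omega) mu t ^+ 2)%E}].
Proof.
(* The estimates on plans pick a point of Omega. If Omega is empty all integrals vanish and zero
   fields suffice. *)
have [Oe|/set0P Omega0] := eqVneq Omega set0.
  have emp (n : measure_on Omega) f : (\int[n]_(x in Omega) f x = 0)%E.
    by apply: integral0_eq => x; rewrite Oe.
  exists (fun _ _ => 0), (fun _ _ => 0); split.
  - exact: measurable_cst.
  - move=> psi eta _ _; rewrite integral0_eq ?integral0_eq ?oppe0 // => t _.
      by rewrite emp mule0.
    by rewrite emp mule0.
  - apply: aeW => t _; rewrite emp.
    (* The square is nonnegative whatever the value of the derivative: finite, infinite or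
       default. *)
    by case: (metric_derivative _ _ _) => [r||] //=; rewrite lee_fin sqr_ge0.
have cOmega : closed Omega by exact: compact_closed.
have [m [jm jm2 m0 hm]] := AC2_clamp Omega_compact Omega0 mu_AC2.
pose nu t := mu (clamp t).
have nuE t : 0 <= t <= 1 -> nu t = mu t by move=> t01; rewrite /nu clamp_id.
have hHK s t : s <= t -> (HK (nu s) (nu t) <= (\int[lebesgue_measure]_(x in `]s, t]) m x)%:E)%E.
  exact: hm.
have [w [v [mw v0 hv wv cw]]] := curve_velocity Omega_compact Omega0 jm jm2 m0 hHK.
(* The last coordinate of w encodes 2 xi. *)
pose xi (t : R) (x : 'rV[R]_d) : R := rsubmx (w (t, x)) 0 0 / 2.
exists (fun t x => lsubmx (w (t, x))), xi.
have wE t x : w (t, x) = row_mx (lsubmx (w (t, x))) (const_mx (2 * xi t x)).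
  rewrite -[LHS]hsubmxK; congr row_mx; apply/rowP => i.
  by rewrite [RHS]mxE /xi ord1; field.
have dotE t x u r : dot (w (t, x)) (row_mx u (const_mx r)) =
    dot (lsubmx (w (t, x))) u + 2 * r * xi t x.
  by rewrite wE dot_row_mx row_mxKl /dot big_ord1 !mxE; congr (_ + _); ring.
have mwt t i : measurable_fun setT (fun x : euclidean R d => w (t, x) 0 i).
  exact: (measurableT_comp (mw i) (pair1_measurable t)).
split.
- apply: measurable_funTS; apply/measurable_fun_pairP; split.
    apply: measurable_fun_euclidean => i /=; under eq_fun do rewrite mxE.
    by under eq_fun do rewrite -surjective_pairing; exact: mw.
  rewrite /xi; apply: measurable_funM; last exact: measurable_cst.
  under eq_fun do rewrite mxE -surjective_pairing; exact: mw.
- move=> psi eta cpsi ceta; have := cw psi eta cpsi ceta.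
  have ceta0 := C1_continuous ceta.
  rewrite [X in X = _ -> _](_ : _ = \int[lebesgue_measure]_(t in `]0%R, 1%R[)
       ((derive1 psi t)%:E * \int[mu t]_(x in Omega) (eta x)%:E))%E; last first.
    apply: eq_integral => t /set_mem /=; rewrite in_itv /= => /andP[t0 t1].
    by rewrite nuE ?(ltW t0) ?(ltW t1) // avg_EFin.
  move=> ->; congr (- _)%E; apply: eq_integral => t /set_mem /=.
  rewrite in_itv /= => /andP[t0 t1]; rewrite nuE ?(ltW t0) ?(ltW t1) //.
  rewrite -(integral_measure_on_signed _ cOmega).
    congr (_ * _)%E; apply: eq_integral => x _; congr (_%:E).
    by rewrite /lift dotE dotC; ring.
  apply: measurable_dot2 => // i.
  by apply: continuous_measurable_euclidean; exact: continuous_lift.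
(* The energy bound and [metric_derivativeE] concern ]0, 1[; the endpoints form a null set. *)
have aeb : {ae lebesgue_measure, forall t : R, t != 0 /\ t != 1}.
  exists [set 0; 1]; split.
  - by apply: measurableU; exact: measurable_set1.
  - by apply: countable_lebesgue_measure0; apply: finite_set_countable.
  move=> t /= /not_andP[/negP|/negP]; rewrite negbK => /eqP ->; [by left|by right].
have aebw : {ae lebesgue_measure, forall t : R, (t != 0 /\ t != 1) /\
    (`]0, 1[%classic t -> (\int[nu t]_x (dot (w (t, x)) (w (t, x)))%:E <= (v t ^+ 2)%:E)%E)}.
  move: aeb wv; apply: filterS2; first exact: (ae_filter_ringOfSetsType lebesgue_measure).
  by move=> t.
move: hv aebw; apply: filterS2; first exact: (ae_filter_ringOfSetsType lebesgue_measure).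
move=> t hvt [[t0 t1] wvt]; rewrite in_itv /= => t01; have /andP[t0' t1'] := t01.
have It : 0 < t < 1 by rewrite !lt_neqAle eq_sym t0 t1 t0' t1'.
have -> : metric_derivative (@HK R d Omega) mu t = (v t)%:E.
  apply: metric_derivativeE => // [s s01|e e0].
    by rewrite -(nuE t) // -(nuE s) // (curve_distE Omega_compact Omega0 hHK).
  have [a a0 ha] := hvt e e0; exists a => // s s01 st.
  by rewrite -(nuE t) // -(nuE s) //; exact: ha.
rewrite -EFinM -expr2; apply: le_trans (wvt _); last by rewrite /= in_itv.
rewrite nuE // -(integral_measure_on_signed _ cOmega).
  rewrite le_eqVlt; apply/orP; left; apply/eqP; apply: eq_integral => x _; congr (_%:E).
  have -> : dot (w (t, x)) (w (t, x)) =
      dot (w (t, x)) (row_mx (lsubmx (w (t, x))) (const_mx (2 * xi t x))) by rewrite -wE.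
  by rewrite dotE enorm_sqr real_normK ?num_real //; ring.
exact: measurable_dot2.
Qed.
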